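(* Let $d\ge1$ and let $(\rho,u)$ be a global-in-time classical solution of $$\partial_t\rho+\nabla\cdot(\rho u)=0,\qquad \partial_t(\rho u)+\nabla\cdot(\rho u\otimes u)=-\rho\,(\nabla W\star\rho)-\rho\int_{\mathbb R^d}\psi(x-y)\,(u(t,x)-u(t,y))\,\rho(t,y)\,dy$$ on $\mathbb R_+\times\mathbb R^d$ with initial data $(\rho_0,u_0)$. Suppose that $W\in C^1(\mathbb R^d,\mathbb R)$ satisfies, for some constants $0<\lambda\le\Lambda<\infty$, $$\lambda|x-y|^2\le\langle\nabla W(x)-\nabla W(y),x-y\rangle\le\Lambda|x-y|^2\qquad\text{for all }x,y\in\mathbb R^d,$$ and that there is $\psi_{\rm m}>0$ such that $\psi(x)\ge\psi_{\rm m}$ for all $x\in\mathbb R^d$. Then: (i) If $\psi$ is bounded from above, then $${\rm d}_2(\rho(t),\delta_{\eta_c(t)})+\|u(t,\cdot)-u_\infty\|_{L^2(\rho(t))}\to0$$ exponentially fast as $t\to\infty$. (ii) If there are $\alpha\in(0,2)$, $R>0$ and $B>0$ with $\psi(x)\le\dfrac{B}{|x|^\alpha}$ for all $0\le|x|\le R$, then $${\rm d}_2(\rho(t),\delta_{\eta_c(t)})+\|u(t,\cdot)-u_\infty\|_{L^2(\rho(t))}=\mathcal O\Big(t^{-(\frac1\alpha-\frac12)}\Big)\qquad\text{as }t\to\infty.$$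
   Context: Standing assumptions: $W$ is symmetric, $W(x)=W(-x)$. The communication weight is $\psi(x)=\phi(|x|)$ with $\phi$ nonnegative and nonincreasing on $(0,\infty)$ (possibly singular at $0$ in case (ii), where bounds are understood for $x\neq0$). $\rho\ge0$ is a probability density: $\|\rho(t)\|_{L^1}=1$ for all $t\ge0$ (mass is conserved). ''Global-in-time classical solution'' means that $(\rho,u)$ is defined for all $t\ge0$ and is regular enough for the equations to hold in the classical sense, for the quantities appearing in the statement and in the basic energy identities to be well defined and finite, and for the forward characteristics $\partial_t\eta(t,x)=u(t,\eta(t,x))$, $\eta(0,x)=x$, $x\in\mathrm{supp}(\rho_0)$, to be well defined, with $\rho(t)=\eta(t,\cdot)\#\rho_0$. Notation: $\eta_c(t):=\int_{\mathbb R^d}x\,\rho(t,x)\,dx$; $u_\infty:=\int_{\mathbb R^d}\rho_0u_0\,dx$; $\|f\|_{L^2(\rho(t))}^2=\int|f|^2\rho(t,x)\,dx$; ${\rm d}_2(\mu,\nu):=\inf_{\pi\in\Pi(\mu,\nu)}\big(\iint|x-y|^2d\pi\big)^{1/2}$, with $\Pi(\mu,\nu)$ the couplings of the probability measures $\mu,\nu$ with finite second moment. ''$f(t)\to0$ exponentially fast'' means $f(t)\le Ce^{-ct}$ for all $t\ge0$ for some $C,c>0$ independent of $t$. $f=\mathcal O(g)$ as $t\to\infty$ means $f(t)\le Cg(t)$ for some $C>0$ and all large $t$. *)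

(* Defs.v *)
From HB Require Import structures.
From mathcomp Require Import all_boot all_order all_algebra.
From mathcomp Require Import all_classical all_reals all_analysis.

Set Implicit Arguments.
Unset Strict Implicit.
Unset Printing Implicit Defensive.

Import Order.TTheory GRing.Theory Num.Theory.
Import numFieldNormedType.Exports.

Local Open Scope classical_set_scope.
Local Open Scope ring_scope.

(* 'rV[R]_n carries the sigma-algebra generated by its coordinates. *)

Definition rV_display : measure_display.
Proof. exact: default_measure_display. Qed.

Section measurable_rV.
Context {R : realType} (n : nat).

Let coors : 'I_n -> 'rV[R]_n -> R := fun i x => x 0 i.

Let rV_set0 : g_sigma_preimage coors set0.
Proof. exact: sigma_algebra0. Qed.

Let rV_setC A : g_sigma_preimage coors A -> g_sigma_preimage coors (~` A).
Proof. exact: sigma_algebraC. Qed.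

Let rV_bigcup (F : _^nat) : (forall i, g_sigma_preimage coors (F i)) ->
  g_sigma_preimage coors (\bigcup_i (F i)).
Proof. exact: sigma_algebra_bigcup. Qed.

HB.instance Definition _ :=
  @isMeasurable.Build rV_display 'rV[R]_n (g_sigma_preimage coors) rV_set0 rV_setC rV_bigcup.

Lemma measurable_coor (i : 'I_n) :
  measurable_fun [set: 'rV[R]_n] (fun x => x 0 i).
Proof.
move=> _ Y mY; rewrite setTI; apply: sub_sigma_algebra => /=.
rewrite -bigcup_seq/=; exists i => /=; first by rewrite mem_index_enum.
by exists Y => //; rewrite setTI.
Qed.

Lemma measurable_fun_rVP d (T : measurableType d) (f : T -> 'rV[R]_n) :
  measurable_fun [set: T] f <->
  forall i, measurable_fun [set: T] (fun t => f t 0 i).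
Proof.
split=> [mf i|mf].
  by apply: (measurableT_comp (measurable_coor i) mf).
move=> _ A mA; rewrite setTI.
have : preimage_set_system setT f (g_sigma_preimage coors) (f @^-1` A).
  by exists A => //; rewrite setTI.
rewrite -g_sigma_preimage_comp; apply: smallest_sub.
  exact: sigma_algebra_measurable.
rewrite -bigcup_seq => _ [i /= _] [B mB <-]; exact: mf.
Qed.

End measurable_rV.

Section lebesgue_rV.
Context {R : realType}.

Definition cons_rV n (p : measurableTypeR R * 'rV[R]_n) : 'rV[R]_n.+1 :=
  row_mx (p.1 : R)%:M p.2.

Definition uncons_rV n (x : 'rV[R]_n.+1) : measurableTypeR R * 'rV[R]_n :=
  (x 0 0, @rsubmx R 1 1 n x).

Lemma cons_rV0 n (p : measurableTypeR R * 'rV[R]_n) : cons_rV p 0 ord0 = p.1.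
Proof.
rewrite /cons_rV mxE; case: splitP => //= j _.
by rewrite ord1 mxE eqxx mulr1n.
Qed.

Lemma cons_rVS n (p : measurableTypeR R * 'rV[R]_n) i :
  cons_rV p 0 (lift ord0 i) = p.2 0 i.
Proof.
rewrite /cons_rV mxE; case: splitP => j /=; rewrite /bump/= add1n.
  by rewrite ord1.
by rewrite add1n => -[ij]; congr (p.2 _ _); apply/val_inj.
Qed.

Lemma cons_rVK n : cancel (@cons_rV n) (@uncons_rV n).
Proof.
move=> [a y]; congr pair => /=; [exact: cons_rV0|].
by rewrite /cons_rV/= row_mxKr.
Qed.

Lemma uncons_rVK n : cancel (@uncons_rV n) (@cons_rV n).
Proof.
move=> x; apply/rowP => i; rewrite mxE/=; case: splitP => j ij.
- rewrite !ord1 mxE mulr1n; congr (x _ _); apply/val_inj.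
  by rewrite /= ij ord1.
- by rewrite mxE; congr (x _ _); apply/val_inj.
Qed.

Lemma measurable_cons_rV n : measurable_fun setT (@cons_rV n).
Proof.
apply/measurable_fun_rVP => i; case: (unliftP ord0 i) => [j ->|->].
- under eq_fun do rewrite cons_rVS.
  exact: (measurableT_comp (measurable_coor j) measurable_snd).
- under eq_fun do rewrite cons_rV0.
  exact: measurable_fst.
Qed.

Lemma measurable_uncons_rV n : measurable_fun setT (@uncons_rV n).
Proof.
apply/measurable_fun_pairP; split; first exact: measurable_coor.
apply/measurable_fun_rVP => i.
under eq_fun do rewrite /= mxE.
exact: measurable_coor.
Qed.

Section cons_measure.
Variables (n : nat) (m : {sigma_finite_measure set 'rV[R]_n -> \bar R}).

Definition cons_measure : set 'rV[R]_n.+1 -> \bar R :=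
  pushforward (@lebesgue_measure R \x m)%E (@cons_rV n).

Let pm : {measure set 'rV[R]_n.+1 -> \bar R} :=
  measure_function_pushforward__canonical__measure_function_Measure
    (@lebesgue_measure R \x m)%E (@measurable_cons_rV n).

Let cons_measure0 : cons_measure set0 = 0%E.
Proof. exact: (measure0 pm). Qed.

Let cons_measure_ge0 A : (0 <= cons_measure A)%E.
Proof. exact: (measure_ge0 pm). Qed.

Let cons_measure_semi_sigma_additive : semi_sigma_additive cons_measure.
Proof. exact: (@measure_semi_sigma_additive _ _ _ pm). Qed.

HB.instance Definition _ := isMeasure.Build _ _ _ cons_measure
  cons_measure0 cons_measure_ge0 cons_measure_semi_sigma_additive.

Let cons_measure_sigma_finite : sigma_finite setT cons_measure.
Proof.
have /sigma_finiteP[F [TF ndF Foo]] := sigma_finiteT (@lebesgue_measure R).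
have /sigma_finiteP[G [TG ndG Goo]] := sigma_finiteT m.
exists (fun k => @uncons_rV n @^-1` (F k `*` G k)).
  apply/esym; rewrite -preimage_bigcup -subTset => x _ /=.
  move: (uncons_rV x) => -[a y].
  have [i _ Fia] : (\bigcup_k F k) a by rewrite -TF.
  have [j _ Gjy] : (\bigcup_k G k) y by rewrite -TG.
  exists (maxn i j) => //; split.
  - by move: (a) Fia; exact/subsetPset/ndF/leq_maxl.
  - by move: (y) Gjy; exact/subsetPset/ndG/leq_maxr.
move=> k; have [mF Fk] := Foo k; have [mG Gk] := Goo k; split.
  by rewrite -[X in measurable X]setTI; apply: measurable_uncons_rV => //;
    exact: measurableX.
rewrite /cons_measure /pushforward -comp_preimage.
rewrite (_ : _ \o _ = id); last by apply/funext => p /=; rewrite cons_rVK.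
by rewrite preimage_id product_measure1E// lte_mul_pinfty// ge0_fin_numE.
Qed.

HB.instance Definition _ := @Measure_isSigmaFinite.Build _ _ _ cons_measure
  cons_measure_sigma_finite.

End cons_measure.

Fixpoint lebesgue_rV n {struct n} : set 'rV[R]_n -> \bar R :=
  if n is m.+1 then
    pushforward (@lebesgue_measure R \x @lebesgue_rV m)%E (@cons_rV m)
  else \d_(0 : 'rV[R]_0).

Arguments lebesgue_rV : clear implicits.

Let lebesgue_rV_sigma_finite_measure n :
  exists m : {sigma_finite_measure set 'rV[R]_n -> \bar R}, lebesgue_rV n = m.
Proof.
elim: n => [|n [m IH]].
  by exists (\d_(0 : 'rV[R]_0) : {sigma_finite_measure set _ -> \bar R}).
by exists (cons_measure m : {sigma_finite_measure set _ -> \bar R}); rewrite /= IH.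
Qed.

Let lebesgue_rV0 n : lebesgue_rV n set0 = 0%E.
Proof. by have [m ->] := lebesgue_rV_sigma_finite_measure n. Qed.

Let lebesgue_rV_ge0 n A : (0 <= lebesgue_rV n A)%E.
Proof. by have [m ->] := lebesgue_rV_sigma_finite_measure n. Qed.

Let lebesgue_rV_semi_sigma_additive n : semi_sigma_additive (lebesgue_rV n).
Proof.
have [m ->] := lebesgue_rV_sigma_finite_measure n.
exact: measure_semi_sigma_additive.
Qed.

HB.instance Definition _ n := isMeasure.Build _ _ _ (lebesgue_rV n)
  (@lebesgue_rV0 n) (@lebesgue_rV_ge0 n) (@lebesgue_rV_semi_sigma_additive n).

Let lebesgue_rV_sigma_finite n : sigma_finite setT (lebesgue_rV n).
Proof.
by have [m ->] := lebesgue_rV_sigma_finite_measure n; exact: sigma_finiteT.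
Qed.

HB.instance Definition _ n := @Measure_isSigmaFinite.Build _ _ _ (lebesgue_rV n)
  (@lebesgue_rV_sigma_finite n).

Lemma lebesgue_rV_box n (A : 'I_n -> set R) : (forall i, measurable (A i)) ->
  lebesgue_rV n [set x | forall i, A i (x 0 i)] =
  (\prod_(i < n) @lebesgue_measure R (A i))%E.
Proof.
elim: n A => [|n IH] A mA.
  by rewrite big_ord0 /= diracE (_ : _ \in _) // inE => -[].
rewrite big_ord_recl -IH//.
have [m mE] := lebesgue_rV_sigma_finite_measure n.
have mB : measurable [set x : 'rV[R]_n | forall i, A (lift ord0 i) (x 0 i)].
  rewrite (_ : mkset _ = \big[setI/setT]_(i < n)
      ((fun x : 'rV[R]_n => x 0 i) @^-1` A (lift ord0 i))).
    apply: bigsetI_measurable => i _.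
    by rewrite -[X in measurable X]setTI; exact: measurable_coor.
  rewrite -bigcap_seq; apply/seteqP; split=> x /= H i; first by move=> _; exact: H.
  by apply: H => /=; rewrite mem_index_enum.
rewrite /= /pushforward mE -product_measure1E//; last exact: mA.
congr (_ _); apply/seteqP; split=> -[a y] /=.
- move=> H; split => [|i].
  + by have := H ord0; rewrite cons_rV0.
  + by have := H (lift ord0 i); rewrite cons_rVS.
- move=> [Aa Ay] i; case: (unliftP ord0 i) => [j ->|->].
  + by rewrite cons_rVS.
  + by rewrite cons_rV0.
Qed.

End lebesgue_rV.
Arguments lebesgue_rV {R} n.

(* The norm of 'rV[R]_d provided by the library is the sup norm. *)
Definition dotrV {R : realType} d (x y : 'rV[R]_d) : R :=
  \sum_(i < d) x 0 i * y 0 i.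

Definition enorm {R : realType} d (x : 'rV[R]_d) : R := Num.sqrt (dotrV x x).

Definition grad {R : realType} d (f : 'rV[R]_d -> R) (x : 'rV[R]_d) : 'rV[R]_d :=
  \row_(i < d) 'D_(delta_mx 0 i) f x.

Definition C1_on {R : realType} {V W : normedModType R} (D : set V)
    (f : V -> W) : Prop :=
  forall p, D p -> differentiable f p /\ forall v, {for p, continuous ('D_v f)}.

Definition density_measure {R : realType} d (r : 'rV[R]_d -> R) :
    set 'rV[R]_d -> \bar R :=
  fun A => (\int[lebesgue_rV d]_(x in A) (r x)%:E)%E.

Definition couplings {R : realType} d (mu nu : set 'rV[R]_d -> \bar R) :
    set {measure set ('rV[R]_d * 'rV[R]_d)%type -> \bar R} :=
  [set pi | forall A, measurable A ->
     pi (A `*` setT) = mu A /\ pi (setT `*` A) = nu A].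

Definition wasserstein2 {R : realType} d (mu nu : set 'rV[R]_d -> \bar R) :
    \bar R :=
  ereal_inf [set ((\int[pi]_z (enorm (z.1 - z.2) ^+ 2)%:E) `^ 2^-1)%E
            | pi in couplings mu nu].

Definition weighted_L2norm {R : realType} d (r : 'rV[R]_d -> R)
    (f : 'rV[R]_d -> 'rV[R]_d) : \bar R :=
  ((\int[lebesgue_rV d]_x (enorm (f x) ^+ 2 * r x)%:E) `^ 2^-1)%E.

Definition barycenter {R : realType} d (r : 'rV[R]_d -> R) : 'rV[R]_d :=
  \row_(j < d) \int[lebesgue_rV d]_x (x 0 j * r x).

Definition mean_velocity {R : realType} d (r : 'rV[R]_d -> R)
    (v : 'rV[R]_d -> 'rV[R]_d) : 'rV[R]_d :=
  \row_(j < d) \int[lebesgue_rV d]_x (r x * v x 0 j).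

Definition potential_force {R : realType} d (W : 'rV[R]_d -> R)
    (r : 'rV[R]_d -> R) (x : 'rV[R]_d) (j : 'I_d) : R :=
  \int[lebesgue_rV d]_y (grad W (x - y) 0 j * r y).

(* The value psi 0 plays no role: it is multiplied by v x - v x = 0. *)
Definition alignment_force {R : realType} d (psi : 'rV[R]_d -> R)
    (r : 'rV[R]_d -> R) (v : 'rV[R]_d -> 'rV[R]_d) (x : 'rV[R]_d) (j : 'I_d) : R :=
  \int[lebesgue_rV d]_y (psi (x - y) * (v x 0 j - v y 0 j) * r y).

Definition density_support {R : realType} d (r : 'rV[R]_d -> R) : set 'rV[R]_d :=
  closure [set x | r x != 0].

Definition moments {R : realType} d (r : 'rV[R]_d -> R)
    (v : 'rV[R]_d -> 'rV[R]_d) : \bar R :=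
  (\int[lebesgue_rV d]_x ((enorm x ^+ 2 + enorm (v x) ^+ 2) * r x)%:E)%E.

(* Absolute integrability required for the energy identities: this dominates
   the alignment terms in the time derivatives of the momentum (weight 1), of
   int <x, u> rho (weight |x|) and of the kinetic energy (weight |u|), before
   symmetrization in x and y, hence also the dissipation
   int int psi(x - y) |u(x) - u(y)|^2 rho(x) rho(y). *)
Definition alignment_exchange {R : realType} d (psi : 'rV[R]_d -> R)
    (r : 'rV[R]_d -> R) (v : 'rV[R]_d -> 'rV[R]_d) : \bar R :=
  (\int[lebesgue_rV d]_x \int[lebesgue_rV d]_y
     (psi (x - y) * enorm (v x - v y) * (1 + enorm x + enorm (v x))
      * r x * r y)%:E)%E.

Record characteristics {R : realType} d (rho0 : 'rV[R]_d -> R)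
    (rho : R -> 'rV[R]_d -> R) (u : R -> 'rV[R]_d -> 'rV[R]_d)
    (eta : R -> 'rV[R]_d -> 'rV[R]_d) : Prop := {
  char_init : forall x, density_support rho0 x -> eta 0 x = x ;
  char_ode : forall (x : 'rV[R]_d) (t : R), density_support rho0 x -> 0 < t ->
    is_derive t 1 (fun s => eta s x) (u t (eta t x)) ;
  char_cont : forall x, density_support rho0 x ->
    {within `[0, +oo[%classic, continuous (fun s => eta s x)} ;
  char_measurable : forall t : R, 0 <= t ->
    measurable_fun (density_support rho0) (eta t) ;
  char_pushforward : forall (t : R) (A : set 'rV[R]_d), 0 <= t -> measurable A ->
    density_measure (rho t) A =
    density_measure rho0 (density_support rho0 `&` eta t @^-1` A) }.

(* rho and u are only constrained at times t >= 0. *)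
Record classical_solution {R : realType} d (W psi : 'rV[R]_d -> R)
    (rho0 : 'rV[R]_d -> R) (u0 : 'rV[R]_d -> 'rV[R]_d)
    (rho : R -> 'rV[R]_d -> R) (u : R -> 'rV[R]_d -> 'rV[R]_d) : Prop := {
  sol_rho_init : forall x, rho 0 x = rho0 x ;
  sol_u_init : forall x, u 0 x = u0 x ;
  sol_rho_ge0 : forall (t : R) (x : 'rV[R]_d), 0 <= t -> 0 <= rho t x ;
  sol_mass : forall t : R, 0 <= t -> density_measure (rho t) setT = 1%E ;
  sol_rho_C1 : C1_on [set p : R * 'rV[R]_d | 0 < p.1] (fun p => rho p.1 p.2) ;
  sol_u_C1 : C1_on [set p : R * 'rV[R]_d | 0 < p.1] (fun p => u p.1 p.2) ;
  sol_rho_cont : {within [set p : R * 'rV[R]_d | 0 <= p.1],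
    continuous (fun p => rho p.1 p.2)} ;
  sol_u_cont : {within [set p : R * 'rV[R]_d | 0 <= p.1],
    continuous (fun p => u p.1 p.2)} ;
  sol_continuity : forall (t : R) (x : 'rV[R]_d), 0 < t ->
    'D_1 (fun s : R => rho s x) t
    + \sum_(i < d) 'D_(delta_mx 0 i) (fun y => rho t y * u t y 0 i) x = 0 ;
  sol_momentum : forall (t : R) (x : 'rV[R]_d) (j : 'I_d), 0 < t ->
    'D_1 (fun s : R => rho s x * u s x 0 j) t
    + \sum_(i < d)
        'D_(delta_mx 0 i) (fun y => rho t y * u t y 0 i * u t y 0 j) x
    = - (rho t x * potential_force W (rho t) x j)
      - rho t x * alignment_force psi (rho t) (u t) x j ;
  sol_potential_integrable : forall (t : R) (x : 'rV[R]_d) (j : 'I_d), 0 < t ->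
    (lebesgue_rV d).-integrable setT
      (fun y => (grad W (x - y) 0 j * rho t y)%:E) ;
  sol_alignment_integrable : forall (t : R) (x : 'rV[R]_d) (j : 'I_d), 0 < t ->
    (lebesgue_rV d).-integrable setT
      (fun y => (psi (x - y) * (u t x 0 j - u t y 0 j) * rho t y)%:E) ;
  sol_moments : forall t : R, 0 <= t -> (moments (rho t) (u t) < +oo)%E ;
  sol_moments_int : forall T : R,
    (\int[lebesgue_measure]_(t in `[0%R, T]) moments (rho t) (u t) < +oo)%E ;
  sol_exchange_int : forall T : R,
    (\int[lebesgue_measure]_(t in `[0%R, T])
       alignment_exchange psi (rho t) (u t) < +oo)%E ;
  sol_characteristics : exists eta, characteristics rho0 rho u eta }.

(* d_2(rho(t), delta_{eta_c(t)}) + || u(t) - u_oo ||_{L^2(rho(t))}. *)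
Definition equilibration_error {R : realType} d
    (rho0 : 'rV[R]_d -> R) (u0 : 'rV[R]_d -> 'rV[R]_d)
    (rho : R -> 'rV[R]_d -> R) (u : R -> 'rV[R]_d -> 'rV[R]_d) (t : R) : \bar R :=
  (wasserstein2 (density_measure (rho t)) \d_(barycenter (rho t))
   + weighted_L2norm (rho t) (fun x => u t x - mean_velocity rho0 u0)%R)%E.

(* Main.v *)
From HB Require Import structures.
Require Import Defs.
From mathcomp Require Import all_boot all_order all_algebra.
From mathcomp Require Import all_classical all_reals all_analysis.
From mathcomp Require Import measurable_realfun.
From mathcomp Require Import ring lra.

(** The proof is Lagrangian. The particles are the points of the support of
rho0, drawn with the law of density rho0; along the characteristics they move
by Newton's law, attracted to each other by the potential W and aligned by the
weight psi. Write x, v for the position and velocity of a particle, and dx, dv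
for their differences over two independent particles, and Ex for expectations.

Momentum is conserved because the pair forces are antisymmetric. The energy
E = 1/4 Ex |dv|^2 + 1/2 Ex (W(dx) - W(0)) is dissipated at the rate
1/2 Ex (psi(dx) |dv|^2), and the convexity bounds on W make it comparable to
Ex |dv|^2 + Ex |dx|^2. It controls both terms of the error: the squared transport
distance to the Dirac mass at the barycenter is the variance of x, hence half
of Ex |dx|^2, and the velocity term is the variance of v, half of Ex |dv|^2.
So the error is at most a constant times the square root of E.

The dissipation alone does not see the positions. It is completed by the
virial Y = 1/2 Ex <dx, dv>, which is bounded by a multiple of E and whose
derivative contains - 1/2 Ex <grad W(dx), dx>, at most - lambda/2 Ex |dx|^2, plus
two bad terms. One, 1/2 Ex |dv|^2, is absorbed by the dissipation because psi is
bounded below. The other is the alignment term - 1/2 Ex (psi(dx) <dx, dv>). If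
psi(z) |z|^2 <= a |z|^2 + b for all z, Young's inequality bounds it by the
dissipation times a/(2 lambda), plus lambda/4 Ex |dx|^2, plus lambda b/(4a).
Integrating Y plus a suitable multiple of E over [s, t], and using that E is
nonincreasing, gives the inequality [energy_estimate]:
<<
  (t - s) c0 E(t) <= (C + a/(2 lambda)) E(s) + (t - s) lambda b/(4a).
>>
If psi is bounded, then b = 0 is possible with a constant a, and E decays
exponentially ([exponential_decay]). If psi(z) <= B |z|^(-alpha) near the
origin, then for every small q one may take a = B q^(-alpha) and b = a q^2:
pairs at distance at least q are compared with a |z|^2, closer ones with b.
Choosing q proportional to t^(-1/alpha) and s = t/2 propagates the bound
E(t) <= A t^(-2/alpha) from one dyadic interval of times to the next
([algebraic_decay]), which is stronger than the rate claimed.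

The remaining work justifies the identities for E and Y. The momentum equation
can be divided by the density only where the density is positive, but almost
every particle sees a positive density at almost every time
([density_positive]), so Newton's law holds for almost every particle and time.
Each functional is then an expectation of quantities that are C^1 in time for
positive times, and it is a primitive of the expected derivative by the
fundamental theorem of calculus and Fubini's theorem
([primitive_expectation]); the integrable majorant comes from the second
moments and from the integrated alignment exchange. *)

Set Implicit Arguments.
Unset Strict Implicit.
Unset Printing Implicit Defensive.

Import Order.TTheory GRing.Theory Num.Theory.
Import numFieldNormedType.Exports.

Local Open Scope classical_set_scope.
Local Open Scope ring_scope.

(** * Decay of a scalar Lyapunov function *)

(** Over a time step of length T = e K the hypothesis loses a factor e; the
monotonicity of E fills in the times between the multiples of T. *)
Lemma exponential_decay {R : realType} (E : R -> R) (K : R) :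
  0 < K -> (forall t : R, 0 <= t -> 0 <= E t) ->
  (forall s t : R, 0 <= s -> s <= t -> E t <= E s) ->
  (forall s t : R, 0 <= s -> s <= t -> (t - s) * E t <= K * E s) ->
  forall t : R, 0 <= t -> E t <= expR 1 * E 0 * expR (- ((expR 1 * K)^-1 * t)).
Proof.
move=> K0 E0 Edec EK; set T := expR 1 * K.
have e0 : 0 < expR 1 :> R by exact: expR_gt0.
have T0 : 0 < T by rewrite mulr_gt0.
have step s : 0 <= s -> E (s + T) <= expR (-1) * E s.
  move=> s0; have := EK s (s + T) s0; rewrite lerDl (ltW T0) => /(_ isT).
  rewrite addrAC subrr add0r /T mulrAC mulrC ler_pM2l// expRN.
  by rewrite -ler_pdivlMl.
have iter n : E (n%:R * T) <= expR (- n%:R) * E 0.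
  elim: n => [|n IH]; first by rewrite mul0r oppr0 expR0 mul1r.
  rewrite -natr1 mulrDl mul1r (le_trans (step _ _))//.
    by rewrite mulr_ge0// ltW.
  by rewrite opprD expRD mulrAC [leRHS]mulrC ler_pM2l ?expR_gt0// mulrC.
move=> t t0; have tT : 0 <= t / T by rewrite divr_ge0// ltW.
have /andP[nt tn] := truncn_itv tT.
set n := Num.truncn _ in nt tn.
apply: (@le_trans _ _ (E (n%:R * T))).
  apply: Edec; first by rewrite mulr_ge0// ltW.
  by rewrite -ler_pdivlMr.
apply: (le_trans (iter n)).
rewrite mulrAC ler_wpM2r ?E0// -expRD ler_expR [_^-1 * _]mulrC.
by move: tn; rewrite -natr1; lra.
Qed.

(** Here q is the cut-off distance below which the singularity of the weight is
not resolved. Taken proportional to t^(-1/alpha), it makes the last term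
comparable to the claimed bound and K2 q^(-alpha) a small multiple of t, so
that the bound at time t/2 implies the bound at time t with the same A. *)
Lemma algebraic_decay {R : realType} (E : R -> R) (alpha r K1 K2 K3 : R) :
  0 < alpha -> 0 < r -> 0 < K1 -> 0 < K2 -> 0 < K3 ->
  (forall t : R, 0 <= t -> 0 <= E t) ->
  (forall s t : R, 0 <= s -> s <= t -> E t <= E s) ->
  (forall q s t : R, 0 < q -> q <= r -> 0 <= s -> s <= t ->
    (t - s) * E t <= (K1 + K2 * q `^ (- alpha)) * E s + (t - s) * (K3 * q ^+ 2)) ->
  exists A t0 : R, [/\ 0 < A, 1 <= t0 &
    forall t : R, t0 <= t -> E t <= A * (t `^ (- alpha^-1)) ^+ 2].
Proof.
move=> a0 r0 K10 K20 K30 E0 Edec EK.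
set b := fun t : R => t `^ (- alpha^-1).
have b0 t : 0 < t -> 0 < b t by move=> t0; exact: powR_gt0.
have bnon s t : 0 < s -> s <= t -> b t <= b s.
  move=> s0 st; rewrite /b !powRN lef_pV2 ?posrE ?powR_gt0//.
    by rewrite ge0_ler_powR ?nnegrE ?invr_ge0 ?(ltW a0) ?(ltW s0) ?(le_trans (ltW s0) st).
  exact: lt_le_trans st.
have ba t : 0 < t -> (b t) `^ (- alpha) = t.
  by move=> t0; rewrite /b -powRrM mulrNN mulVf ?gt_eqF// powRr1// ltW.
set c2 := (b 2^-1) ^+ 2.
have c20 : 0 < c2 by rewrite exprn_gt0// b0// invr_gt0.
have bhalf t : 0 < t -> (b (t / 2)) ^+ 2 = c2 * (b t) ^+ 2.
  by move=> t0; rewrite /b powRM ?exprMn 1?mulrC// ltW.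
clearbody c2.
pose D := K1 + K2 * r `^ (- alpha).
have D0 : 0 < D by rewrite addr_gt0// mulr_gt0 ?powR_gt0.
pose t0 := 1 + 8 * c2 * D.
have t01 : 1 <= t0 by rewrite lerDl ltW// !mulr_gt0.
have t00 : 0 < t0 by exact: lt_le_trans t01.
have E00 : 0 <= E 0 by exact: E0.
(* for m >= m0 the part K2 m^(-alpha) t of the coefficient of E (t / 2) is at
   most t / (8 c2), where c2 is the loss from b(t)^2 to b(t/2)^2; t0 does the
   same for the remaining part D *)
pose m0 := b (8 * c2 * K2)^-1.
have m00 : 0 < m0 by rewrite b0// invr_gt0 !mulr_gt0.
have m0b : m0 `^ (- alpha) = (8 * c2 * K2)^-1.
  by rewrite ba// invr_gt0 !mulr_gt0.
clearbody m0.
(* the first term makes the m below at least m0; the second one starts the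
   induction on [t0, 2 t0] *)
pose A := 2 * K3 * m0 ^+ 2 + E 0 * (b (2 * t0)) ^- 2.
have b2t0 : 0 < b (2 * t0) ^+ 2 by rewrite exprn_gt0// b0// mulr_gt0.
have A1 : 2 * K3 * m0 ^+ 2 <= A by rewrite lerDl mulr_ge0// invr_ge0 ltW.
have A0 : 0 < A by apply: lt_le_trans A1; rewrite !mulr_gt0// exprn_gt0.
exists A, t0; split=> //.
pose m := Num.sqrt (A / (2 * K3)).
have m2 : m ^+ 2 = A / (2 * K3).
  by rewrite sqr_sqrtr// divr_ge0 ?mulr_ge0// ltW.
have m0m : m0 <= m.
  rewrite -(@ler_pXn2r _ 2)// ?nnegrE ?sqrtr_ge0 ?(ltW m00)//.
  by rewrite m2 ler_pdivlMr ?mulr_gt0// mulrC.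
have mp : 0 < m by exact: lt_le_trans m0m.
have m0a : m `^ (- alpha) <= (8 * c2 * K2)^-1.
  rewrite -m0b !powRN lef_pV2 ?posrE ?powR_gt0//.
  by rewrite ge0_ler_powR ?nnegrE// ltW.
have key t : t0 <= t -> E (t / 2) <= A * b (t / 2) ^+ 2 -> E t <= A * b t ^+ 2.
  move=> tt Eh; have tp : 0 < t by exact: lt_le_trans tt.
  have bt := b0 _ tp.
  pose q := Num.min r (m * b t).
  have q0 : 0 < q by rewrite lt_min r0 mulr_gt0.
  have qr : q <= r by rewrite ge_min lexx.
  have qm : q <= m * b t by rewrite ge_min lexx orbT.
  have qa : q `^ (- alpha) <= r `^ (- alpha) + m `^ (- alpha) * t.
    rewrite /q minElt; case: ifPn => _.
      by rewrite lerDl mulr_ge0 ?powR_ge0// ltW.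
    by rewrite powRM ?ba ?(ltW mp) ?(ltW bt)// lerDr powR_ge0.
  have := EK q (t / 2) t q0 qr; rewrite divr_ge0 ?(ltW tp)// => /(_ isT).
  have -> : (t / 2 <= t) by lra.
  move=> /(_ isT); have -> : t - t / 2 = t / 2 by lra.
  set Q := q `^ (- alpha) in qa *; set M := m `^ _ in m0a qa.
  move=> H.
  have Eh0 : 0 <= E (t / 2) by rewrite E0// divr_ge0// ltW.
  have q2 : K3 * q ^+ 2 <= A / 2 * b t ^+ 2.
    have -> : A / 2 * b t ^+ 2 = K3 * (m * b t) ^+ 2.
      rewrite exprMn m2; field; lra.
    by rewrite ler_pM2l// lerXn2r// ?nnegrE ltW// mulr_gt0.
  have H2 : (K1 + K2 * Q) * E (t / 2) <= (t / 4) * (A * b t ^+ 2).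
    apply: (@le_trans _ _ ((D + K2 * M * t) * E (t / 2))).
      rewrite ler_wpM2r// /D -addrA lerD2l -mulrA -mulrDr ler_pM2l//.
    have DM0 : 0 <= D + K2 * M * t.
      by rewrite addr_ge0 ?(ltW D0)// !mulr_ge0 ?powR_ge0// ltW.
    apply: (le_trans (ler_wpM2l DM0 Eh)); rewrite bhalf//.
    have -> : (D + K2 * M * t) * (A * (c2 * b t ^+ 2)) =
      (c2 * D + c2 * K2 * M * t) * (A * b t ^+ 2) by ring.
    rewrite ler_wpM2r ?mulr_ge0 ?exprn_ge0 ?(ltW A0) ?(ltW bt)//.
    have h1 : c2 * D <= t / 8 by move: tt; rewrite /t0; lra.
    have h2 : c2 * K2 * M <= 1 / 8.
      have h3 : c2 * K2 * (8 * c2 * K2)^-1 = 1 / 8.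
        by field; rewrite ?gt_eqF.
      by rewrite -h3 ler_pM2l// mulr_gt0.
    have := ler_wpM2r (ltW tp) h2; lra.
  have H3 : (t / 2) * (K3 * q ^+ 2) <= (t / 2) * (A / 2 * b t ^+ 2).
    by rewrite ler_pM2l// divr_gt0.
  have th : 0 < t / 2 by rewrite divr_gt0.
  by rewrite -(ler_pM2l th); lra.
have ind n t : t0 <= t -> t <= 2 ^+ n.+1 * t0 -> E t <= A * b t ^+ 2.
  elim: n t => [|n IH] t tt tn.
    have tp : 0 < t by exact: lt_le_trans tt.
    apply: (le_trans (Edec 0 t _ (ltW tp)))=> //.
    apply: (@le_trans _ _ (A * b (2 * t0) ^+ 2)).
      rewrite /A mulrDl -[E 0 * _ * _]mulrA mulVf ?gt_eqF// mulr1 lerDr.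
      by rewrite ltW// !mulr_gt0// b0// mulr_gt0.
    by rewrite ler_pM2l// lerXn2r ?nnegrE ?(ltW (b0 _ _)) ?bnon ?mulr_gt0.
  have [tl|tl] := leP t (2 * t0).
    by apply: IH => //; rewrite (le_trans tl)// ler_pM2r// exprS ler_peMr// exprn_ege1// ler1n.
  apply: key => //; apply: IH; first by rewrite ler_pdivlMr// mulrC ltW.
  by rewrite ler_pdivrMr// mulrAC -exprSr.
move=> t tt.
pose n := (Num.truncn t).+1.
apply: (ind n) => //.
have tp : 0 <= t by rewrite (le_trans (ltW t00)).
have /andP[_ /ltW tn] := truncn_itv tp.
apply: (le_trans tn).
rewrite -[leLHS]mulr1 ler_pM ?ler0n// -natrX ler_nat -/n.
by rewrite (leq_trans (ltnW (ltn_expl n (ltnSn 1))))// leq_exp2l.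
Qed.

(** * Measurability of continuous and of Caratheodory functions *)

Section grid.
Context {R : realType} d (T : measurableType d).

Lemma measurable_floor_fiber (f : T -> R) (z : int) :
  measurable_fun setT f -> measurable [set t | Num.floor (f t) = z].
Proof.
move=> mf; rewrite (_ : mkset _ = setT `&` f @^-1` `[z%:~R, (z + 1)%:~R[).
  exact: mf.
apply/seteqP; split=> t /=; rewrite in_itv/=.
  by move=> <-; split=> //; exact: floor_itv.
by move=> [_ ?]; exact: floor_def.
Qed.

Lemma measurable_fun_countable_choice (I : countType) (q : T -> I)
    d' (U : measurableType d') (F : I -> T -> U) :
  (forall i, measurable [set t | q t = i]) ->
  (forall i, measurable_fun setT (F i)) ->
  measurable_fun setT (fun t => F (q t) t).
Proof.
move=> mq mF _ Y mY; rewrite setTI.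
rewrite (_ : _ @^-1` Y = \bigcup_i ([set t | q t = i] `&` (setT `&` F i @^-1` Y))).
  apply: countable_bigcupT_measurable; first exact: countableP.
  by move=> i; apply: measurableI => //; exact: mF.
apply/seteqP; split=> [t Yt|t [i _ /= [<- [_ ?]]]] //=.
by exists (q t).
Qed.

End grid.

Section grid_approximation.
Context {R : realType}.

Definition grid (k : nat) (t : R) : R := (Num.floor (t * k.+1%:R))%:~R / k.+1%:R.

Lemma grid_dist k (t : R) : `|t - grid k t| < k.+1%:R^-1.
Proof.
have k0 : 0 < k.+1%:R :> R by [].
have /andP[l u] := floor_itv (t * k.+1%:R).
have E : (t - grid k t) * k.+1%:R = t * k.+1%:R - (Num.floor (t * k.+1%:R))%:~R.
  by rewrite mulrBl divfK// gt_eqF.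
rewrite -(ltr_pM2r k0) mulVf ?gt_eqF// -[in ltLHS](gtr0_norm k0) -normrM E.
by move: u; rewrite intrD ger0_norm ?subr_ge0//; lra.
Qed.

Lemma cvg_grid (t : R) : grid k t @[k --> \oo] --> t.
Proof.
apply/cvgrPdist_lt => e e0; near=> k.
apply: (lt_trans (grid_dist k t)); near: k.
exact: near_infty_natSinv_lt (PosNum e0).
Unshelve. all: by end_near. Qed.

(** A function measurable in w and continuous in t is the limit of its values at
the grid points below t, which are countably many at each step. *)
Lemma measurable_caratheodory d (T : measurableType d) (f : R -> T -> R) :
  (forall t, measurable_fun setT (f t)) ->
  (forall w, continuous (f ^~ w)) ->
  measurable_fun setT (fun p : measurableTypeR R * T => f p.1 p.2).
Proof.
move=> mf cf.
apply: (@measurable_fun_cvg _ _ _ _ (fun k (p : measurableTypeR R * T) => f (grid k p.1) p.2)).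
  move=> k.
  apply: (@measurable_fun_countable_choice _ _ _
    (fun p : measurableTypeR R * T => Num.floor (p.1 * k.+1%:R : R)) _ _
    (fun z p => f (z%:~R / k.+1%:R) p.2)).
    move=> z; apply: (@measurable_floor_fiber R _ _ (fun p : measurableTypeR R * T => p.1 * k.+1%:R : R)).
    by apply: measurable_funM => //; exact: measurable_fst.
  by move=> z; apply: measurableT_comp => //; exact: mf.
by move=> [t w] _ /=; exact: (cvg_comp _ _ (@cvg_grid t) (cf w t)).
Qed.

(** The sigma-algebra of the coordinates contains the open sets, since an open
set is the countable union of the grid cells that it contains. *)
Lemma open_measurable_rV n (A : set 'rV[R]_n) : open A -> measurable A.
Proof.
move=> oA.
pose q k (x : 'rV[R]_n) : 'rV[int]_n := \row_i Num.floor (x 0 i * k.+1%:R).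
rewrite (_ : A = \bigcup_k \bigcup_(z : 'rV[int]_n)
    (if `[< [set x | q k x = z] `<=` A >] then [set x | q k x = z] else set0)).
  apply: bigcupT_measurable => k; apply: countable_bigcupT_measurable => [|z].
    exact: countableP.
  case: ifPn => // _.
  rewrite (_ : mkset _ = \big[setI/setT]_(i < n)
      [set x : 'rV[R]_n | Num.floor (x 0 i * k.+1%:R) = z 0 i]).
    apply: bigsetI_measurable => i _; apply: measurable_floor_fiber.
    by apply: measurable_funM => //; exact: measurable_coor.
  rewrite -bigcap_seq; apply/seteqP; split=> x /=.
    by move=> <- i _; rewrite /= mxE.
  by move=> H; apply/rowP => i; rewrite mxE; apply: H; rewrite /= mem_index_enum.
apply/seteqP; split=> [x Ax|x [k _ [z _]]]; last by case: ifPn => // /asboolP; exact.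
have := open_nbhs_nbhs (conj oA Ax) => /nbhs_ballP[e /= e0 eA].
near \oo => k.
exists k => //; exists (q k x) => //; rewrite asboolT// => y /= qyx.
apply: eA; split=> // i j; rewrite ord1 /ball/=.
have ke : k.+1%:R^-1 < e / 2.
  by near: k; apply: near_infty_natSinv_lt (PosNum (divr_gt0 e0 (ltr0Sn _ 1))).
have gE : grid k (y 0 j) = grid k (x 0 j).
  by rewrite /grid; move/rowP : qyx => /(_ j); rewrite !mxE => ->.
have h1 := grid_dist k (x 0 j); have h2 := grid_dist k (y 0 j).
rewrite gE in h2.
rewrite (_ : x 0 j - y 0 j = (x 0 j - grid k (x 0 j)) - (y 0 j - grid k (x 0 j))); last by ring.
apply: (le_lt_trans (ler_normB _ _)); apply: (lt_trans (ltrD h1 h2)).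
by rewrite [ltRHS]splitr ltrD.
Unshelve. all: by end_near. Qed.

Lemma continuous_measurable_rV n (f : 'rV[R]_n -> R) :
  continuous f -> measurable_fun setT f.
Proof.
move=> /continuousP cf; apply: (measurability _ (RGenOpens.measurableE R)).
move=> _ [_ [a [b ->] <-]]; rewrite setTI; apply: open_measurable_rV.
exact/cf/interval_open.
Qed.

End grid_approximation.

(** * Primitives of integrable functions *)

Section almost_everywhere.
Context d (T : measurableType d) {R : realType} (m : {measure set T -> \bar R}).
Implicit Types P Q : T -> Prop.

Lemma ae_imp P Q : {ae m, forall x, P x} -> (forall x, P x -> Q x) ->
  {ae m, forall x, Q x}.
Proof. by move=> aP PQ; apply: filterS aP. Qed.

Lemma ae_imp2 P Q S : {ae m, forall x, P x} -> {ae m, forall x, Q x} ->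
  (forall x, P x -> Q x -> S x) -> {ae m, forall x, S x}.
Proof. by move=> aP aQ PQS; apply: filterS2 aP aQ. Qed.

End almost_everywhere.

Section primitive.
Context {R : realType}.
Notation mu := (@lebesgue_measure R).
Implicit Types (f g : R -> R).

Lemma lebesgue_measure_segment (s t : R) : s <= t -> mu `[s, t]%classic = (t - s)%:E.
Proof.
move=> st; rewrite lebesgue_measure_itv/= lte_fin; case: ifPn => [_|].
  by rewrite EFinB.
by rewrite -leNgt => ts; rewrite (le_anti (_ : s <= t <= s)) ?subrr// st.
Qed.

(** On the half-line: absolute continuity of f on bounded intervals, with
derivative g almost everywhere, in integrated form. *)
Definition primitive f g := forall s t : R, 0 <= s -> s <= t ->
  mu.-integrable `[s, t] (EFin \o g) /\ f t - f s = \int[mu]_(r in `[s, t]) g r.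

Lemma primitive0 : primitive (cst 0) (cst 0).
Proof.
move=> s t _ _; split; last by rewrite subrr Rintegral_cst// mul0r.
by apply: integrable0.
Qed.

Lemma primitiveD f1 f2 g1 g2 : primitive f1 g1 -> primitive f2 g2 ->
  primitive (fun t => f1 t + f2 t) (fun t => g1 t + g2 t).
Proof.
move=> p1 p2 s t s0 st; have [i1 e1] := p1 _ _ s0 st; have [i2 e2] := p2 _ _ s0 st.
split; first exact: (integrableD _ i1 i2).
by rewrite RintegralD// -e1 -e2; ring.
Qed.

Lemma primitiveZ c f g : primitive f g ->
  primitive (fun t => c * f t) (fun t => c * g t).
Proof.
move=> p s t s0 st; have [i e] := p _ _ s0 st.
split; first exact: (integrableZl _ c i).
by rewrite RintegralZl// -e mulrBr.
Qed.

Lemma primitive_sum I (r : seq I) (f g : I -> R -> R) :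
  (forall i, primitive (f i) (g i)) ->
  primitive (fun t => \sum_(i <- r) f i t) (fun t => \sum_(i <- r) g i t).
Proof.
move=> p; elim: r => [|i r IH].
  have e (h : I -> R -> R) : (fun t => \sum_(i <- [::]) h i t) = cst 0.
    by apply/funext => t; rewrite big_nil.
  by rewrite !e; exact: primitive0.
have e (h : I -> R -> R) : (fun t => \sum_(i <- i :: r) h i t) =
    (fun t => h i t + \sum_(i <- r) h i t).
  by apply/funext => t; rewrite big_cons.
by rewrite !e; exact: primitiveD.
Qed.

(** g is replaced by its minimum with c, because the bound holds only almost
everywhere. *)
Lemma primitive_le f g s t c : primitive f g -> 0 <= s -> s <= t ->
  {ae mu, forall r : R, `[s, t]%classic r -> g r <= c} -> f t - f s <= c * (t - s).
Proof.
move=> p s0 st gc; have [i ->] := p _ _ s0 st.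
pose h := fun r => Num.min (g r) c.
have mg : measurable_fun `[s, t] g by apply/measurable_EFinP; exact: measurable_int i.
have mh : measurable_fun `[s, t] h by apply: measurable_minr.
have ic : mu.-integrable `[s, t] (EFin \o cst c).
  apply/integrableP; split; first exact/measurable_EFinP.
  by rewrite (eq_integral (cst `|c|%:E))// integral_cst//= lebesgue_measure_segment// -EFinM ltry.
have -> : \int[mu]_(r in `[s, t]) g r = \int[mu]_(r in `[s, t]) h r.
  congr fine; apply: ae_eq_integral => //; [exact/measurable_EFinP|exact/measurable_EFinP|].
  apply: (ae_imp gc) => r + rst; move/(_ rst) => gr.
  by rewrite /h min_l.
have ih : mu.-integrable `[s, t] (EFin \o h).
  apply: (@le_integrable _ _ _ mu _ _ _ (fun r => (`|g r| + `|c|)%:E)) => //.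
  - exact/measurable_EFinP.
  - move=> r _ /=; rewrite lee_fin [leRHS]ger0_norm ?addr_ge0//.
    rewrite /h; case: (leP (g r) c) => _; [rewrite lerDl//|rewrite lerDr//].
  - apply: (@integrableD _ _ _ mu _ _ (fun r => (`|g r|)%:E) (fun r => (`|c|)%:E)) => //.
      exact: integrable_norm i.
    exact: (integrable_norm ic).
apply: (@le_trans _ _ (\int[mu]_(r in `[s, t]) c)).
  apply: le_Rintegral => // r _; rewrite /h ge_min lexx orbT//.
by rewrite Rintegral_cst//= lebesgue_measure_segment.
Qed.

(** f is only continuous at 0, where f' may blow up: the fundamental theorem of
calculus is applied on [c, t] and c is sent to 0, which the integrability of g
allows. *)
Lemma primitive_of_C1 f f' g :
  {within `[0, +oo[, continuous f} ->
  (forall t : R, 0 < t -> is_derive t 1 f (f' t)) ->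
  (forall t : R, 0 < t -> {for t, continuous f'}) ->
  {ae mu, forall t : R, 0 < t -> f' t = g t} ->
  (forall t : R, mu.-integrable `[0, t] (EFin \o g)) ->
  primitive f g.
Proof.
move=> cf df cf' fg ig.
have igst (s t : R) : 0 <= s -> mu.-integrable `[s, t] (EFin \o g).
  move=> s0; apply: integrableS (ig t) => //; apply: subset_itvr.
  by rewrite bnd_simp.
have [cfo cf0] := (continuous_within_itvcyP _ _).1 cf.
have pos (s t : R) : 0 < s -> s < t -> f t - f s = \int[mu]_(r in `[s, t]) g r.
  move=> s0 st.
  have cf'st : {within `[s, t], continuous f'}.
    apply: continuous_in_subspaceT => x /[!inE]/= /[!in_itv]/= /andP[sx _].
    by apply: cf'; exact: lt_le_trans sx.
  have cfx x : s <= x -> {for x, continuous f}.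
    by move=> sx; apply: cfo; rewrite in_itv/= andbT (lt_le_trans s0).
  have dfst : derivable_oo_LRcontinuous f s t.
    split.
    - by move=> x /[!in_itv]/= /andP[sx _]; have [] := df x (lt_trans s0 sx).
    - by apply: cvg_at_right_filter; exact: cfx.
    - by apply: cvg_at_left_filter; apply: cfx; exact: ltW.
  have := continuous_FTC2 st cf'st dfst.
  have H : {in `]s, t[, derive1 f =1 f'}.
    move=> x /[!in_itv]/= /andP[sx _]; rewrite derive1E.
    by have [_] := df x (lt_trans s0 sx).
  move=> /(_ H) ftc.
  suff -> : \int[mu]_(r in `[s, t]) g r = fine (\int[mu]_(x in `[s, t]) (f' x)%:E)%E.
    by rewrite ftc.
  congr fine; apply: ae_eq_integral => //.
  - exact: measurable_int (igst s t (ltW s0)).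
  - apply: measurable_int (continuous_compact_integrable _ cf'st).
    exact: segment_compact.
  - apply: (ae_imp fg) => r + /=; rewrite in_itv/= => + /andP[sr _].
    by move=> -> //; exact: lt_le_trans sr.
move=> s t s0 st; split; first exact: igst.
move: st; rewrite le_eqVlt => /predU1P[<-|st].
  by rewrite subrr set_itv1 Rintegral_set1.
move: s0; rewrite le_eqVlt => /predU1P[s0|s0]; last exact: pos.
move: st; rewrite -s0 => t0 {s0 s}.
have h0 : (fun c => f c - \int[mu]_(r in `[0, c]) g r) @ 0^'+ --> f 0 - 0.
  apply: cvgB => //; apply: cvg_at_right_filter.
  exact: (parameterized_integral_cvg_left t0).
have hK : (fun c => f c - \int[mu]_(r in `[0, c]) g r) @ 0^'+ -->
    f t - \int[mu]_(r in `[0, t]) g r.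
  apply: cvg_near_cst; near=> c.
  have c0 : 0 < c by near: c; exact: nbhs_right_gt.
  have ct : c < t by near: c; exact: nbhs_right_lt.
  have := Rintegral_itvB (ig t) (_ : BLeft 0 <= BRight c)%O (_ : BRight c <= BRight t)%O.
  rewrite !bnd_simp => /(_ (ltW c0) (ltW ct)).
  rewrite Rintegral_itv_obnd_cbnd; last first.
    by apply: integrableS (ig t) => //; apply: subset_itvr; rewrite bnd_simp ltW.
  by rewrite -pos// => e; lra.
have := cvg_unique _ hK h0; rewrite subr0 => /(_ (@Rhausdorff R)) <-.
by ring.
Unshelve. all: by end_near. Qed.

End primitive.

(** * Differentiating expectations along paths *)

Section expectation.
Context {R : realType} d (T : measurableType d) (P : probability T R).
Notation mu := (@lebesgue_measure R).

Lemma measurable_Rintegral d' (U : measurableType d') (k : U -> T -> R) :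
  measurable_fun setT (fun p : U * T => k p.1 p.2) ->
  measurable_fun setT (fun r => \int[P]_w k r w).
Proof.
move=> mk; pose K := fun p : U * T => (k p.1 p.2)%:E.
have mK : measurable_fun setT K by exact/measurable_EFinP.
rewrite /Rintegral; apply: (@measurableT_comp _ _ _ _ _ _ fine) => //.
rewrite (_ : (fun r => _) = (fubini_F P (K ^\+)%E \- fubini_F P (K ^\-)%E)%E).
  apply: emeasurable_funB; apply: measurable_fun_fubini_tonelli_F => //.
    exact: measurable_funepos.
  exact: measurable_funeneg.
apply/funext => r; rewrite [LHS]integralE /fubini_F/=.
by congr (_ - _)%E; apply: eq_integral => w _; rewrite ?funeposE ?funenegE.
Qed.

(** By Fubini's theorem. The integrability of almost every path of k, which each
path needs to have a primitive, follows from the same product integrability, so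
the existence of primitives is only asked under this condition. *)
Lemma primitive_expectation (f k : R -> T -> R) :
  measurable_fun setT (fun p : measurableTypeR R * T => k p.1 p.2) ->
  (forall t : R, 0 <= t -> P.-integrable setT (EFin \o f t)) ->
  (forall t : R, (\int[mu]_(r in `[0%R, t]) \int[P]_w `|k r w|%:E < +oo)%E) ->
  {ae P, forall w, (forall t : R, mu.-integrable `[0, t] (EFin \o k ^~ w)) ->
     primitive (f ^~ w) (k ^~ w)} ->
  primitive (fun t => \int[P]_w f t w) (fun r => \int[P]_w k r w).
Proof.
move=> mk if_ ik pf.
pose ks (s t : R) (p : measurableTypeR R * T) := ((k p.1 p.2) * \1_(`[s, t]%classic) p.1)%:E.
have mks s t : measurable_fun setT (ks s t).
  apply/measurable_EFinP; apply: measurable_funM => //.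
  by apply: measurableT_comp => //; exact: measurable_fst.
have mkr (r : R) : measurable_fun setT (k r).
  exact: (measurableT_comp mk (pair1_measurable (r : measurableTypeR R))).
have mabs : measurable_fun setT (fun r : measurableTypeR R => (\int[P]_w `|k r w|%:E)%E).
  apply: (@measurable_fun_fubini_tonelli_F _ _ _ _ _ P (fun p : measurableTypeR R * T => `|k p.1 p.2|%:E)) => //.
  by apply/measurable_EFinP; exact: measurableT_comp.
have iks (s t : R) : 0 <= s -> (mu \x P)%E.-integrable setT (ks s t).
  move=> s0; apply/integrable12ltyP => //.
  apply: le_lt_trans (ik t); rewrite [leRHS]integral_mkcond epatch_indic.
  apply: ge0_le_integral => //.
  - by move=> r _; apply: integral_ge0.
  - apply: (@measurable_fun_fubini_tonelli_F _ _ _ _ _ P (abse \o ks s t)) => [|p /=].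
      by apply: measurableT_comp.
    by rewrite lee_fin.
  - by apply: (emeasurable_funM mabs); apply/measurable_EFinP.
  - move=> r _ /=; rewrite -ge0_integralZr//; last first.
      by apply/measurable_EFinP/measurableT_comp.
    apply: ge0_le_integral => //.
    + have m := measurableT_comp (mks s t) (pair1_measurable (r : measurableTypeR R)).
      exact: (measurableT_comp (@abse_measurable _ _) m).
    + apply/measurable_EFinP; apply: measurable_funM => //.
      by apply: measurableT_comp.
    + move=> w _; rewrite -EFinM lee_fin normrM ler_wpM2l// ger0_norm//.
      rewrite !indicE ler_nat.
      case: (boolP (r \in `[s, t]%classic)) => // /[!inE]/= /[!in_itv]/= /andP[sr rt].
      by rewrite mem_set//= in_itv/= rt (le_trans s0).
have ksE (s t r : R) w : (ks s t (r, w)) = ((EFin \o k ^~ w) \_ `[s, t]) r.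
  by rewrite epatch_indic /= /ks/= EFinM.
have aei : {ae P, forall w, forall t : R, mu.-integrable `[0, t] (EFin \o k ^~ w)}.
  have : {ae P, forall w, forall n, mu.-integrable `[0, n%:R] (EFin \o k ^~ w)}.
    apply/ae_foralln => n.
    have := ae_integrable2 (iks 0 n%:R (lexx _)); apply: filterS => w H.
    apply/integrable_mkcond => //.
    by apply: eq_integrable H => // r _; rewrite ksE.
  apply: filterS => w H t.
  apply: integrableS (H (Num.truncn t).+1) => //; apply: subset_itvl.
  rewrite bnd_simp; have [t0|t0] := leP 0 t.
    by have /andP[_ /ltW] := truncn_itv t0.
  by rewrite (le_trans (ltW t0)).
move=> s t s0 st; have t0 := le_trans s0 st.
pose F := fubini_F P (ks s t).
have iF : mu.-integrable setT F by exact: (integrable_fubini_F (iks s t s0)).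
have FE (r : R) : `[s, t]%classic r -> F r = (\int[P]_w (k r w)%:E)%E.
  move=> rst; rewrite /F /fubini_F; apply: eq_integral => w _.
  by rewrite ksE patchE mem_set.
have iF' : mu.-integrable `[s, t] F by apply: integrableS iF.
have mRk : measurable_fun setT (fun r : measurableTypeR R => \int[P]_w k r w).
  exact: (@measurable_Rintegral _ (measurableTypeR R)).
split.
  apply: le_integrable iF' => //.
    by apply/measurable_EFinP; exact: measurable_funTS mRk.
  move=> r rst; rewrite FE// /Rintegral /=.
  by case: (\int[P]_w (k r w)%:E)%E => [x| |] /=; rewrite ?normr0 ?leey.
rewrite -RintegralB//; [|exact: if_..].
have -> : \int[P]_w (f t w - f s w) = fine (\int[P]_w \int[mu]_r ks s t (r, w))%E.
  congr fine; apply: ae_eq_integral => //.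
  - apply: measurable_int (integrableB _ (if_ _ t0) (if_ _ s0)) => //.
  - exact: measurable_fubini_G (iks s t s0).
  - apply: filterS2 aei pf => w iw /(_ iw) pw _.
    have [iw' ->] := pw _ _ s0 st.
    rewrite /Rintegral fineK; last exact: integrable_fin_num iw'.
    by rewrite integral_mkcond; apply: eq_integral => r _; rewrite ksE.
rewrite -(Fubini (iks s t s0)); congr fine.
rewrite [RHS]integral_mkcond; apply: ae_eq_integral => //.
- exact: measurable_int iF.
- apply/(measurable_restrictT _ _).1 => //; apply/measurable_EFinP.
  exact: measurable_funTS mRk.
- apply: filterS (integrable_ae measurableT iF) => r /= + _ => /(_ I) finF.
  rewrite patchE; case: ifPn => [/[!inE] rst|rst].
    by rewrite /= /Rintegral -(FE _ rst) fineK.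
  rewrite integral0_eq// => w _.
  by rewrite ksE patchE (negbTE rst).
Qed.

End expectation.

(** * Expectations over independent pairs *)

Lemma Rintegral_sum {R : realType} d (T : measurableType d)
    (m : {measure set T -> \bar R}) n (K : 'I_n -> T -> R) :
  (forall j, m.-integrable setT (EFin \o K j)) ->
  m.-integrable setT (EFin \o (fun z => \sum_(j < n) K j z)) /\
  \int[m]_z (\sum_(j < n) K j z) = \sum_(j < n) \int[m]_z K j z.
Proof.
move=> iK.
have iS (r : seq 'I_n) : m.-integrable setT (EFin \o (fun z => \sum_(j <- r) K j z)).
  have := @integrable_sum _ _ _ m _ measurableT _ r xpredT
    (fun j z => (K j z)%:E) (fun j _ => iK j).
  by apply: eq_integrable => // z _; rewrite /= -sumEFin.
split; first exact: iS.
elim: (index_enum 'I_n) => [|j r IH].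
  by rewrite big_nil; under eq_Rintegral do rewrite big_nil; rewrite Rintegral_cst ?mul0r.
by rewrite big_cons -IH; under eq_Rintegral do rewrite big_cons; rewrite RintegralD.
Qed.

Section pairs.
Context {R : realType} d (T : measurableType d) (P : probability T R).
Notation PP := (P \x P)%E.
Implicit Types (f g : T -> R) (K : T * T -> R).

Notation intP f := (P.-integrable setT (EFin \o f)).
Notation intPP K := (PP.-integrable setT (EFin \o K)).

Lemma Rintegral_pair K : intPP K ->
  \int[P]_w (\int[P]_w' K (w, w')) = \int[PP]_z K z.
Proof.
move=> iK; rewrite [RHS]/Rintegral -(integral12_prod_meas1 iK); congr fine.
apply: ae_eq_integral => //.
- apply/measurable_EFinP; apply: (@measurable_Rintegral _ _ _ P _ _ (fun w w' => K (w, w'))).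
  apply/measurable_EFinP; rewrite (_ : _ \o _ = EFin \o K).
    exact: measurable_int iK.
  by apply/funext => -[].
- exact: measurable_fubini_F iK.
- apply: filterS (ae_integrable1 iK) => w iw _.
  by rewrite /= fineK//; exact: (integrable_fin_num _ iw).
Qed.

Lemma integrable_swap K : intPP K -> intPP (K \o swap_pair).
Proof.
move=> iK; have mK := measurable_int _ iK.
have mKs : measurable_fun setT (EFin \o (K \o swap_pair)).
  by apply: (measurableT_comp mK); exact: measurable_swap.
apply/(integrable21ltyP P P mKs).
exact: (integrable12ltyP P P mK).1 iK.
Qed.

Lemma Rintegral_swap K : intPP K -> \int[PP]_z K (swap_pair z) = \int[PP]_z K z.
Proof.
move=> iK; rewrite /Rintegral -(integral12_prod_meas1 iK).
by rewrite -(integral21_prod_meas1 (integrable_swap iK)).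
Qed.

Lemma integrable_fst f : intP f -> intPP (fun z => f z.1).
Proof.
move=> iF; have mf := measurable_int _ iF.
have mF : measurable_fun setT (fun z : T * T => (f z.1)%:E).
  exact: (measurableT_comp mf measurable_fst).
apply/(integrable12ltyP P P mF).
have E w : (\int[P]_w' `|(f (w, w').1)%:E| = `|(EFin \o f) w|)%E.
  by rewrite (eq_integral (cst `|(f w)%:E|%E))// integral_cst//= probability_setT mule1.
by under eq_integral do rewrite E; case/integrableP : iF.
Qed.

Lemma integrable_snd f : intP f -> intPP (fun z => f z.2).
Proof. by move=> /integrable_fst/integrable_swap. Qed.

Lemma integrable_pairM f g : intP f -> intP g -> intPP (fun z => f z.1 * g z.2).
Proof.
move=> iF iG; have mf := measurable_int _ iF; have mg := measurable_int _ iG.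
have mF : measurable_fun setT (fun z : T * T => (f z.1 * g z.2)%:E).
  apply/measurable_EFinP/measurable_funM; apply/measurable_EFinP.
    exact: (measurableT_comp mf measurable_fst).
  exact: (measurableT_comp mg measurable_snd).
apply/(integrable12ltyP P P mF).
have E w : (\int[P]_w' `|(f w * g w')%:E| =
    `|(EFin \o f) w| * \int[P]_w' `|(EFin \o g) w'|)%E.
  rewrite -ge0_integralZl//; last exact: measurableT_comp.
  by apply: eq_integral => w' _; rewrite EFinM abseM.
under eq_integral do rewrite E.
rewrite ge0_integralZr//; last 2 first.
- exact: measurableT_comp.
- exact: integral_ge0.
case/integrableP : iF => _ iF; case/integrableP : iG => _ iG.
by rewrite lte_mul_pinfty// ?integral_ge0// ge0_fin_numE// integral_ge0.
Qed.

Lemma Rintegral_fst f : intP f -> \int[PP]_z f z.1 = \int[P]_w f w.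
Proof.
move=> iF; rewrite -(Rintegral_pair (integrable_fst iF)).
by apply: eq_Rintegral => w _ /=; rewrite Rintegral_cst//= probability_setT mulr1.
Qed.

Lemma Rintegral_snd f : intP f -> \int[PP]_z f z.2 = \int[P]_w f w.
Proof. by move=> iF; rewrite -Rintegral_fst// -(Rintegral_swap (integrable_fst iF)). Qed.

Lemma Rintegral_pairM f g : intP f -> intP g ->
  \int[PP]_z (f z.1 * g z.2) = (\int[P]_w f w) * \int[P]_w g w.
Proof.
move=> iF iG; rewrite -(Rintegral_pair (integrable_pairM iF iG)) /=.
rewrite -RintegralZr//; apply: eq_Rintegral => w _.
by rewrite RintegralZl.
Qed.

Lemma integrable_diffM f g : intP f -> intP g -> intP (fun w => f w * g w) ->
  intPP (fun z => (f z.1 - f z.2) * (g z.1 - g z.2)).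
Proof.
move=> iF iG iFG.
have i1 := integrable_fst iFG; have i2 := integrable_snd iFG.
have i3 := integrable_pairM iF iG; have i4 := integrable_swap i3.
have := integrableB measurableT (integrableD measurableT i1 i2)
  (integrableD measurableT i3 i4).
apply: eq_integrable => // z _ /=; rewrite -!EFinD; congr EFin; ring.
Qed.

(** Twice a covariance: the differences of two independent copies are blind to
the means. *)
Lemma Rintegral_diffM f g : intP f -> intP g -> intP (fun w => f w * g w) ->
  \int[PP]_z ((f z.1 - f z.2) * (g z.1 - g z.2)) =
  2 * (\int[P]_w (f w * g w)) - 2 * (\int[P]_w f w * \int[P]_w g w).
Proof.
move=> iF iG iFG.
have i1 := integrable_fst iFG; have i2 := integrable_snd iFG.
have i3 := integrable_pairM iF iG; have i4 := integrable_swap i3.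
under eq_Rintegral => z _.
  have -> : (f z.1 - f z.2) * (g z.1 - g z.2) =
    (f z.1 * g z.1 + f z.2 * g z.2) - (f z.1 * g z.2 + f z.2 * g z.1) by ring.
  over.
rewrite RintegralB//; [|exact: (integrableD _ i1 i2)|exact: (integrableD _ i3 i4)].
rewrite !RintegralD// (Rintegral_fst iFG) (Rintegral_snd iFG).
have := Rintegral_swap i3; rewrite /= => ->; rewrite Rintegral_pairM//; ring.
Qed.

(** Newton's third law: an antisymmetric kernel tested against a one-body
function only sees the differences of that function. *)
Lemma Rintegral_antisym f K :
  (forall z, K (swap_pair z) = - K z) -> measurable_fun setT f ->
  intPP K -> intPP (fun z => f z.1 * K z) ->
  \int[P]_w (f w * \int[P]_w' K (w, w')) =
  2^-1 * \int[PP]_z ((f z.1 - f z.2) * K z).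
Proof.
move=> aK mf iK ifK.
have -> : \int[P]_w (f w * \int[P]_w' K (w, w')) =
    \int[P]_w (\int[P]_w' (f w * K (w, w'))).
  congr fine; apply: ae_eq_integral => //.
  - apply/measurable_EFinP/measurable_funM => //.
    apply: (@measurable_Rintegral _ _ _ P _ _ (fun w w' => K (w, w'))).
    apply/measurable_EFinP; rewrite (_ : _ \o _ = EFin \o K).
      exact: measurable_int iK.
    by apply/funext => -[].
  - apply/measurable_EFinP.
    apply: (@measurable_Rintegral _ _ _ P _ _ (fun w w' => f w * K (w, w'))).
    apply/measurable_EFinP; rewrite (_ : _ \o _ = EFin \o (fun z => f z.1 * K z)).
      exact: measurable_int ifK.
    by apply/funext => -[].
  - by apply: filterS (ae_integrable1 iK) => w iw _; rewrite RintegralZl.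
have := Rintegral_pair ifK; rewrite /= => ->.
have iS := integrable_swap ifK.
have eS : \int[PP]_z (f z.2 * K z) = - \int[PP]_z (f z.1 * K z).
  rewrite -[in RHS](Rintegral_swap ifK) -mulN1r -RintegralZl//.
  by apply: eq_Rintegral => z _ /=; rewrite aK; ring.
have -> : \int[PP]_z ((f z.1 - f z.2) * K z) =
    \int[PP]_z (f z.1 * K z) - \int[PP]_z (f z.2 * K z).
  rewrite -RintegralB//; first by apply: eq_Rintegral => z _; rewrite mulrBl.
  have := integrableN iS; apply: eq_integrable => // z _ /=.
  by rewrite aK mulrN opprK.
by rewrite eS opprK; field.
Qed.

End pairs.

(** * Calculus along curves, and the interaction potential *)

Section euclidean.
Context {R : realType} {d : nat}.
Implicit Types x y z : 'rV[R]_d.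

Lemma dotrV_ge0 x : 0 <= dotrV x x.
Proof. by apply: sumr_ge0 => i _; rewrite -expr2 sqr_ge0. Qed.

Lemma enorm_ge0 x : 0 <= enorm x. Proof. exact: sqrtr_ge0. Qed.

Lemma enorm2 x : enorm x ^+ 2 = dotrV x x.
Proof. by rewrite sqr_sqrtr// dotrV_ge0. Qed.

Lemma dotrV0l x : dotrV 0 x = 0.
Proof. by rewrite /dotrV big1// => i _; rewrite mxE mul0r. Qed.

Lemma dotrVN x y : dotrV (- x) y = - dotrV x y.
Proof. by rewrite /dotrV -sumrN; apply: eq_bigr => i _; rewrite mxE mulNr. Qed.

Lemma dotrVZr (a : R) x y : dotrV x (a *: y) = a * dotrV x y.
Proof. by rewrite /dotrV mulr_sumr; apply: eq_bigr => i _; rewrite mxE mulrCA. Qed.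

Lemma dotrVDl x y z : dotrV (x + y) z = dotrV x z + dotrV y z.
Proof. by rewrite /dotrV -big_split; apply: eq_bigr => i _; rewrite mxE mulrDl. Qed.

Lemma dotrVBl x y z : dotrV (x - y) z = dotrV x z - dotrV y z.
Proof. by rewrite dotrVDl dotrVN. Qed.

Lemma enorm0 : enorm (0 : 'rV[R]_d) = 0.
Proof. by rewrite /enorm /dotrV big1 ?sqrtr0// => i _; rewrite mxE mul0r. Qed.

Lemma enormN x : enorm (- x) = enorm x.
Proof.
by rewrite /enorm /dotrV; congr Num.sqrt; apply: eq_bigr => i _; rewrite !mxE mulrNN.
Qed.

Lemma enormZ (a : R) x : enorm (a *: x) ^+ 2 = a ^+ 2 * enorm x ^+ 2.
Proof.
rewrite !enorm2 /dotrV mulr_sumr; apply: eq_bigr => i _; rewrite !mxE; ring.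
Qed.

Lemma coord_le_enorm x i : `|x 0 i| <= enorm x.
Proof.
rewrite -(@ler_pXn2r _ 2)// ?nnegrE ?enorm_ge0// enorm2 /dotrV (bigD1 i)//=.
rewrite real_normK ?num_real// expr2 lerDl.
by apply: sumr_ge0 => j _; rewrite -expr2 sqr_ge0.
Qed.

Lemma enorm_eq0 x : (enorm x == 0) = (x == 0).
Proof.
apply/eqP/eqP => [x0|->]; last exact: enorm0.
by apply/rowP => i; apply/eqP; rewrite mxE -normr_le0 -x0 coord_le_enorm.
Qed.

Lemma sqr_enormB x y : enorm (x - y) ^+ 2 <= 2 * enorm x ^+ 2 + 2 * enorm y ^+ 2.
Proof.
rewrite !enorm2 /dotrV !mulr_sumr -big_split; apply: ler_sum => i _.
rewrite !mxE -subr_ge0.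
by rewrite (_ : _ - _ = (x 0 i + y 0 i) ^+ 2) ?sqr_ge0//=; ring.
Qed.

End euclidean.

Section curves.
Context {R : realType}.

Lemma within_continuous_comp (V U : topologicalType) (A : set R) (g : R -> V) (h : V -> U) :
  {within A, continuous g} -> continuous h -> {within A, continuous (fun t => h (g t))}.
Proof. by move=> cg ch t; exact: (cvg_comp _ _ (cg t) (ch (g t))). Qed.

Lemma is_derive_comp_curve (V U : normedModType R) (F : V -> U) (g : R -> V) t g' :
  is_derive t (1 : R) g g' -> differentiable F (g t) ->
  is_derive t (1 : R) (F \o g) ('d F (g t) g').
Proof.
move=> [dg <-] dF.
have dgt : differentiable g t by exact/derivable1_diffP.
have dFg := differentiable_comp dgt dF.
apply: DeriveDef; first exact/derivable1_diffP.
by rewrite !deriveE// diff_comp.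
Qed.

Lemma is_derive_coord n (g : R -> 'rV[R]_n) t g' i :
  is_derive t (1 : R) g g' -> is_derive t (1 : R) (fun s => g s 0 i) (g' 0 i).
Proof.
move=> [dg dgE]; have dgi := (derivable_mxP g t 1).1 dg.
apply: DeriveDef; first exact: dgi.
by rewrite -dgE derive_mx// mxE.
Qed.

Lemma is_derive_continuous (V : normedModType R) (g : R -> V) t g' :
  is_derive t (1 : R) g g' -> {for t, continuous g}.
Proof. by move=> [dg _]; apply/differentiable_continuous/derivable1_diffP. Qed.

Lemma diff_grad n (F : 'rV[R]_n -> R) x h : differentiable F x ->
  'd F x h = dotrV (grad F x) h.
Proof.
move=> dF; rewrite [in LHS](row_sum_delta h) linear_sum /dotrV.
by apply: eq_bigr => i _; rewrite linearZ /= mxE -deriveE// mulrC.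
Qed.

End curves.

Section potential.
Context {R : realType} {d : nat} (W : 'rV[R]_d -> R).
Hypothesis W_C1 : C1_on setT W.
Hypothesis W_sym : forall x, W (- x) = W x.

Let dW x : differentiable W x. Proof. by have [] := W_C1 (I : setT x). Qed.

Lemma is_derive_potential (g : R -> 'rV[R]_d) (t : R) g' :
  is_derive t (1 : R) g g' ->
  is_derive t (1 : R) (fun s => W (g s)) (dotrV (grad W (g t)) g').
Proof. by move=> dg; rewrite -diff_grad//; exact: is_derive_comp_curve. Qed.

Lemma grad_continuous j : continuous (fun x => grad W x 0 j).
Proof.
have -> : (fun x => grad W x 0 j) = 'D_(delta_mx 0 j) W.
  by apply/funext => x; rewrite mxE.
by move=> x; have [_] := W_C1 (I : setT x); apply.
Qed.

Let is_derive_line (z h : 'rV[R]_d) (s : R) :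
  is_derive s (1 : R) (fun s => z + s *: h) h.
Proof.
have : is_derive s (1 : R) (fun s : R => z + s *: h) (0 + (1 : R) *: h).
  apply: is_deriveD.
  have [ds dE] := is_diff_scalel s h.
  apply: DeriveDef; first exact/derivable1_diffP.
  by rewrite deriveE// dE.
by rewrite add0r scale1r.
Qed.

Lemma grad_odd (x : 'rV[R]_d) : grad W (- x) = - grad W x.
Proof.
apply/rowP => j; rewrite [RHS]mxE; set v : 'rV[R]_d := delta_mx 0 j.
have vE (y : 'rV[R]_d) : dotrV y v = y 0 j.
  rewrite /dotrV (bigD1 j)//= big1 ?addr0 => [|i ij]; rewrite mxE ?eqxx ?mulr1//.
  by rewrite (negbTE ij) andbF mulr0.
have d1 := is_derive_potential (is_derive_line x v 0).
have := is_derive_potential (is_derive_line (- x) (- v) 0).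
rewrite (_ : (fun s => _) = (fun s => W (x + s *: v))); last first.
  by apply/funext => s; rewrite -W_sym scalerN opprD opprK opprK.
move=> [_]; have [_ ->] := d1.
by rewrite !scale0r !addr0 -(scaleN1r v) dotrVZr !vE => ->; rewrite mulN1r opprK.
Qed.

Lemma grad0 : grad W 0 = 0.
Proof.
have := grad_odd 0; rewrite oppr0 => /eqP; rewrite -addr_eq0 -mulr2n -scaler_nat.
by rewrite scaler_eq0 pnatr_eq0 => /eqP.
Qed.

Lemma potential_mvt (z h : 'rV[R]_d) : exists2 th : R, 0 < th < 1 &
  W (z + h) - W z = dotrV (grad W (z + th *: h)) h.
Proof.
pose g := fun s : R => z + s *: h.
have dg (s : R) : is_derive s (1 : R) g h by exact: is_derive_line.
have dWg s := is_derive_potential (dg s).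
have [th] := MVT ltr01 (fun s _ => dWg s)
  (continuous_subspaceT (fun s => is_derive_continuous (dWg s))).
rewrite in_itv/= => th01.
by rewrite /g scale1r scale0r addr0 subr0 mulr1 => E; exists th.
Qed.

Variables lambda Lambda : R.
Hypothesis lambda_gt0 : 0 < lambda.
Hypothesis W_convex : forall x y,
      lambda * enorm (x - y) ^+ 2 <= dotrV (grad W x - grad W y) (x - y) /\
      dotrV (grad W x - grad W y) (x - y) <= Lambda * enorm (x - y) ^+ 2.

(** The evenness of W puts its critical point at the origin. *)
Lemma grad_coercive z : lambda * enorm z ^+ 2 <= dotrV (grad W z) z.
Proof. by have [+ _] := W_convex z 0; rewrite grad0 !subr0. Qed.

Lemma potential_convex z h : W z + dotrV (grad W z) h <= W (z + h).
Proof.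
have [th /andP[th0 th1] E] := potential_mvt z h.
have [+ _] := W_convex (z + th *: h) z.
rewrite addrAC subrr add0r dotrVZr dotrVBl enormZ => H.
have : 0 <= th * (dotrV (grad W (z + th *: h)) h - dotrV (grad W z) h).
  by apply: le_trans H; rewrite mulr_ge0 ?(ltW lambda_gt0)// mulr_ge0 ?sqr_ge0.
by rewrite pmulr_rge0// subr_ge0 -E; lra.
Qed.

Lemma potential_upper z : W z - W 0 <= Lambda * enorm z ^+ 2.
Proof.
have [th /andP[th0 th1]] := potential_mvt 0 z; rewrite !add0r => ->.
have [_] := W_convex (th *: z) 0; rewrite grad0 !subr0 dotrVZr enormZ => H.
have {}H : dotrV (grad W (th *: z)) z <= th * (Lambda * enorm z ^+ 2).
  by rewrite -(ler_pM2l th0) (le_trans H)// le_eqVlt; apply/orP; left; apply/eqP; ring.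
apply: (le_trans H); rewrite ler_piMl ?(ltW th1)//.
have [h1 h2] := W_convex z 0; move: (le_trans h1 h2); rewrite subr0; apply: le_trans.
by rewrite mulr_ge0 ?sqr_ge0// ltW.
Qed.

(** Convexity twice, from 0 to z/2 and from z/2 to z; the coercivity of the
gradient at z/2 yields the quadratic gain. *)
Lemma potential_lower z : lambda / 4 * enorm z ^+ 2 <= W z - W 0.
Proof.
have h0 : W 0 <= W (2^-1 *: z).
  have := potential_convex 0 (2^-1 *: z).
  by rewrite grad0 add0r dotrV0l addr0.
have := potential_convex (2^-1 *: z) (2^-1 *: z).
rewrite -scalerDl (_ : 2^-1 + 2^-1 = 1 :> R); last by lra.
rewrite scale1r dotrVZr.
have := grad_coercive (2^-1 *: z); rewrite enormZ dotrVZr; lra.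
Qed.

(** A convex function between two parabolas: its increment over a step of length
|z| along a coordinate axis bounds the partial derivative. *)
Lemma grad_linear_growth z j : `|grad W z 0 j| <= 4 * Lambda * enorm z.
Proof.
have [->|z0] := eqVneq z 0; first by rewrite grad0 mxE normr0 enorm0 mulr0.
have n0 : 0 < enorm z by rewrite lt_neqAle enorm_ge0 eq_sym enorm_eq0 z0.
have key (e : R) : e ^+ 2 = 1 -> e * grad W z 0 j <= 4 * Lambda * enorm z.
  move=> e1; pose h := (e * enorm z) *: delta_mx 0 j : 'rV[R]_d.
  have hE : dotrV (grad W z) h = enorm z * (e * grad W z 0 j).
    rewrite /dotrV (bigD1 j)//= big1 ?addr0 => [|i ij].
      by rewrite /h !mxE !eqxx /=; ring.
    by rewrite /h !mxE (negbTE ij) andbF !mulr0.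
  have h2 : enorm h ^+ 2 = enorm z ^+ 2.
    rewrite /h enormZ exprMn e1 mul1r enorm2 /dotrV (bigD1 j)//= big1 => [|i ij].
      by rewrite !mxE !eqxx /=; ring.
    by rewrite !mxE (negbTE ij) andbF mul0r.
  have [h3 h4] := W_convex z 0.
  have L0 : 0 <= Lambda.
    move: (le_trans h3 h4); rewrite subr0 ler_pM2r ?exprn_gt0// => /(le_trans (ltW lambda_gt0)).
    exact.
  rewrite -(ler_pM2l n0) -hE.
  have := potential_convex z h; have := potential_upper (z + h).
  have := sqr_enormB z (- h); rewrite opprK enormN h2.
  have := potential_lower z; have : 0 <= lambda / 4 * enorm z ^+ 2.
    by rewrite mulr_ge0 ?sqr_ge0// divr_ge0// ltW.
  move=> a1 a2 a3 a4 a5.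
  have := ler_wpM2l L0 a3; lra.
rewrite ler_norml; apply/andP; split.
  by rewrite lerNl; have := key (-1); rewrite mulN1r; apply; rewrite sqrrN expr1n.
by have := key 1; rewrite mul1r; apply; rewrite expr1n.
Qed.

End potential.

(** * Particles interacting by alignment and a convex potential *)

Section measurable_rV_ops.
Context {R : realType} {n : nat} {d} {U : measurableType d}.

Lemma measurable_rVB (f g : U -> 'rV[R]_n) :
  measurable_fun setT f -> measurable_fun setT g ->
  measurable_fun setT (fun p => f p - g p).
Proof.
move=> /measurable_fun_rVP mf /measurable_fun_rVP mg; apply/measurable_fun_rVP => i.
under eq_fun do rewrite !mxE.
exact: measurable_funB.
Qed.

Lemma measurable_enorm : measurable_fun setT (@enorm R n).
Proof.
have msqrt : measurable_fun setT (@Num.sqrt R).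
  exact: continuous_measurable_fun (@sqrt_continuous R).
have mdot : measurable_fun setT (fun y : 'rV[R]_n => dotrV y y).
  by apply: measurable_sum => i; apply: measurable_funM; exact: measurable_coor.
exact: (measurableT_comp msqrt mdot).
Qed.

Lemma measurable_enorm_comp (f : U -> 'rV[R]_n) :
  measurable_fun setT f -> measurable_fun setT (fun p => enorm (f p)).
Proof. exact: measurableT_comp measurable_enorm. Qed.

Lemma measurable_coor_comp (f : U -> 'rV[R]_n) i :
  measurable_fun setT f -> measurable_fun setT (fun p => f p 0 i).
Proof. by move=> /measurable_fun_rVP. Qed.

End measurable_rV_ops.

Lemma measurable_integral_ge0 {R : realType} d (U : measurableType d)
    (Q : probability U R) (k : R -> U -> R) :
  measurable_fun setT (fun p : measurableTypeR R * U => k p.1 p.2) ->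
  (forall r w, 0 <= k r w) ->
  measurable_fun setT (fun r : measurableTypeR R => (\int[Q]_w (k r w)%:E)%E).
Proof.
move=> mk k0.
apply: (@measurable_fun_fubini_tonelli_F _ _ _ _ _ Q (fun p => (k p.1 p.2)%:E)).
  exact/measurable_EFinP.
by move=> p; rewrite lee_fin.
Qed.

Section particles.
Context {R : realType} {n : nat} d (T : measurableType d) (P : probability T R).
Variables (W psi : 'rV[R]_n -> R) (x v : R -> T -> 'rV[R]_n).
Notation mu := (@lebesgue_measure R).
Notation PP := (P \x P)%E.

Definition pair_force (j : 'I_n) (t : R) (z : T * T) : R :=
  grad W (x t z.1 - x t z.2) 0 j
  + psi (x t z.1 - x t z.2) * (v t z.1 0 j - v t z.2 0 j).

Definition acceleration (j : 'I_n) (t : R) (w : T) : R :=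
  - \int[P]_w' pair_force j t (w, w').

(** Newton's law holds with a C^1 velocity, but the expected force is only
identified with the acceleration at almost every time. *)
Record newton_path (w : T) : Prop := {
  path_cont : {within `[0, +oo[, continuous (x ^~ w)} ;
  path_velocity : forall t : R, 0 < t -> is_derive t (1 : R) (x ^~ w) (v t w) ;
  path_vcont : {within `[0, +oo[, continuous (v ^~ w)} ;
  path_acceleration : exists a : R -> 'rV[R]_n,
    [/\ forall t : R, 0 < t -> is_derive t (1 : R) (v ^~ w) (a t),
        forall t : R, 0 < t -> {for t, continuous a} &
        {ae mu, forall t : R, 0 < t -> forall j, a t 0 j = acceleration j t w}] }.

(** Dominates the alignment part of the pair force, also when it is tested
against positions or velocities. *)
Definition exchange (t : R) (z : T * T) : R :=
  psi (x t z.1 - x t z.2) * enorm (v t z.1 - v t z.2)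
  * (1 + enorm (x t z.1) + enorm (v t z.1)).

Definition moment (t : R) (w : T) : R := enorm (x t w) ^+ 2 + enorm (v t w) ^+ 2.

Record particle_flow : Prop := {
  flow_mx : measurable_fun setT (fun p : measurableTypeR R * T => x p.1 p.2) ;
  flow_mv : measurable_fun setT (fun p : measurableTypeR R * T => v p.1 p.2) ;
  flow_moment : forall t : R, 0 <= t -> (\int[P]_w (moment t w)%:E < +oo)%E ;
  flow_moment_int : forall t : R,
    (\int[mu]_(r in `[0%R, t]) \int[P]_w (moment r w)%:E < +oo)%E ;
  flow_exchange_int : forall t : R,
    (\int[mu]_(r in `[0%R, t]) \int[P]_w \int[P]_w' (exchange r (w, w'))%:E < +oo)%E ;
  flow_newton : {ae P, forall w, newton_path w} }.

Hypothesis flow : particle_flow.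
Hypothesis W_C1 : C1_on setT W.
Hypothesis W_sym : forall z, W (- z) = W z.
Variables lambda Lambda psi_m : R.
Hypothesis lambda_gt0 : 0 < lambda.
Hypothesis W_convex : forall y z,
      lambda * enorm (y - z) ^+ 2 <= dotrV (grad W y - grad W z) (y - z) /\
      dotrV (grad W y - grad W z) (y - z) <= Lambda * enorm (y - z) ^+ 2.
Hypothesis Lambda_ge0 : 0 <= Lambda.
Hypothesis psi_meas : measurable_fun setT psi.
Hypothesis psi_even : forall z, psi (- z) = psi z.
Hypothesis psi_m_gt0 : 0 < psi_m.
Hypothesis psi_lower : forall z, psi_m <= psi z.

Let psi_ge0 z : 0 <= psi z. Proof. by apply: le_trans (psi_lower z); exact: ltW. Qed.

Notation intPP K := (PP.-integrable setT (EFin \o K)).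
Notation RTT := (measurableTypeR R * (T * T))%type.

Let mx1 : measurable_fun setT (fun p : RTT => x p.1 p.2.1).
Proof.
apply: (measurableT_comp (flow_mx flow) (_ : measurable_fun setT (fun p : RTT => (p.1, p.2.1)))).
apply/measurable_fun_pairP; split; first exact: measurable_fst.
exact: (measurableT_comp measurable_fst measurable_snd).
Qed.

Let mx2 : measurable_fun setT (fun p : RTT => x p.1 p.2.2).
Proof.
apply: (measurableT_comp (flow_mx flow) (_ : measurable_fun setT (fun p : RTT => (p.1, p.2.2)))).
apply/measurable_fun_pairP; split; first exact: measurable_fst.
exact: (measurableT_comp measurable_snd measurable_snd).
Qed.

Let mv1 : measurable_fun setT (fun p : RTT => v p.1 p.2.1).
Proof.
apply: (measurableT_comp (flow_mv flow) (_ : measurable_fun setT (fun p : RTT => (p.1, p.2.1)))).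
apply/measurable_fun_pairP; split; first exact: measurable_fst.
exact: (measurableT_comp measurable_fst measurable_snd).
Qed.

Let mv2 : measurable_fun setT (fun p : RTT => v p.1 p.2.2).
Proof.
apply: (measurableT_comp (flow_mv flow) (_ : measurable_fun setT (fun p : RTT => (p.1, p.2.2)))).
apply/measurable_fun_pairP; split; first exact: measurable_fst.
exact: (measurableT_comp measurable_snd measurable_snd).
Qed.

Let mdx := measurable_rVB mx1 mx2.
Let mdv := measurable_rVB mv1 mv2.

Let mdist : measurable_fun setT (fun p : RTT => psi (x p.1 p.2.1 - x p.1 p.2.2)).
Proof. exact: (measurableT_comp psi_meas mdx). Qed.

Let mgrad j : measurable_fun setT
  (fun p : RTT => grad W (x p.1 p.2.1 - x p.1 p.2.2) 0 j).
Proof.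
have mg : measurable_fun setT (fun y => grad W y 0 j).
  exact: (continuous_measurable_rV (@grad_continuous _ _ _ W_C1 j)).
exact: (measurableT_comp mg mdx).
Qed.

Let mpot : measurable_fun setT (fun p : RTT => W (x p.1 p.2.1 - x p.1 p.2.2)).
Proof.
have cW : continuous W.
  by move=> z; apply: differentiable_continuous; have [] := W_C1 (I : setT z).
have mW : measurable_fun setT W by exact: continuous_measurable_rV cW.
exact: (measurableT_comp mW mdx).
Qed.

Let mforce j : measurable_fun setT (fun p : RTT => pair_force j p.1 p.2).
Proof.
apply: measurable_funD; first exact: mgrad.
apply: measurable_funM; first exact: mdist.
by apply: measurable_funB; exact: measurable_coor_comp.
Qed.

(** * Domination of the pair forces *)

Definition domination (t : R) (z : T * T) : R :=
  exchange t z + (1 + moment t z.1 + moment t z.2).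

Let mexchange : measurable_fun setT (fun p : RTT => exchange p.1 p.2).
Proof.
apply: measurable_funM.
  apply: measurable_funM; first exact: mdist.
  exact: measurable_enorm_comp.
apply: measurable_funD; last exact: measurable_enorm_comp.
by apply: measurable_funD => //; exact: measurable_enorm_comp.
Qed.

Let mmoment : measurable_fun setT (fun p : measurableTypeR R * T => moment p.1 p.2).
Proof.
apply: measurable_funD; apply: measurable_funX; apply: measurable_enorm_comp.
  exact: flow_mx flow.
exact: flow_mv flow.
Qed.

Let mdomination : measurable_fun setT (fun p : RTT => domination p.1 p.2).
Proof.
apply: measurable_funD; first exact: mexchange.
apply: measurable_funD.
  apply: measurable_funD => //.
  by apply: measurable_funD; apply: measurable_funX; exact: measurable_enorm_comp.
by apply: measurable_funD; apply: measurable_funX; exact: measurable_enorm_comp.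
Qed.

Let exchange_ge0 t z : 0 <= exchange t z.
Proof. by rewrite mulr_ge0 ?mulr_ge0 ?addr_ge0 ?enorm_ge0. Qed.

Let moment_ge0 t w : 0 <= moment t w.
Proof. by rewrite addr_ge0 ?sqr_ge0. Qed.

Let domination_ge0 t z : 0 <= domination t z.
Proof. by rewrite addr_ge0 ?exchange_ge0// !addr_ge0 ?sqr_ge0. Qed.

Let section1 (f : measurableTypeR R * T -> R) t :
  measurable_fun setT f -> measurable_fun setT (fun w => f (t, w)).
Proof. by move=> mf; exact: (measurableT_comp mf (pair1_measurable t)). Qed.

Let section2 (f : RTT -> R) t :
  measurable_fun setT f -> measurable_fun setT (fun z => f (t, z)).
Proof. by move=> mf; exact: (measurableT_comp mf (pair1_measurable t)). Qed.

Let moment_integrable t : 0 <= t -> P.-integrable setT (EFin \o moment t).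
Proof.
move=> t0; apply/integrableP; split.
  by apply/measurable_EFinP; exact: (section1 t mmoment).
under eq_integral do rewrite /= ger0_norm ?moment_ge0//.
exact: (flow_moment flow).
Qed.

(** The majorant behind every exchange of expectation and time integral. *)
Lemma domination_time (t : R) :
  (\int[mu]_(r in `[0%R, t]) \int[PP]_z (domination r z)%:E < +oo)%E.
Proof.
have mm : measurable_fun setT (fun r : measurableTypeR R => (\int[P]_w (moment r w)%:E)%E).
  exact: measurable_integral_ge0.
have me : measurable_fun setT (fun r : measurableTypeR R => (\int[PP]_w (exchange r w)%:E)%E).
  exact: (@measurable_integral_ge0 _ _ _ PP).
have E r : 0 <= r -> (\int[PP]_z (domination r z)%:E =
    \int[PP]_z (exchange r z)%:E + (1 + 2%:E * \int[P]_w (moment r w)%:E))%E.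
  move=> r0.
  have im := moment_integrable r0.
  have i1 := integrable_fst im; have i2 := integrable_snd im.
  rewrite (eq_integral (fun z => (exchange r z)%:E + (1 + moment r z.1 + moment r z.2)%:E)%E)//.
  rewrite ge0_integralD//; first last.
  - apply/measurable_EFinP; apply: measurable_funD.
      apply: measurable_funD => //; exact: (measurableT_comp (section1 r mmoment) measurable_fst).
    exact: (measurableT_comp (section1 r mmoment) measurable_snd).
  - by move=> z _; rewrite lee_fin !addr_ge0 ?sqr_ge0.
  - by apply/measurable_EFinP; exact: (section2 r mexchange).
  - by move=> z _; rewrite lee_fin.
  congr (_ + _)%E.
  have i0 : PP.-integrable setT (EFin \o (fun _ => 1 : R)).
    have i := finite_measure_integrable_cst P (1 : R) measurableT.
    exact: (integrable_fst i).
  have i01 := integrableD measurableT i0 i1.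
  have -> : (\int[PP]_z (1 + moment r z.1 + moment r z.2)%:E =
     (\int[PP]_z (1 + moment r z.1 + moment r z.2))%:E)%E.
    by rewrite /Rintegral fineK//; apply: integrable_fin_num => //; exact: (integrableD _ i01 i2).
  rewrite RintegralD// RintegralD// Rintegral_fst// Rintegral_snd// Rintegral_cst//=.
  rewrite probability_setT/= mulr1.
  have -> : (\int[P]_w (moment r w)%:E = (\int[P]_w moment r w)%:E)%E.
    by rewrite /Rintegral fineK//; exact: (integrable_fin_num _ im).
  by rewrite -EFinM -EFinD; congr EFin; ring.
rewrite (eq_integral (fun r : measurableTypeR R => \int[PP]_z (exchange r z)%:E +
  (1 + 2%:E * \int[P]_w (moment r w)%:E))%E); last first.
  by move=> r /[!inE]/= /[!in_itv]/= /andP[r0 _]; rewrite E.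
have m1 : measurable_fun `[0, t] (fun r => 1 + 2%:E * \int[P]_w (moment r w)%:E)%E.
  apply: emeasurable_funD => //; apply: measurable_funeM.
  exact: (measurable_funTS mm).
rewrite ge0_integralD//; first last.
- by move=> r _; rewrite adde_ge0// mule_ge0// integral_ge0// => w _; rewrite lee_fin.
- exact: (measurable_funTS me).
- by move=> r _; rewrite integral_ge0// => w _; rewrite lee_fin.
apply: lte_add_pinfty.
  apply: le_lt_trans (flow_exchange_int flow t).
  rewrite le_eqVlt; apply/orP; left; apply/eqP; apply: eq_integral => r _.
  rewrite (fubini_tonelli1 (fun z => (exchange r z)%:E)) //.
    by apply/measurable_EFinP; exact: (section2 r mexchange).
  by move=> z; rewrite lee_fin.
rewrite ge0_integralD//; first last.
- by apply: measurable_funeM; exact: (measurable_funTS mm).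
- by move=> r _; rewrite mule_ge0// integral_ge0// => w _; rewrite lee_fin.
apply: lte_add_pinfty.
  rewrite integral_cst//= mul1e lebesgue_measure_itv/=.
  by case: ifPn => _; rewrite ?ltry// -EFinB ltry.
rewrite ge0_integralZl//; first last.
- by move=> r _; rewrite integral_ge0// => w _; rewrite lee_fin.
- exact: (measurable_funTS mm).
by rewrite lte_mul_pinfty//; exact: flow_moment_int.
Qed.

Let mdom_time : measurable_fun setT
  (fun r : measurableTypeR R => (\int[PP]_z (domination r z)%:E)%E).
Proof. exact: (@measurable_integral_ge0 _ _ _ PP). Qed.

(** At such times all the pair integrals below converge. *)
Definition good_time (t : R) := PP.-integrable setT (EFin \o domination t).

Lemma good_times : {ae mu, forall t : R, 0 <= t -> good_time t}.
Proof.
have H : {ae mu, forall t : R, forall N : nat, `[0, N%:R]%classic t ->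
    (\int[PP]_z (domination t z)%:E)%E \is a fin_num}.
  apply/ae_foralln => N; apply: (@integrable_ae _ _ _ mu _ _ (fun t => (\int[PP]_z (domination t z)%:E)%E)) => //.
  apply/integrableP; split; first exact: (measurable_funTS mdom_time).
  apply: le_lt_trans (domination_time N%:R).
  rewrite le_eqVlt; apply/orP; left; apply/eqP; apply: eq_integral => r _.
  by rewrite gee0_abs// integral_ge0// => z _; rewrite lee_fin.
apply: (ae_imp H) => t Ht t0.
have := Ht (Num.truncn t).+1; rewrite /= in_itv/= t0/=.
have /andP[_ /ltW ->] := truncn_itv t0; move=> /(_ isT) fin.
apply/integrableP; split; first by apply/measurable_EFinP; exact: (section2 t mdomination).
under eq_integral do rewrite /= ger0_norm//.
by rewrite -ge0_fin_numE// integral_ge0// => z _; rewrite lee_fin.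
Qed.

Lemma dominated_integrable (K : T * T -> R) (C t : R) : good_time t -> measurable_fun setT K ->
  (forall z, `|K z| <= C * domination t z) -> PP.-integrable setT (EFin \o K).
Proof.
move=> gt mK KC; apply: (le_integrable _ _ _ (integrableZl _ C gt)) => //.
- exact/measurable_EFinP.
- by move=> z _; rewrite /= lee_fin (le_trans (KC z))// ler_norm.
Qed.

Lemma dominated_time1 (k : R -> T -> R) (C : R) : 0 <= C ->
  measurable_fun setT (fun p : measurableTypeR R * T => k p.1 p.2) ->
  (forall r w, (`|k r w|%:E <= C%:E * \int[P]_w' (domination r (w, w'))%:E)%E) ->
  forall t : R, (\int[mu]_(r in `[0%R, t]) \int[P]_w `|k r w|%:E < +oo)%E.
Proof.
move=> C0 mk kC t.
apply: (@le_lt_trans _ _ (\int[mu]_(r in `[0%R, t]) (C%:E * \int[PP]_z (domination r z)%:E)))%E.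
  have mdz r : measurable_fun setT (fun z => (domination r z)%:E).
    by apply/measurable_EFinP; exact: (section2 r mdomination).
  apply: ge0_le_integral => //.
  - by move=> r _; apply: integral_ge0.
  - apply: (measurable_funTS (measurable_integral_ge0 _ (_ : measurable_fun setT (fun p : measurableTypeR R * T => `|k p.1 p.2|)) _)) => //.
    exact: measurableT_comp.
  - by apply: measurable_funeM; exact: (measurable_funTS mdom_time).
  - move=> r _; rewrite fubini_tonelli1//; last by move=> z; rewrite lee_fin.
    have mF : measurable_fun setT (fubini_F P (fun z => (domination r z)%:E)).
      by apply: measurable_fun_fubini_tonelli_F => // z; rewrite lee_fin.
    have F0 w : (0 <= fubini_F P (fun z => (domination r z)%:E) w)%E.
      by apply: integral_ge0 => w' _; rewrite lee_fin.
    rewrite -ge0_integralZl//; apply: ge0_le_integral => //.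
      by apply/measurable_EFinP/measurableT_comp => //; exact: (section1 r mk).
    by apply: measurable_funeM.
rewrite ge0_integralZl//; first last.
- by move=> r _; rewrite integral_ge0// => z _; rewrite lee_fin.
- exact: (measurable_funTS mdom_time).
by rewrite lte_mul_pinfty//; exact: domination_time.
Qed.

Lemma dominated_time2 (K : R -> T * T -> R) (C : R) : 0 <= C ->
  measurable_fun setT (fun p : RTT => K p.1 p.2) ->
  (forall r z, `|K r z| <= C * domination r z) ->
  forall t : R, (\int[mu]_(r in `[0%R, t]) \int[PP]_z `|K r z|%:E < +oo)%E.
Proof.
move=> C0 mK KC t.
apply: (@le_lt_trans _ _ (\int[mu]_(r in `[0%R, t]) (C%:E * \int[PP]_z (domination r z)%:E)))%E.
  have mdz r : measurable_fun setT (fun z => (domination r z)%:E).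
    by apply/measurable_EFinP; exact: (section2 r mdomination).
  have mKn : measurable_fun setT (fun p : RTT => `|K p.1 p.2|) by exact: measurableT_comp.
  apply: ge0_le_integral => //.
  - by move=> r _; apply: integral_ge0.
  - apply: measurable_funTS; exact: (@measurable_integral_ge0 _ _ _ PP (fun r z => `|K r z|)).
  - by apply: measurable_funeM; exact: (measurable_funTS mdom_time).
  - move=> r _; rewrite -ge0_integralZl//; last by move=> z _; rewrite lee_fin.
    apply: ge0_le_integral => //.
    + by apply/measurable_EFinP; exact: (section2 r mKn).
    + by apply: measurable_funeM.
    + by move=> z _; rewrite -EFinM lee_fin.
rewrite ge0_integralZl//; first last.
- by move=> r _; rewrite integral_ge0// => z _; rewrite lee_fin.
- exact: (measurable_funTS mdom_time).
by rewrite lte_mul_pinfty//; exact: domination_time.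
Qed.

(** The gradient part of the force grows linearly, so its product with h is
bounded by second moments; the alignment part is the exchange. *)
Lemma force_dominated j (r h c : R) z : 0 <= c ->
  `|h| <= c * (1 + enorm (x r z.1) + enorm (v r z.1)) ->
  `|h * pair_force j r z| <= c * (12 * Lambda + 1) * domination r z.
Proof.
move=> c0 hc; rewrite /domination /exchange /moment.
set a := enorm (x r z.1) in hc *; set b := enorm (v r z.1) in hc *.
set a' := enorm (x r z.2); set b' := enorm (v r z.2).
set p := psi (x r z.1 - x r z.2); set D := enorm (v r z.1 - v r z.2).
pose q := enorm (x r z.1 - x r z.2).
have a0 : 0 <= a by exact: enorm_ge0.
have b0 : 0 <= b by exact: enorm_ge0.
have p0 : 0 <= p by exact: psi_ge0.
have D0 : 0 <= D by exact: enorm_ge0.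
have q0 : 0 <= q by exact: enorm_ge0.
have q2 : q ^+ 2 <= 2 * a ^+ 2 + 2 * a' ^+ 2 by exact: sqr_enormB.
have F1 : `|pair_force j r z| <= 4 * Lambda * q + p * D.
  rewrite /pair_force (le_trans (ler_normD _ _))// lerD//; first exact: (grad_linear_growth W_C1 W_sym lambda_gt0 W_convex).
  rewrite normrM ger0_norm// ler_wpM2l//.
  by have := coord_le_enorm (v r z.1 - v r z.2) j; rewrite !mxE.
have s0 : 0 <= 1 + a + b by rewrite !addr_ge0.
rewrite normrM; apply: (le_trans (ler_pM (normr_ge0 _) (normr_ge0 _) hc F1)).
rewrite -!mulrA ler_wpM2l//.
have e1 : (1 + a + b) * q <= 3 * (1 + a ^+ 2 + b ^+ 2 + a' ^+ 2).
  have := sqr_ge0 (1 + a + b - q); have := sqr_ge0 (a - b); have := sqr_ge0 (a - 1).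
  have := sqr_ge0 (b - 1); have := sqr_ge0 a; have := sqr_ge0 b; nra.
have e2 : 4 * Lambda * ((1 + a + b) * q) <= 4 * Lambda * (3 * (1 + a ^+ 2 + b ^+ 2 + a' ^+ 2)).
  by rewrite ler_wpM2l// mulr_ge0.
have e3 : 0 <= p * D * (1 + a + b) by rewrite !mulr_ge0.
have e4 : 0 <= 12 * Lambda * (p * D * (1 + a + b)) by rewrite mulr_ge0// mulr_ge0.
have e5 : 0 <= 12 * Lambda * b' ^+ 2 by rewrite mulr_ge0 ?sqr_ge0// mulr_ge0.
have := sqr_ge0 a; have := sqr_ge0 b; have := sqr_ge0 a'; have := sqr_ge0 b'.
nra.
Qed.

Lemma acceleration_dominated j (r h c : R) w : 0 <= c ->
  `|h| <= c * (1 + enorm (x r w) + enorm (v r w)) ->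
  (`|h * acceleration j r w|%:E <=
   (c * (12 * Lambda + 1))%:E * \int[P]_w' (domination r (w, w'))%:E)%E.
Proof.
move=> c0 hc.
have mF : measurable_fun setT (fun w' => pair_force j r (w, w')).
  exact: (measurableT_comp (section2 r (mforce j)) (pair1_measurable w)).
have mD : measurable_fun setT (fun w' => domination r (w, w')).
  exact: (measurableT_comp (section2 r mdomination) (pair1_measurable w)).
have C0 : 0 <= c * (12 * Lambda + 1) by rewrite mulr_ge0// addr_ge0// mulr_ge0.
rewrite /acceleration mulrN normrN normrM.
apply: (@le_trans _ _ (`|h|%:E * \int[P]_w' `|pair_force j r (w, w')|%:E)%E).
  rewrite EFinM lee_wpmul2l//.
  have mFE : measurable_fun setT (fun w' => (pair_force j r (w, w'))%:E).
    exact/measurable_EFinP.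
  apply: le_trans (le_abse_integral P measurableT mFE).
  rewrite /Rintegral; case: (\int[P]_w' (pair_force j r (w, w'))%:E)%E => [y| |] //=.
    by rewrite normr0 leey.
  by rewrite normr0 leey.
rewrite -!ge0_integralZl//; first last.
- by apply/measurable_EFinP/measurableT_comp.
- by move=> w' _; rewrite lee_fin.
- exact/measurable_EFinP.
apply: ge0_le_integral => //.
- by apply: measurable_funeM; apply/measurable_EFinP/measurableT_comp.
- by apply: measurable_funeM; exact/measurable_EFinP.
- by move=> w' _; rewrite -!EFinM lee_fin -normrM; exact: force_dominated.
Qed.

Let macc j : measurable_fun setT (fun p : measurableTypeR R * T => acceleration j p.1 p.2).
Proof.
apply: measurable_funN.
apply: (@measurable_Rintegral _ _ _ P _ _ (fun p w' => pair_force j p.1 (p.2, w'))).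
have m : measurable_fun setT
    (fun q : (measurableTypeR R * T) * T => (q.1.1, (q.1.2, q.2)) : RTT).
  apply/measurable_fun_pairP; split; first exact: (measurableT_comp measurable_fst measurable_fst).
  apply/measurable_fun_pairP; split; last exact: measurable_snd.
  exact: (measurableT_comp measurable_snd measurable_fst).
exact: (measurableT_comp (mforce j) m).
Qed.

Lemma pair_force_antisym j t z : pair_force j t (swap_pair z) = - pair_force j t z.
Proof.
rewrite /pair_force /= -[x t z.2 - x t z.1]opprB grad_odd// mxE psi_even.
by rewrite -[v t z.2 0 j - _]opprB mulrN opprD.
Qed.

(** The work of the forces against h, symmetrized. *)
Lemma work_of_forces j (t c : R) (h : T -> R) : good_time t -> 0 <= c ->
  measurable_fun setT h ->
  (forall w, `|h w| <= c * (1 + enorm (x t w) + enorm (v t w))) ->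
  [/\ PP.-integrable setT (EFin \o (fun z => (h z.1 - h z.2) * pair_force j t z)),
      P.-integrable setT (EFin \o (fun w => h w * acceleration j t w)) &
      \int[P]_w (h w * acceleration j t w) =
      - (2^-1 * \int[PP]_z ((h z.1 - h z.2) * pair_force j t z))].
Proof.
move=> gt c0 mh hc.
have mF := section2 t (mforce j).
have iF : PP.-integrable setT (EFin \o pair_force j t).
  apply: (dominated_integrable gt mF (C := 1 * (12 * Lambda + 1))) => z.
  rewrite -[X in `|X|]mul1r; apply: force_dominated => //.
  by rewrite normr1 mul1r -addrA lerDl addr_ge0 ?enorm_ge0.
have ihF : PP.-integrable setT (EFin \o (fun z => h z.1 * pair_force j t z)).
  apply: (dominated_integrable gt _ (C := c * (12 * Lambda + 1))) => [|z].
    by apply: measurable_funM => //; exact: (measurableT_comp mh measurable_fst).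
  exact: force_dominated.
have C0 : 0 <= c * (12 * Lambda + 1) by rewrite mulr_ge0// addr_ge0// mulr_ge0.
have mF1 : measurable_fun setT (fubini_F P (fun z => (domination t z)%:E)).
  apply: measurable_fun_fubini_tonelli_F => [|z]; last by rewrite lee_fin.
  by apply/measurable_EFinP; exact: (section2 t mdomination).
have mha : measurable_fun setT (fun w => h w * acceleration j t w).
  by apply: measurable_funM => //; exact: (section1 t (macc j)).
have iha : P.-integrable setT (EFin \o (fun w => h w * acceleration j t w)).
  apply/integrableP; split; first exact/measurable_EFinP.
  apply: (@le_lt_trans _ _ (\int[P]_w ((c * (12 * Lambda + 1))%:E * \int[P]_w' (domination t (w, w'))%:E)))%E.
    apply: ge0_le_integral => //.
    - exact/measurable_EFinP/measurableT_comp.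
    - by apply: measurable_funeM.
    - by move=> w _; exact: acceleration_dominated.
  rewrite ge0_integralZl; [|by []|exact: mF1|..]; last 2 first.
  - by move=> w _; apply: integral_ge0 => w' _; rewrite lee_fin.
  - by rewrite lee_fin.
  rewrite lte_mul_pinfty//.
  rewrite -(fubini_tonelli1 (fun z => (domination t z)%:E)); last 2 first.
  - by apply/measurable_EFinP; exact: (section2 t mdomination).
  - by move=> z; rewrite lee_fin.
  case/integrableP : gt => _.
  by under eq_integral do rewrite /= ger0_norm//.
split => //.
  have := integrableD measurableT ihF (integrable_swap ihF).
  apply: eq_integrable => // z _ /=.
  by rewrite pair_force_antisym -EFinD; congr EFin; ring.
rewrite -(Rintegral_antisym _ mh iF ihF); last exact: pair_force_antisym.
rewrite -mulN1r -RintegralZl//.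
  by apply: eq_Rintegral => w _; rewrite /acceleration mulrN mulN1r.
have := integrableN iha; apply: eq_integrable => // w _ /=.
by rewrite /acceleration mulrN opprK.
Qed.

Lemma newton_coord w j : newton_path w ->
  [/\ {within `[0, +oo[, continuous (fun t => x t w 0 j)},
      forall t : R, 0 < t -> is_derive t (1 : R) (fun t => x t w 0 j) (v t w 0 j),
      {within `[0, +oo[, continuous (fun t => v t w 0 j)} &
      exists a : R -> R,
        [/\ forall t : R, 0 < t -> is_derive t (1 : R) (fun t => v t w 0 j) (a t),
            forall t : R, 0 < t -> {for t, continuous a} &
            {ae mu, forall t : R, 0 < t -> a t = acceleration j t w}]].
Proof.
move=> nw.
split.
- exact: (within_continuous_comp (path_cont nw) (@coord_continuous R 1 n 0 j)).
- by move=> t t0; exact: (is_derive_coord j (path_velocity nw t0)).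
- exact: (within_continuous_comp (path_vcont nw) (@coord_continuous R 1 n 0 j)).
have [a [da ca ea]] := path_acceleration nw.
exists (fun t => a t 0 j); split.
- by move=> t t0; exact: (is_derive_coord j (da t t0)).
- by move=> t t0; exact: (cvg_comp _ _ (ca t t0) (@coord_continuous R 1 n 0 j (a t))).
- by apply: (ae_imp ea) => t /[apply].
Qed.

(** Gathers the analytic justification: for a quantity attached to one particle,
only the derivative along a single path and a domination remain to be checked. *)
Lemma primitive_onebody (f k : R -> T -> R) (C : R) : 0 <= C ->
  measurable_fun setT (fun p : measurableTypeR R * T => k p.1 p.2) ->
  (forall r w, (`|k r w|%:E <= C%:E * \int[P]_w' (domination r (w, w'))%:E)%E) ->
  (forall t : R, 0 <= t -> P.-integrable setT (EFin \o f t)) ->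
  (forall w, newton_path w -> {within `[0, +oo[, continuous (f ^~ w)} /\
    exists k' : R -> R,
     [/\ forall t : R, 0 < t -> is_derive t (1 : R) (f ^~ w) (k' t),
        forall t : R, 0 < t -> {for t, continuous k'} &
        {ae mu, forall t : R, 0 < t -> k' t = k t w}]) ->
  primitive (fun t => \int[P]_w f t w) (fun t => \int[P]_w k t w).
Proof.
move=> C0 mk kC fi H; apply: primitive_expectation => //.
  exact: dominated_time1 kC.
apply: (ae_imp (flow_newton flow)) => w /H[cf [k' [dk ck ek]]] ik.
exact: primitive_of_C1 ek ik.
Qed.

Let mxj j : measurable_fun setT (fun p : measurableTypeR R * T => x p.1 p.2 0 j).
Proof. exact: measurable_coor_comp (flow_mx flow). Qed.

Let mvj j : measurable_fun setT (fun p : measurableTypeR R * T => v p.1 p.2 0 j).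
Proof. exact: measurable_coor_comp (flow_mv flow). Qed.

Lemma moment_dominated (C t : R) (f : T -> R) : 0 <= t -> measurable_fun setT f ->
  (forall w, `|f w| <= C * (1 + moment t w)) -> P.-integrable setT (EFin \o f).
Proof.
move=> t0 mf fC.
have i0 := finite_measure_integrable_cst P (1 : R) measurableT.
have i := integrableZl measurableT C (integrableD measurableT i0 (moment_integrable t0)).
apply: (le_integrable _ _ _ i) => //; first exact/measurable_EFinP.
by move=> w _; rewrite /= lee_fin (le_trans (fC w))// ler_norm.
Qed.

Lemma moment_dominated2 (C t : R) (K : T * T -> R) : 0 <= t -> measurable_fun setT K ->
  (forall z, `|K z| <= C * (1 + moment t z.1 + moment t z.2)) ->
  PP.-integrable setT (EFin \o K).
Proof.
move=> t0 mK KC.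
have im := moment_integrable t0.
have i0 := integrable_fst (finite_measure_integrable_cst P (1 : R) measurableT).
have i := integrableZl measurableT C (integrableD measurableT
   (integrableD measurableT i0 (integrable_fst im)) (integrable_snd im)).
apply: (le_integrable _ _ _ i) => //; first exact/measurable_EFinP.
by move=> z _; rewrite /= lee_fin (le_trans (KC z))// ler_norm.
Qed.

Let coordx t w j : `|x t w 0 j| <= enorm (x t w). Proof. exact: coord_le_enorm. Qed.
Let coordv t w j : `|v t w 0 j| <= enorm (v t w). Proof. exact: coord_le_enorm. Qed.

Lemma prod_moment (c e f g a b : R) : 0 <= c -> 0 <= e -> 0 <= a -> 0 <= b ->
  `|f| <= c * (1 + a + b) -> `|g| <= e * (1 + a + b) ->
  `|f * g| <= (3 * c * e) * (1 + (a ^+ 2 + b ^+ 2)).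
Proof.
move=> c0 e0 a0 b0 fc ge; rewrite normrM.
apply: (le_trans (ler_pM (normr_ge0 _) (normr_ge0 _) fc ge)).
have h : (1 + a + b) * (1 + a + b) <= 3 * (1 + (a ^+ 2 + b ^+ 2)).
  by have := sqr_ge0 (a - b); have := sqr_ge0 (a - 1); have := sqr_ge0 (b - 1); nra.
have := ler_wpM2l (mulr_ge0 c0 e0) h; rewrite (_ : c * e * ((1 + a + b) * (1 + a + b)) =
  c * (1 + a + b) * (e * (1 + a + b))); last by ring.
by move/le_trans; apply; rewrite le_eqVlt; apply/orP; left; apply/eqP; ring.
Qed.

Let bound_one t w : `|1 : R| <= 1 * (1 + enorm (x t w) + enorm (v t w)).
Proof. by rewrite normr1 mul1r -addrA lerDl addr_ge0 ?enorm_ge0. Qed.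

Let bound_x t w j : `|x t w 0 j| <= 1 * (1 + enorm (x t w) + enorm (v t w)).
Proof. have := coordx t w j; have := enorm_ge0 (v t w); lra. Qed.

Let bound_v t w j (u : R) :
  `|v t w 0 j - u| <= (1 + `|u|) * (1 + enorm (x t w) + enorm (v t w)).
Proof.
apply: (le_trans (ler_normB _ _)).
have := coordv t w j; have := enorm_ge0 (v t w); have := enorm_ge0 (x t w).
have : 0 <= `|u| by []. nra.
Qed.

Let u1_ge0 (u : R) : 0 <= 1 + `|u|. Proof. by rewrite addr_ge0. Qed.

Lemma L2_integrable (c e t : R) (f g : T -> R) : 0 <= t -> 0 <= c -> 0 <= e ->
  measurable_fun setT f -> measurable_fun setT g ->
  (forall w, `|f w| <= c * (1 + enorm (x t w) + enorm (v t w))) ->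
  (forall w, `|g w| <= e * (1 + enorm (x t w) + enorm (v t w))) ->
  P.-integrable setT (EFin \o (fun w => f w * g w)).
Proof.
move=> t0 c0 e0 mf mg fc ge; apply: (moment_dominated (C := 3 * c * e) t0).
  exact: measurable_funM.
by move=> w; apply: prod_moment => //; exact: enorm_ge0.
Qed.

Lemma L1_integrable (c t : R) (f : T -> R) : 0 <= t -> 0 <= c ->
  measurable_fun setT f ->
  (forall w, `|f w| <= c * (1 + enorm (x t w) + enorm (v t w))) ->
  P.-integrable setT (EFin \o f).
Proof.
move=> t0 c0 mf fc.
have := L2_integrable t0 c0 ler01 mf (measurable_cst (1 : R)) fc (bound_one t).
by apply: eq_integrable => // w _ /=; rewrite mulr1.
Qed.

(** * Balance laws for momentum, energy and virial *)

Definition momentum (j : 'I_n) : R := \int[P]_w (v 0 w 0 j).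

Let mxt t j := section1 t (mxj j).
Let mvt t j := section1 t (mvj j).
Let mvu t j u : measurable_fun setT (fun w => v t w 0 j - u).
Proof. by apply: measurable_funB => //; exact: mvt. Qed.

(** The work against a constant vanishes. *)
Lemma momentum_conserved j t : 0 <= t -> \int[P]_w (v t w 0 j) = momentum j.
Proof.
move=> t0.
have p : primitive (fun t => \int[P]_w (v t w 0 j)) (fun t => \int[P]_w (acceleration j t w)).
  apply: (@primitive_onebody _ _ (1 * (12 * Lambda + 1))).
  - by rewrite mul1r addr_ge0// mulr_ge0.
  - exact: macc.
  - move=> r w; rewrite -[X in `|X|%:E]mul1r; apply: acceleration_dominated => //.
  - move=> r r0; have := L1_integrable r0 (u1_ge0 0) (mvu r j 0) (fun w => bound_v r w j 0).
    by apply: eq_integrable => // w _ /=; rewrite subr0.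
  - by move=> w /(newton_coord j)[_ _ cv ev]; split.
have z0 : {ae mu, forall r : R, 0 <= r -> \int[P]_w (acceleration j r w) = 0}.
  apply: (ae_imp good_times) => r gr r0.
  have [_ _] := work_of_forces j (gr r0) ler01 (measurable_cst (1 : R)) (bound_one r).
  under eq_Rintegral do rewrite mul1r.
  move=> ->; rewrite (_ : (fun z => _) = cst 0) ?Rintegral_cst ?mul0r ?mulr0 ?oppr0//.
  by apply/funext => z; rewrite subrr mul0r.
apply/eqP; rewrite -subr_eq0 eq_le; apply/andP; split.
  rewrite -[leRHS](mul0r (t - 0)); apply: (primitive_le p) => //.
  by apply: (ae_imp z0) => r rz /=; rewrite in_itv/= => /andP[r0 _]; rewrite rz.
have := primitive_le (c := 0) (primitiveZ (-1) p) (lexx 0) t0.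
rewrite mul0r -mulrBr mulN1r oppr_le0; apply.
by apply: (ae_imp z0) => r rz /=; rewrite in_itv/= => /andP[r0 _]; rewrite rz// mulr0.
Qed.

Lemma moment_bound (g C r : R) w : 0 <= C -> `|g| <= C * (1 + moment r w) ->
  (`|g|%:E <= C%:E * \int[P]_w' (domination r (w, w'))%:E)%E.
Proof.
move=> C0 gC.
apply: (@le_trans _ _ (\int[P]_w' (C * (1 + moment r w))%:E)%E).
  by rewrite integral_cst//= probability_setT mule1 lee_fin.
have mD : measurable_fun setT (fun w' => domination r (w, w')).
  exact: (measurableT_comp (section2 r mdomination) (pair1_measurable w)).
rewrite -ge0_integralZl//; first last.
- by move=> w' _; rewrite lee_fin.
- exact/measurable_EFinP.
apply: ge0_le_integral => //.
- by move=> w' _; rewrite lee_fin mulr_ge0// addr_ge0.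
- by apply: measurable_funeM; exact/measurable_EFinP.
- move=> w' _; rewrite -EFinM lee_fin ler_wpM2l// /domination.
  have := exchange_ge0 r (w, w'); have := moment_ge0 r w'; rewrite /=; lra.
Qed.

(** Twice the j-th part of the kinetic energy, in the frame of the mean
velocity. *)
Definition kinetic (j : 'I_n) (t : R) : R :=
  \int[P]_w ((v t w 0 j - momentum j) * (v t w 0 j - momentum j)).

(** The velocity is centered, so that the virial is a covariance and only depends
on differences of positions. *)
Definition virial (j : 'I_n) (t : R) : R :=
  \int[P]_w (x t w 0 j * (v t w 0 j - momentum j)).

Let within_mul (f g : R -> R) (A : set R) : {within A, continuous f} ->
  {within A, continuous g} -> {within A, continuous (fun t => f t * g t)}.
Proof. by move=> cf cg t; exact: (cvgM (cf t) (cg t)). Qed.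

Let within_sub (f : R -> R) (A : set R) (c : R) : {within A, continuous f} ->
  {within A, continuous (fun t => f t - c)}.
Proof. by move=> cf t; exact: (cvgB (cf t) (cvg_cst _)). Qed.

Let within_subV (f g : R -> 'rV[R]_n) (A : set R) : {within A, continuous f} ->
  {within A, continuous g} -> {within A, continuous (fun t => f t - g t)}.
Proof. by move=> cf cg t; exact: (cvgB (cf t) (cg t)). Qed.

Let L_ge0 (c : R) : 0 <= c -> 0 <= c * (12 * Lambda + 1).
Proof. by move=> c0; rewrite mulr_ge0// addr_ge0// mulr_ge0. Qed.

Let is_derive_subc (f : R -> R) (c t df : R) : is_derive t (1 : R) f df ->
  is_derive t (1 : R) (fun s => f s - c) df.
Proof.
move=> H; have : is_derive t (1 : R) (f \- cst c) (df - 0) by apply: is_deriveB.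
by rewrite subr0.
Qed.

Lemma kinetic_primitive j : primitive (kinetic j)
  (fun t => \int[P]_w (2 * (v t w 0 j - momentum j) * acceleration j t w)).
Proof.
apply: (@primitive_onebody _ _ (2 * (1 + `|momentum j|) * (12 * Lambda + 1))).
- by apply: L_ge0; rewrite mulr_ge0.
- apply: measurable_funM; last exact: (macc j).
  apply: measurable_funM; first exact: measurable_cst.
  by apply: measurable_funB => //; exact: (mvj j).
- move=> r w; apply: acceleration_dominated; first by rewrite mulr_ge0.
  by rewrite normrM ger0_norm// -mulrA ler_pM2l.
- move=> t t0; exact: (L2_integrable t0 (u1_ge0 _) (u1_ge0 _) (mvu t j _) (mvu t j _)
    (fun w => bound_v t w j _) (fun w => bound_v t w j _)).
- move=> w /(newton_coord j)[_ _ cv [a [da ca ea]]]; split.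
    by apply: within_mul; exact: within_sub.
  exists (fun t => 2 * (v t w 0 j - momentum j) * a t); split.
  + move=> t t0; have d1 := is_derive_subc (momentum j) (da t t0).
    apply: is_derive_eq (is_deriveM d1 d1) _.
    by rewrite /GRing.scale /=; ring.
  + move=> t t0; have cvt := is_derive_continuous (da t t0).
    apply: cvgM; last exact: ca.
    apply: cvgM; first exact: cvg_cst.
    by apply: cvgB; [exact: cvt|exact: cvg_cst].
  + by apply: (ae_imp ea) => t /[apply] ->.
Qed.

Lemma virial_primitive j : primitive (virial j)
  (fun t => \int[P]_w (v t w 0 j * (v t w 0 j - momentum j)
                        + x t w 0 j * acceleration j t w)).
Proof.
have B (r : R) w : `|v r w 0 j| <= (1 + `|0 : R|) * (1 + enorm (x r w) + enorm (v r w)).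
  by have := bound_v r w j 0; rewrite subr0.
pose C1 := 3 * (1 + `|0 : R|) * (1 + `|momentum j|).
have C10 : 0 <= C1 by rewrite !mulr_ge0.
apply: (@primitive_onebody _ _ (C1 + 1 * (12 * Lambda + 1))).
- by rewrite addr_ge0// L_ge0.
- apply: measurable_funD.
    apply: measurable_funM; first exact: (mvj j).
    by apply: measurable_funB => //; exact: (mvj j).
  by apply: measurable_funM; [exact: (mxj j)|exact: (macc j)].
- move=> r w.
  have I0 : (0 <= \int[P]_w' (domination r (w, w'))%:E)%E.
    by apply: integral_ge0 => w' _; rewrite lee_fin.
  rewrite EFinD ge0_muleDl ?lee_fin ?L_ge0//.
  apply: (@le_trans _ _ (`|v r w 0 j * (v r w 0 j - momentum j)|%:E +
    `|x r w 0 j * acceleration j r w|%:E)%E).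
    by rewrite -EFinD lee_fin ler_normD.
  apply: leeD; last by apply: acceleration_dominated => //; exact: bound_x.
  apply: moment_bound => //.
  by apply: prod_moment; rewrite ?enorm_ge0//; exact: bound_v.
- move=> t t0; exact: (L2_integrable t0 ler01 (u1_ge0 _) (mxt t j) (mvu t j _)
    (fun w => bound_x t w j) (fun w => bound_v t w j _)).
- move=> w /(newton_coord j)[cx dx cv [a [da ca ea]]]; split.
    by apply: within_mul => //; exact: within_sub.
  exists (fun t => v t w 0 j * (v t w 0 j - momentum j) + x t w 0 j * a t); split.
  + move=> t t0; have d1 := is_derive_subc (momentum j) (da t t0).
    apply: is_derive_eq (is_deriveM (dx t t0) d1) _.
    by rewrite /GRing.scale /=; ring.
  + move=> t t0; have cvt := is_derive_continuous (da t t0).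
    have cxt := is_derive_continuous (dx t t0).
    apply: cvgD; last by apply: cvgM; [exact: cxt|exact: ca].
    apply: cvgM; first exact: cvt.
    by apply: cvgB; [exact: cvt|exact: cvg_cst].
  + by apply: (ae_imp ea) => t /[apply] ->.
Qed.

Lemma kinetic_rate j (t : R) : good_time t ->
  PP.-integrable setT (EFin \o (fun z => (v t z.1 0 j - v t z.2 0 j) * pair_force j t z)) /\
  \int[P]_w (2 * (v t w 0 j - momentum j) * acceleration j t w) =
  - \int[PP]_z ((v t z.1 0 j - v t z.2 0 j) * pair_force j t z).
Proof.
move=> gt.
have [i1 i2 e] := work_of_forces j gt (u1_ge0 _) (mvu t j (momentum j)) (fun w => bound_v t w j _).
have E z : (v t z.1 0 j - momentum j - (v t z.2 0 j - momentum j)) = v t z.1 0 j - v t z.2 0 j.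
  by ring.
split; first by apply: eq_integrable i1 => // z _ /=; rewrite E.
under eq_Rintegral do rewrite -mulrA.
rewrite RintegralZl// e mulrN mulrA divff// mul1r.
by congr (- _); apply: eq_Rintegral => z _; rewrite E.
Qed.

Lemma virial_rate j (t : R) : 0 <= t -> good_time t ->
  PP.-integrable setT (EFin \o (fun z => (x t z.1 0 j - x t z.2 0 j) * pair_force j t z)) /\
  \int[P]_w (v t w 0 j * (v t w 0 j - momentum j) + x t w 0 j * acceleration j t w) =
  kinetic j t - 2^-1 * \int[PP]_z ((x t z.1 0 j - x t z.2 0 j) * pair_force j t z).
Proof.
move=> t0 gt.
have [i1 i2 e] := work_of_forces j gt ler01 (mxt t j) (fun w => bound_x t w j).
split => //.
have iv := L1_integrable t0 (u1_ge0 _) (mvu t j 0) (fun w => bound_v t w j 0).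
have iv1 : P.-integrable setT (EFin \o (fun w => v t w 0 j)).
  by apply: eq_integrable iv => // w _ /=; rewrite subr0.
have ic := finite_measure_integrable_cst P (momentum j) measurableT.
have ivu := integrableB measurableT iv1 ic.
have ik := L2_integrable t0 (u1_ge0 _) (u1_ge0 _) (mvu t j _) (mvu t j _)
    (fun w => bound_v t w j (momentum j)) (fun w => bound_v t w j (momentum j)).
have E w : v t w 0 j * (v t w 0 j - momentum j) =
  (v t w 0 j - momentum j) * (v t w 0 j - momentum j) + momentum j * (v t w 0 j - momentum j).
  by ring.
have iE : P.-integrable setT (EFin \o (fun w => v t w 0 j * (v t w 0 j - momentum j))).
  have := integrableD measurableT ik (integrableZl measurableT (momentum j) ivu).
  by apply: eq_integrable => // w _ /=; rewrite E.
rewrite RintegralD// e; congr (_ - _).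
under eq_Rintegral do rewrite E.
rewrite RintegralD//; last exact: (integrableZl measurableT (momentum j) ivu).
rewrite RintegralZl// RintegralB// Rintegral_cst//= probability_setT mulr1.
by rewrite momentum_conserved// subrr mulr0 addr0.
Qed.

Let pos (t : R) (z : T * T) := x t z.1 - x t z.2.
Let vel (t : R) (z : T * T) := v t z.1 - v t z.2.

Let pos_moment t z : enorm (pos t z) ^+ 2 <= 2 * (enorm (x t z.1) ^+ 2 + enorm (x t z.2) ^+ 2).
Proof. by rewrite mulrDr; exact: sqr_enormB. Qed.

Let vel_moment t z : enorm (vel t z) ^+ 2 <= 2 * (enorm (v t z.1) ^+ 2 + enorm (v t z.2) ^+ 2).
Proof. by rewrite mulrDr; exact: sqr_enormB. Qed.

Definition potential (t : R) : R := \int[PP]_z (W (pos t z) - W 0).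

Let cW : continuous W.
Proof. by move=> z; apply: differentiable_continuous; have [] := W_C1 (I : setT z). Qed.

Let mpow : measurable_fun setT (fun p : RTT => dotrV (grad W (pos p.1 p.2)) (vel p.1 p.2)).
Proof.
apply: measurable_sum => j; apply: measurable_funM; first exact: mgrad.
exact: measurable_coor_comp mdv.
Qed.

Let power_bound t z : `|dotrV (grad W (pos t z)) (vel t z)| <=
  n%:R * (4 * Lambda) * (moment t z.1 + moment t z.2).
Proof.
apply: (le_trans (ler_norm_sum _ _ _)).
apply: (@le_trans _ _ (\sum_(i < n) 4 * Lambda * (moment t z.1 + moment t z.2))); last first.
  by rewrite sumr_const card_ord -[leLHS]mulr_natl mulrA.
apply: ler_sum => i _; rewrite normrM.
have g := grad_linear_growth W_C1 W_sym lambda_gt0 W_convex (pos t z) i.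
have h := coord_le_enorm (vel t z) i.
apply: (le_trans (ler_pM (normr_ge0 _) (normr_ge0 _) g h)).
have := pos_moment t z; have := vel_moment t z; rewrite /moment.
set p := enorm (pos t z); set q := enorm (vel t z) => h1 h2.
have e : p * q <= enorm (x t z.1) ^+ 2 + enorm (v t z.1) ^+ 2
      + (enorm (x t z.2) ^+ 2 + enorm (v t z.2) ^+ 2).
  by have := sqr_ge0 (p - q); nra.
by rewrite -!mulrA; rewrite !ler_wpM2l.
Qed.

Lemma ae_pair (Q : T -> Prop) : {ae P, forall w, Q w} ->
  {ae PP, forall z, Q z.1 /\ Q z.2}.
Proof.
move=> [N [mN N0 QN]].
exists ((N `*` setT) `|` (setT `*` N)); split.
- by apply: measurableU; exact: measurableX.
- have e1 : PP (N `*` setT) = 0%E by rewrite product_measure1E// [X in (X * _)%E]N0 mul0e.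
  have e2 : PP (setT `*` N) = 0%E by rewrite product_measure1E// [X in (_ * X)%E]N0 mule0.
  have e3 : (PP (N `*` setT) + PP (setT `*` N) <= 0)%E by rewrite e1 e2 adde0.
  apply/eqP; rewrite eq_le measure_ge0 andbT.
  by apply: (le_trans (measureU2 _ _ _) e3); exact: measurableX.
- move=> z /= /not_andP[] nQ; [left|right]; split => //; exact: QN.
Qed.

Let continuous_dotrV (g h : R -> 'rV[R]_n) (t : R) :
  (forall j, {for t, continuous (fun s => g s 0 j)}) ->
  (forall j, {for t, continuous (fun s => h s 0 j)}) ->
  {for t, continuous (fun s => dotrV (g s) (h s))}.
Proof.
move=> cg ch; rewrite /dotrV.
apply: (@cvg_big _ _ +%R) => // [|i _]; first exact: add_continuous.
by apply: cvgM; [exact: cg|exact: ch].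
Qed.

Let potential_integrable t : 0 <= t -> intPP (fun z => W (pos t z) - W 0).
Proof.
move=> t0; apply: (moment_dominated2 (C := Lambda * 2) t0).
  by apply: measurable_funB => //; exact: (section2 t mpot).
move=> z; rewrite ger0_norm; last first.
  apply: le_trans (potential_lower W_C1 W_sym lambda_gt0 W_convex _).
  by rewrite mulr_ge0 ?sqr_ge0// divr_ge0// ltW.
apply: (le_trans (potential_upper W_C1 W_sym lambda_gt0 W_convex _)).
rewrite -mulrA ler_wpM2l//; apply: (le_trans (pos_moment t z)).
by rewrite /moment ler_pM2l//; have := sqr_ge0 (enorm (v t z.1));
    have := sqr_ge0 (enorm (v t z.2)); lra.
Qed.

Lemma potential_primitive : primitive potential
  (fun t => \int[PP]_z dotrV (grad W (pos t z)) (vel t z)).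
Proof.
have nL0 : 0 <= n%:R * (4 * Lambda) by rewrite mulr_ge0// mulr_ge0.
apply: (@primitive_expectation _ _ _ PP).
- exact: mpow.
- exact: potential_integrable.
- apply: (dominated_time2 (C := n%:R * (4 * Lambda)) nL0 mpow) => r z.
  apply: (le_trans (power_bound r z)); rewrite ler_wpM2l//.
  by rewrite /domination; have := exchange_ge0 r z; lra.
- apply: (ae_imp (ae_pair (flow_newton flow))) => z [n1 n2] ik.
  have dpos (t : R) : 0 < t -> is_derive t (1 : R) (fun t => pos t z) (vel t z).
    by move=> t0; apply: is_deriveB; exact: path_velocity.
  have dW (t : R) : 0 < t -> is_derive t (1 : R) (fun t => W (pos t z) - W 0)
      (dotrV (grad W (pos t z)) (vel t z)).
    by move=> t0; apply: is_derive_subc; exact: (is_derive_potential W_C1 (dpos t t0)).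
  apply: (primitive_of_C1 _ dW _ _ ik).
  + apply: within_sub; apply: within_continuous_comp cW.
    exact: (within_subV (path_cont n1) (path_cont n2)).
  + move=> t t0; apply: continuous_dotrV => j.
      exact: (cvg_comp _ _ (is_derive_continuous (dpos t t0))
        (@grad_continuous _ _ _ W_C1 j (pos t z))).
    have [a1 [da1 _ _]] := path_acceleration n1.
    have [a2 [da2 _ _]] := path_acceleration n2.
    have dv := is_deriveB (da1 t t0) (da2 t t0).
    exact: (is_derive_continuous (is_derive_coord j dv)).
  + by apply: aeW => t _.
Qed.

(** * Decay of the energy *)

Hypothesis lambda_le : lambda <= Lambda.

Let Lambda_gt0 : 0 < Lambda. Proof. exact: lt_le_trans lambda_le. Qed.

(** The potential is counted over ordered pairs, hence the factor 1/2. *)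
Definition energy (t : R) : R := 2^-1 * \sum_(j < n) kinetic j t + 2^-1 * potential t.

Let iconst (c : R) : intPP (fun _ : T * T => c).
Proof. by have := integrable_fst (finite_measure_integrable_cst P c measurableT). Qed.

Let Rintegral_const (c : R) : \int[PP]_z c = c.
Proof.
have := Rintegral_fst (finite_measure_integrable_cst P c measurableT).
by rewrite /= => ->; rewrite Rintegral_cst//= probability_setT mulr1.
Qed.

Let Rintegral_lin (c : R) (K1 K2 : T * T -> R) : intPP K1 -> intPP K2 ->
  intPP (fun z => c * K1 z + K2 z) /\
  \int[PP]_z (c * K1 z + K2 z) = c * \int[PP]_z K1 z + \int[PP]_z K2 z.
Proof.
move=> i1 i2; have i := integrableZl measurableT c i1.
split; first exact: (integrableD _ i i2).
by rewrite RintegralD// RintegralZl.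
Qed.

Let kinetic_pair j t : 0 <= t ->
  intPP (fun z => vel t z 0 j * vel t z 0 j) /\
  \int[PP]_z (vel t z 0 j * vel t z 0 j) = 2 * kinetic j t.
Proof.
move=> t0; have bv w := bound_v t w j (momentum j).
have i1 := L1_integrable t0 (u1_ge0 _) (mvu t j _) bv.
have i2 := L2_integrable t0 (u1_ge0 _) (u1_ge0 _) (mvu t j _) (mvu t j _) bv bv.
have iv := L1_integrable t0 (u1_ge0 _) (mvu t j 0) (fun w => bound_v t w j 0).
have iv1 : P.-integrable setT (EFin \o (fun w => v t w 0 j)).
  by apply: eq_integrable iv => // w _ /=; rewrite subr0.
have z0 : \int[P]_w (v t w 0 j - momentum j) = 0.
  rewrite RintegralB//; last exact: finite_measure_integrable_cst.
  by rewrite Rintegral_cst//= probability_setT mulr1 momentum_conserved// subrr.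
have E z : vel t z 0 j * vel t z 0 j =
    (v t z.1 0 j - momentum j - (v t z.2 0 j - momentum j)) *
    (v t z.1 0 j - momentum j - (v t z.2 0 j - momentum j)).
  by rewrite !mxE; ring.
split.
  by have := integrable_diffM i1 i1 i2; apply: eq_integrable => // z _ /=; rewrite E.
under eq_Rintegral do rewrite E.
by rewrite (Rintegral_diffM i1 i1 i2) z0 !mulr0 subr0.
Qed.

Let virial_pair j t : 0 <= t ->
  intPP (fun z => pos t z 0 j * vel t z 0 j) /\
  \int[PP]_z (pos t z 0 j * vel t z 0 j) = 2 * virial j t.
Proof.
move=> t0; have bv w := bound_v t w j (momentum j); have bx w := bound_x t w j.
have i1 := L1_integrable t0 (u1_ge0 _) (mvu t j _) bv.
have i3 := L1_integrable t0 ler01 (mxt t j) bx.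
have i2 := L2_integrable t0 ler01 (u1_ge0 _) (mxt t j) (mvu t j _) bx bv.
have iv := L1_integrable t0 (u1_ge0 _) (mvu t j 0) (fun w => bound_v t w j 0).
have iv1 : P.-integrable setT (EFin \o (fun w => v t w 0 j)).
  by apply: eq_integrable iv => // w _ /=; rewrite subr0.
have z0 : \int[P]_w (v t w 0 j - momentum j) = 0.
  rewrite RintegralB//; last exact: finite_measure_integrable_cst.
  by rewrite Rintegral_cst//= probability_setT mulr1 momentum_conserved// subrr.
have E z : pos t z 0 j * vel t z 0 j =
    (x t z.1 0 j - x t z.2 0 j) *
    (v t z.1 0 j - momentum j - (v t z.2 0 j - momentum j)).
  by rewrite !mxE; ring.
split.
  by have := integrable_diffM i3 i1 i2; apply: eq_integrable => // z _ /=; rewrite E.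
under eq_Rintegral do rewrite E.
by rewrite (Rintegral_diffM i3 i1 i2) z0 !mulr0 subr0.
Qed.

Let position_pair j t : 0 <= t ->
  intPP (fun z => pos t z 0 j * pos t z 0 j) /\
  \int[PP]_z (pos t z 0 j * pos t z 0 j) =
  2 * \int[P]_w ((x t w 0 j - \int[P]_w' (x t w' 0 j)) ^+ 2).
Proof.
move=> t0; have bx w := bound_x t w j.
set c := \int[P]_w' (x t w' 0 j).
have i3 := L1_integrable t0 ler01 (mxt t j) bx.
have ic := finite_measure_integrable_cst P c measurableT.
have i1 := integrableB measurableT i3 ic.
have i2 : P.-integrable setT (EFin \o (fun w => (x t w 0 j - c) * (x t w 0 j - c))).
  have i4 := L2_integrable t0 ler01 ler01 (mxt t j) (mxt t j) bx bx.
  have i5 := integrableZl measurableT (- (2 * c)) i3.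
  have i6 := finite_measure_integrable_cst P (c * c) measurableT.
  have := integrableD measurableT (integrableD measurableT i4 i5) i6.
  by apply: eq_integrable => // w _ /=; rewrite -!EFinD; congr EFin; ring.
have z0 : \int[P]_w (x t w 0 j - c) = 0.
  by rewrite RintegralB// Rintegral_cst//= probability_setT mulr1 subrr.
have E z : pos t z 0 j * pos t z 0 j =
    (x t z.1 0 j - c - (x t z.2 0 j - c)) * (x t z.1 0 j - c - (x t z.2 0 j - c)).
  by rewrite !mxE; ring.
split.
  by have := integrable_diffM i1 i1 i2; apply: eq_integrable => // z _ /=; rewrite E.
under eq_Rintegral do rewrite E.
by rewrite (Rintegral_diffM i1 i1 i2) z0 !mulr0 subr0.
Qed.

Let vel2_pair t : 0 <= t -> intPP (fun z => enorm (vel t z) ^+ 2) /\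
  \int[PP]_z (enorm (vel t z) ^+ 2) = 2 * \sum_(j < n) kinetic j t.
Proof.
move=> t0; have [i e] := Rintegral_sum (fun j => (kinetic_pair j t0).1).
split; first by apply: eq_integrable i => // z _ /=; rewrite enorm2.
under eq_Rintegral do rewrite enorm2 /dotrV.
by rewrite e mulr_sumr; apply: eq_bigr => j _; have [] := kinetic_pair j t0.
Qed.

Let posvel_pair t : 0 <= t -> intPP (fun z => dotrV (pos t z) (vel t z)) /\
  \int[PP]_z dotrV (pos t z) (vel t z) = 2 * \sum_(j < n) virial j t.
Proof.
move=> t0; have [i e] := Rintegral_sum (fun j => (virial_pair j t0).1).
split=> //.
by rewrite [LHS]e mulr_sumr; apply: eq_bigr => j _; have [] := virial_pair j t0.
Qed.

Let pos2_pair t : 0 <= t -> intPP (fun z => enorm (pos t z) ^+ 2) /\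
  \int[PP]_z (enorm (pos t z) ^+ 2) =
  2 * \sum_(j < n) \int[P]_w ((x t w 0 j - \int[P]_w' (x t w' 0 j)) ^+ 2).
Proof.
move=> t0; have [i e] := Rintegral_sum (fun j => (position_pair j t0).1).
split; first by apply: eq_integrable i => // z _ /=; rewrite enorm2.
under eq_Rintegral do rewrite enorm2 /dotrV.
by rewrite e mulr_sumr; apply: eq_bigr => j _; have [] := position_pair j t0.
Qed.

Let V2 t := \int[PP]_z (enorm (vel t z) ^+ 2).
Let X2 t := \int[PP]_z (enorm (pos t z) ^+ 2).

(** Written over pairs, the kinetic part loses another factor 2. *)
Lemma energyE t : 0 <= t -> energy t = 4^-1 * V2 t + 2^-1 * potential t.
Proof.
move=> t0; rewrite /energy /V2; have [_ ->] := vel2_pair t0.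
by congr (_ + _); field.
Qed.

Lemma position_le_energy t : 0 <= t -> lambda / 8 * X2 t <= energy t - 4^-1 * V2 t.
Proof.
move=> t0; rewrite energyE// addrAC subrr add0r.
have [ix _] := pos2_pair t0; have iW := potential_integrable t0.
have i := integrableZl measurableT (lambda / 4) ix.
rewrite (_ : lambda / 8 * X2 t = 2^-1 * (lambda / 4 * X2 t)); last by field.
rewrite ler_pM2l// -RintegralZl//; apply: le_Rintegral => // z _.
exact: (potential_lower W_C1 W_sym lambda_gt0 W_convex).
Qed.

Let V2_ge0 t : 0 <= V2 t. Proof. by apply: Rintegral_ge0 => z _; rewrite sqr_ge0. Qed.
Let X2_ge0 t : 0 <= X2 t. Proof. by apply: Rintegral_ge0 => z _; rewrite sqr_ge0. Qed.

Lemma energy_ge0 t : 0 <= t -> 0 <= energy t.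
Proof.
move=> t0; have := position_le_energy t0; have := V2_ge0 t.
have : 0 <= lambda / 8 * X2 t by rewrite mulr_ge0 ?X2_ge0// divr_ge0// ltW.
lra.
Qed.

Let virials t := \sum_(j < n) virial j t.

Let dotrV_young t z : `|dotrV (pos t z) (vel t z)| <=
  2^-1 * (enorm (pos t z) ^+ 2 + enorm (vel t z) ^+ 2).
Proof.
rewrite !enorm2 /dotrV; apply: (le_trans (ler_norm_sum _ _ _)).
rewrite -big_split/= mulr_sumr; apply: ler_sum => j _.
set p := pos t z 0 j; set q := vel t z 0 j.
by rewrite ler_norml; have := sqr_ge0 (p - q); have := sqr_ge0 (p + q); nra.
Qed.

(** Young's inequality; the convexity of W makes E control the positions. *)
Lemma virial_le_energy t : 0 <= t -> `|virials t| <= (1 + 2 / lambda) * energy t.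
Proof.
move=> t0.
have [iv ev] := posvel_pair t0; have [ix _] := pos2_pair t0; have [iV _] := vel2_pair t0.
have h : `|virials t| <= 4^-1 * X2 t + 4^-1 * V2 t.
  have -> : virials t = 2^-1 * \int[PP]_z dotrV (pos t z) (vel t z).
    by rewrite ev mulrA mulVf// mul1r.
  rewrite normrM ger0_norm// -mulrDr (_ : 4^-1 = 2^-1 * 2^-1 :> R); last by field.
  rewrite -mulrA ler_pM2l//; apply: (le_trans (le_normr_Rintegral _ iv)) => //.
  have isum := integrableD measurableT ix iV.
  rewrite -RintegralD// -RintegralZl//.
  apply: le_Rintegral => //; first exact: (integrable_norm iv).
  exact: (integrableZl _ _ isum).
have := position_le_energy t0; have := X2_ge0 t; have := V2_ge0 t => hV hX he.
apply: (le_trans h).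
have e1 : 4^-1 * X2 t = 2 / lambda * (lambda / 8 * X2 t).
  by field; rewrite gt_eqF.
rewrite mulrDl mul1r addrC lerD//.
  have : 0 <= lambda / 8 * X2 t by rewrite mulr_ge0// divr_ge0// ltW.
  lra.
rewrite e1 ler_wpM2l ?divr_ge0 ?(ltW lambda_gt0)//; lra.
Qed.

Let energy_rate t :=
  2^-1 * \sum_(j < n) \int[P]_w (2 * (v t w 0 j - momentum j) * acceleration j t w)
  + 2^-1 * \int[PP]_z dotrV (grad W (pos t z)) (vel t z).

Let virials_rate t := \sum_(j < n)
  \int[P]_w (v t w 0 j * (v t w 0 j - momentum j) + x t w 0 j * acceleration j t w).

Lemma energy_primitive : primitive energy energy_rate.
Proof.
apply: primitiveD; apply: primitiveZ; last exact: potential_primitive.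
by apply: primitive_sum => j; exact: kinetic_primitive.
Qed.

Lemma virials_primitive : primitive virials virials_rate.
Proof. by apply: primitive_sum => j; exact: virial_primitive. Qed.

Let friction t z := psi (pos t z) * enorm (vel t z) ^+ 2.

Let vel_force t z : \sum_(j < n) (v t z.1 0 j - v t z.2 0 j) * pair_force j t z =
  dotrV (grad W (pos t z)) (vel t z) + friction t z.
Proof.
rewrite /friction enorm2 /dotrV mulr_sumr -big_split; apply: eq_bigr => j _ /=.
rewrite /pair_force -/(pos t z) (_ : v t z.1 0 j - v t z.2 0 j = vel t z 0 j); last by rewrite !mxE.
ring.
Qed.

Let pos_force t z : \sum_(j < n) (x t z.1 0 j - x t z.2 0 j) * pair_force j t z =
  dotrV (grad W (pos t z)) (pos t z) + psi (pos t z) * dotrV (pos t z) (vel t z).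
Proof.
rewrite /dotrV mulr_sumr -big_split; apply: eq_bigr => j _ /=.
rewrite /pair_force -/(pos t z) (_ : x t z.1 0 j - x t z.2 0 j = pos t z 0 j); last by rewrite !mxE.
by rewrite !mxE; ring.
Qed.

Let power_integrable t : 0 <= t -> intPP (fun z => dotrV (grad W (pos t z)) (vel t z)).
Proof.
move=> t0; apply: (moment_dominated2 (C := n%:R * (4 * Lambda)) t0).
  exact: (section2 t mpow).
move=> z; apply: (le_trans (power_bound t z)).
by rewrite ler_wpM2l ?mulr_ge0//; have := moment_ge0 t z.1; lra.
Qed.

(** The gradient part of the work of the forces cancels the derivative of the
potential energy. *)
Lemma friction_rate t : 0 <= t -> good_time t ->
  intPP (friction t) /\ energy_rate t = - (2^-1 * \int[PP]_z friction t z).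
Proof.
move=> t0 gt.
have [i e] := Rintegral_sum (fun j => (kinetic_rate j gt).1).
have ip := power_integrable t0.
have ifr : intPP (friction t).
  have := integrableB measurableT i ip; apply: eq_integrable => // z _ /=.
  by rewrite vel_force -EFinB addrAC subrr add0r.
split => //; rewrite /energy_rate.
under eq_bigr do rewrite (kinetic_rate _ gt).2.
rewrite sumrN -e; under eq_Rintegral do rewrite vel_force.
by rewrite RintegralD//; ring.
Qed.

Let ae_good (Q : R -> Prop) : (forall r, 0 <= r -> good_time r -> Q r) ->
  forall s t : R, 0 <= s -> {ae mu, forall r : R, `[s, t]%classic r -> Q r}.
Proof.
move=> H s t s0; apply: (ae_imp good_times) => r gr; rewrite /= in_itv/= => /andP[sr _].
by apply: H; [|apply: gr]; exact: le_trans sr.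
Qed.

Lemma energy_noninc s t : 0 <= s -> s <= t -> energy t <= energy s.
Proof.
move=> s0 st; rewrite -subr_le0 -(mul0r (t - s)).
apply: (primitive_le energy_primitive s0 st); apply: ae_good s0 => r r0 gr.
have [_ ->] := friction_rate r0 gr.
by rewrite oppr_le0 mulr_ge0//; apply: Rintegral_ge0 => z _; rewrite mulr_ge0// sqr_ge0.
Qed.

Let c0 := lambda / (2 * Lambda).

(** An inequality between integrands over pairs: the friction, weighted by
a/(2 lambda), pays for the alignment term, and weighted by 2/psi_m for the
kinetic terms; the convexity of W pays for the potential energy. *)
Lemma virials_rate_le (a b t : R) : 0 < a -> 0 <= b ->
  (forall z, psi z * enorm z ^+ 2 <= a * enorm z ^+ 2 + b) ->
  0 <= t -> good_time t ->
  virials_rate t + (a / (2 * lambda) + 2 / psi_m) * energy_rate t + c0 * energy t <=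
  lambda * b / (4 * a).
Proof.
move=> a0 b0 hab t0 gt.
set kappa := a / (2 * lambda) + 2 / psi_m.
have [ifr ->] := friction_rate t0 gt.
have [iA eA] := Rintegral_sum (fun j => (virial_rate j t0 gt).1).
have [iV eV] := vel2_pair t0; have iW := potential_integrable t0.
pose A z := \sum_(j < n) (x t z.1 0 j - x t z.2 0 j) * pair_force j t z.
have -> : virials_rate t = 2^-1 * V2 t - 2^-1 * \int[PP]_z A z.
  rewrite /virials_rate; under eq_bigr do rewrite (virial_rate _ t0 gt).2.
  by rewrite sumrB -mulr_sumr -eA /V2 eV mulrA mulVf// mul1r.
rewrite energyE//.
have [i1 e1] := Rintegral_lin (2^-1 * c0) iW (iconst 0).
have [i2 e2] := Rintegral_lin (2^-1 + 4^-1 * c0) iV i1.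
have [i3 e3] := Rintegral_lin (- (2^-1 * kappa)) ifr i2.
have [i4 e4] := Rintegral_lin (- 2^-1) iA i3.
have c00 : 0 < c0 by rewrite divr_gt0// mulr_gt0.
have -> : 2^-1 * V2 t - 2^-1 * (\int[PP]_z A z) + kappa * - (2^-1 * \int[PP]_z friction t z)
   + c0 * (4^-1 * V2 t + 2^-1 * potential t) =
   \int[PP]_z (- 2^-1 * A z + (- (2^-1 * kappa) * friction t z +
     ((2^-1 + 4^-1 * c0) * enorm (vel t z) ^+ 2 +
        (2^-1 * c0 * (W (pos t z) - W 0) + 0)))).
  by rewrite e4 e3 e2 e1 Rintegral_const /V2 /potential; ring.
have -> : lambda * b / (4 * a) = \int[PP]_z (lambda * b / (4 * a)).
  by rewrite Rintegral_const.
apply: (le_Rintegral measurableT i4 (iconst _)).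
move=> z _; rewrite /A pos_force /friction addr0.
have hW := potential_upper W_C1 W_sym lambda_gt0 W_convex (pos t z).
have hG := grad_coercive W_C1 W_sym W_convex (pos t z).
have hY := dotrV_young.
set r2 := enorm (pos t z) ^+ 2 in hW hG *; set q2 := enorm (vel t z) ^+ 2.
set p := psi (pos t z); set g := dotrV (grad W _) _ in hG *.
have hab' : p * r2 <= a * r2 + b := hab (pos t z).
have p0 : 0 <= p by exact: psi_ge0.
have pm : psi_m <= p by exact: psi_lower.
have q20 : 0 <= q2 by rewrite sqr_ge0.
have r20 : 0 <= r2 by rewrite sqr_ge0.
(* Young's inequality with the weight that makes the friction absorb the
   alignment part of the virial *)
have hD : - dotrV (pos t z) (vel t z) <= a / (2 * lambda) * q2 + lambda / (2 * a) * r2.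
  rewrite /q2 /r2 !enorm2 /dotrV !mulr_sumr -sumrN -big_split/=; apply: ler_sum => j _.
  set e := pos t z 0 j; set f := vel t z 0 j.
  rewrite -subr_ge0 (_ : _ - _ = (a * f + lambda * e) ^+ 2 / (2 * lambda * a)).
    by rewrite divr_ge0 ?sqr_ge0// !mulr_ge0// ltW.
  by field; rewrite !gt_eqF.
have hD2 := ler_wpM2l p0 hD.
have hab2 := ler_wpM2l (ltW (divr_gt0 lambda_gt0 (mulr_gt0 (ltr0Sn R 1) a0))) hab'.
have e1' : lambda / (2 * a) * (a * r2 + b) = lambda / 2 * r2 + lambda * b / (2 * a).
  by field; rewrite gt_eqF.
have hq : 2 * q2 <= 2 / psi_m * (p * q2).
  rewrite (_ : 2 / psi_m * (p * q2) = 2 * (p / psi_m) * q2); last by field; rewrite gt_eqF.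
  by rewrite ler_wpM2r// ler_peMr// ler_pdivlMr// mul1r.
have hcW : 2^-1 * c0 * (W (pos t z) - W 0) <= lambda / 4 * r2.
  apply: (@le_trans _ _ (2^-1 * c0 * (Lambda * r2))).
    by rewrite ler_pM2l// mulr_gt0.
  by rewrite le_eqVlt /c0; apply/orP; left; apply/eqP; field; rewrite gt_eqF.
have c01 : c0 <= 2^-1.
  by rewrite /c0 ler_pdivrMr ?mulr_gt0// mulrA mulVf// mul1r.
have hcq : c0 * q2 <= 2^-1 * q2 by rewrite ler_wpM2r.
have e2' : lambda * b / (4 * a) = 2^-1 * (lambda * b / (2 * a)).
  by field; rewrite gt_eqF.
rewrite e2' /kappa.
set ka := a / (2 * lambda) in hD hD2 *; set la := lambda / (2 * a) in hD hD2 hab2 e1' *.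
set kp := 2 / psi_m in hq *; set bb := lambda * b / (2 * a) in e1' *.
set dt := dotrV (pos t z) (vel t z) in hD hD2 *.
have e3' : p * (ka * q2 + la * r2) = ka * (p * q2) + la * (p * r2) by ring.
have e4' : p * - dt = - (p * dt) by ring.
rewrite e3' e4' in hD2.
nra.
Qed.

(** The virial completed by a multiple of the energy decreases at a rate
proportional to the energy, up to a constant; at both ends of the interval it
is bounded by the energy. *)
Lemma energy_estimate (a b s t : R) : 0 < a -> 0 <= b ->
  (forall z, psi z * enorm z ^+ 2 <= a * enorm z ^+ 2 + b) -> 0 <= s -> s <= t ->
  (t - s) * c0 * energy t <=
  (2 * (1 + 2 / lambda) + (a / (2 * lambda) + 2 / psi_m)) * energy s
  + (t - s) * (lambda * b / (4 * a)).
Proof.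
move=> a0 b0 hab s0 st; have t0 := le_trans s0 st.
set kappa := a / (2 * lambda) + 2 / psi_m.
have p := primitiveD virials_primitive (primitiveZ kappa energy_primitive).
have H : {ae mu, forall r : R, `[s, t]%classic r ->
   virials_rate r + kappa * energy_rate r <= lambda * b / (4 * a) - c0 * energy t}.
  apply: (ae_imp good_times) => r gr; rewrite /= in_itv/= => /andP[sr rt].
  have r0 := le_trans s0 sr.
  have := virials_rate_le a0 b0 hab r0 (gr r0); rewrite -/kappa.
  have : c0 * energy t <= c0 * energy r.
    rewrite ler_wpM2l ?energy_noninc// divr_ge0// ?(ltW lambda_gt0)//.
    by rewrite mulr_ge0// ltW.
  lra.
have := primitive_le p s0 st H.
have := virial_le_energy s0; have := virial_le_energy t0.
rewrite !ler_norml => /andP[h1 h2] /andP[h3 h4].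
have e0 := energy_ge0 t0; have est := energy_noninc s0 st.
have k0 : 0 <= kappa.
  by rewrite addr_ge0// divr_ge0 ?mulr_ge0// ltW.
have l0 : 0 <= 1 + 2 / lambda by rewrite addr_ge0// divr_ge0// ltW.
have k1 : 0 <= kappa * energy t by rewrite mulr_ge0.
have l1 := ler_wpM2l l0 est.
nra.
Qed.

(** The error is measured one particle at a time, by a variance, which is half of
the corresponding pair integral. *)
Lemma velocity_spread (t : R) : 0 <= t ->
  (\int[P]_w (enorm (v t w - \row_j momentum j) ^+ 2)%:E <= (2 * energy t)%:E)%E.
Proof.
move=> t0; have ik j := L2_integrable t0 (u1_ge0 _) (u1_ge0 _) (mvu t j _) (mvu t j _)
    (fun w => bound_v t w j (momentum j)) (fun w => bound_v t w j (momentum j)).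
have [i e] := Rintegral_sum ik.
have E w : enorm (v t w - \row_j momentum j) ^+ 2 =
    \sum_(j < n) (v t w 0 j - momentum j) * (v t w 0 j - momentum j).
  by rewrite enorm2 /dotrV; apply: eq_bigr => j _; rewrite !mxE.
under eq_integral do rewrite E.
rewrite -[leLHS]fineK; last exact: (integrable_fin_num _ i).
rewrite lee_fin; move: e; rewrite {1}/Rintegral => ->.
rewrite /energy mulrDr !mulrA divff// !mul1r lerDl.
rewrite Rintegral_ge0// => z _.
apply: le_trans (potential_lower W_C1 W_sym lambda_gt0 W_convex _).
by rewrite mulr_ge0 ?sqr_ge0// divr_ge0// ltW.
Qed.

Lemma position_spread (t : R) : 0 <= t ->
  (\int[P]_w (enorm (x t w - \row_j \int[P]_w' (x t w' 0 j)) ^+ 2)%:E <=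
   (4 / lambda * energy t)%:E)%E.
Proof.
move=> t0.
pose c j := \int[P]_w' (x t w' 0 j).
have bc j w : `|x t w 0 j - c j| <= (1 + `|c j|) * (1 + enorm (x t w) + enorm (v t w)).
  apply: (le_trans (ler_normB _ _)).
  have := coordx t w j; have := enorm_ge0 (v t w); have := enorm_ge0 (x t w).
  have : 0 <= `|c j| by []. nra.
have mc j : measurable_fun setT (fun w => x t w 0 j - c j).
  by apply: measurable_funB => //; exact: mxt.
have ik j := L2_integrable t0 (u1_ge0 _) (u1_ge0 _) (mc j) (mc j) (bc j) (bc j).
have [i e] := Rintegral_sum ik.
have E w : enorm (x t w - \row_j c j) ^+ 2 = \sum_(j < n) (x t w 0 j - c j) * (x t w 0 j - c j).
  by rewrite enorm2 /dotrV; apply: eq_bigr => j _; rewrite !mxE.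
under eq_integral do rewrite E.
rewrite -[leLHS]fineK; last exact: (integrable_fin_num _ i).
rewrite lee_fin; move: e; rewrite {1}/Rintegral => ->.
have [_ eX] := pos2_pair t0.
have := position_le_energy t0; rewrite /X2 eX => h.
have h2 : \sum_(j < n) \int[P]_w ((x t w 0 j - c j) * (x t w 0 j - c j)) =
   \sum_(j < n) \int[P]_w ((x t w 0 j - \int[P]_w' x t w' 0 j) ^+ 2) by [].
rewrite h2; set S := \sum_(j < n) _ in h h2 *.
rewrite -(ler_pM2l (divr_gt0 lambda_gt0 (ltr0Sn R 3))).
have -> : lambda / 4 * (4 / lambda * energy t) = energy t by field; rewrite gt_eqF.
have := V2_ge0 t; lra.
Qed.

End particles.

(** * Probability densities *)

Section density_probability.
Context {R : realType} d (T : measurableType d) (m : {measure set T -> \bar R}).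
Variable r : T -> R.
Hypothesis mr : measurable_fun setT r.
Hypothesis r0 : forall y, 0 <= r y.
Hypothesis r1 : (\int[m]_y (r y)%:E = 1)%E.

(** The hypotheses on the density are arguments, so that the structure of
probability measure can be attached to the definition. *)
Definition density_prob of measurable_fun setT r & (forall y, 0 <= r y)
    & (\int[m]_y (r y)%:E = 1)%E : set T -> \bar R :=
  fun A => (\int[m]_(y in A) (r y)%:E)%E.

Local Notation mu := (density_prob mr r0 r1).

Let mu0 : mu set0 = 0%E. Proof. by rewrite /density_prob integral_set0. Qed.

Let mu_ge0 A : (0 <= mu A)%E.
Proof. by apply: integral_ge0 => y _; rewrite lee_fin. Qed.

Let mu_sigma_additive : semi_sigma_additive mu.
Proof.
apply: semi_sigma_additive_nng_induced; first exact/measurable_EFinP.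
by move=> y; rewrite lee_fin.
Qed.

HB.instance Definition _ := isMeasure.Build _ _ _ mu mu0 mu_ge0 mu_sigma_additive.

HB.instance Definition _ := Measure_isProbability.Build _ _ _ mu r1.

Import HBNNSimple.

Let integral_density_nnsfun (f : {nnsfun T >-> R}) :
  (\int[mu]_y (f y)%:E = \int[m]_y (f y * r y)%:E)%E.
Proof.
under [LHS]eq_integral do rewrite fimfunE -fsumEFin//.
rewrite [LHS]ge0_integral_fsum//; last 2 first.
- by move=> k; exact/measurable_EFinP/measurable_funM.
- by move=> k y _; rewrite nnfun_muleindic_ge0.
under [RHS]eq_integral.
  move=> y _.
  rewrite fimfunE EFinM -fsumEFin// ge0_mule_fsuml; last first.
    by move=> k; rewrite nnfun_muleindic_ge0.
  over.
rewrite [RHS]ge0_integral_fsum//; last 2 first.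
- move=> k; apply: emeasurable_funM; last exact/measurable_EFinP.
  exact/measurable_EFinP/measurable_funM.
- by move=> k y _; rewrite mule_ge0// ?nnfun_muleindic_ge0// lee_fin.
apply: eq_fsbigr => k _.
have mk : measurable (f @^-1` [set k]) by [].
rewrite integralZl_indic_nnsfun// integral_indic// setIT.
have [k0|k0] := ltP k 0.
  rewrite preimage_nnfun0// measure0 mule0 integral0_eq// => y _.
  by rewrite indic0 mulr0 mul0e.
under [RHS]eq_integral do rewrite EFinM -muleA.
rewrite [RHS]ge0_integralZl//; last 2 first.
- by apply: emeasurable_funM; apply/measurable_EFinP.
- by move=> y _; rewrite mule_ge0// lee_fin.
congr (_ * _)%E; rewrite [LHS]/= /density_prob integral_mkcond epatch_indic.
by apply: eq_integral => y _ /=; rewrite muleC.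
Qed.

(** By monotone approximation with simple functions. *)
Lemma ge0_integral_density (f : T -> \bar R) :
  measurable_fun setT f -> (forall y, 0 <= f y)%E ->
  (\int[mu]_y f y = \int[m]_y (f y * (r y)%:E))%E.
Proof.
move=> mf f0.
pose f_ := nnsfun_approx measurableT mf.
have mrE : measurable_fun setT (fun y => (r y)%:E) by exact/measurable_EFinP.
have mfn n : measurable_fun setT (fun y => (f_ n y)%:E).
  exact/measurable_EFinP/measurable_funTS.
have cf y : (EFin \o f_ ^~ y) n @[n --> \oo] --> f y by exact: cvg_nnsfun_approx.
transitivity (limn (fun n => \int[mu]_y (f_ n y)%:E)%E).
  rewrite -monotone_convergence//=.
  - by apply: eq_integral => y _; apply/esym/cvg_lim => //; exact: cf.
  - by move=> n y _; rewrite lee_fin.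
  - by move=> y _ ? ? ?; rewrite lee_fin; exact/lefP/nd_nnsfun_approx.
transitivity (limn (fun n => \int[m]_y ((f_ n y)%:E * (r y)%:E))%E).
  by congr (limn _); apply/funext => n; rewrite integral_density_nnsfun.
rewrite -monotone_convergence//=.
- apply: eq_integral => y _; apply/cvg_lim => //.
  by apply: cvgeZr => //; exact: cf.
- by move=> n; exact: emeasurable_funM.
- by move=> n y _; rewrite mule_ge0// lee_fin.
- move=> y _ ? ? ?; rewrite lee_wpmul2r ?lee_fin//; exact/lefP/nd_nnsfun_approx.
Qed.

End density_probability.

(** * Transport of densities *)

Section transport.
Context {R : realType} d d' (T : measurableType d) (U : measurableType d').
Variables (m : {measure set T -> \bar R}) (P : probability U R).
Variables (r : T -> R) (X : U -> T).
Hypothesis mr : measurable_fun setT r.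
Hypothesis r0 : forall y, 0 <= r y.
Hypothesis r1 : (\int[m]_y (r y)%:E = 1)%E.
Hypothesis mX : measurable_fun setT X.
Hypothesis rX : forall A, measurable A ->
  (\int[m]_(y in A) (r y)%:E)%E = P (X @^-1` A).

Lemma ge0_integral_transport (f : T -> \bar R) :
  measurable_fun setT f -> (forall y, 0 <= f y)%E ->
  (\int[m]_y (f y * (r y)%:E) = \int[P]_w f (X w))%E.
Proof.
move=> mf f0; rewrite -(ge0_integral_density mr r0 r1)//.
transitivity (\int[pushforward P X]_y f y)%E.
  by apply: eq_measure_integral => A mA _; exact: rX.
by rewrite ge0_integral_pushforward// preimage_setT.
Qed.

Lemma Rintegral_transport (g : T -> R) : measurable_fun setT g ->
  \int[m]_y (g y * r y) = \int[P]_w g (X w).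
Proof.
move=> mg; rewrite /Rintegral; congr fine.
rewrite [LHS]integralE [RHS]integralE.
congr (_ - _)%E.
- transitivity (\int[P]_w ((EFin \o g)^\+ (X w)))%E; last first.
    by apply: eq_integral => w _; rewrite !funeposE.
  rewrite -ge0_integral_transport //; last first.
    exact/measurable_funepos/measurable_EFinP.
  apply: eq_integral => y _; rewrite !funeposE /=.
  by rewrite -!EFin_max -EFinM maxr_pMl// mul0r.
- transitivity (\int[P]_w ((EFin \o g)^\- (X w)))%E; last first.
    by apply: eq_integral => w _; rewrite !funenegE.
  rewrite -ge0_integral_transport //; last first.
    exact/measurable_funeneg/measurable_EFinP.
  apply: eq_integral => y _; rewrite !funenegE /=.
  by rewrite -!EFin_max -EFinM maxr_pMl// mul0r mulNr.
Qed.

End transport.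

Section wasserstein.
Context {R : realType} {n : nat} {d'} {U : measurableType d'} (P : probability U R).
Variables (r : 'rV[R]_n -> R) (X : U -> 'rV[R]_n) (c : 'rV[R]_n).
Hypothesis mX : measurable_fun setT X.
Hypothesis rX : forall A, measurable A -> density_measure r A = P (X @^-1` A).

(** The law of (X, c) is a coupling; it is the only one, but its existence is
enough for an upper bound. *)
Lemma wasserstein2_dirac_le :
  (wasserstein2 (density_measure r) \d_c <=
   (\int[P]_w (enorm (X w - c) ^+ 2)%:E) `^ 2^-1)%E.
Proof.
have mXc : measurable_fun setT (fun w => (X w, c)).
  by apply/measurable_fun_pairP; split => //; exact: measurable_cst.
pose pi : {measure set ('rV[R]_n * 'rV[R]_n)%type -> \bar R} :=
  measure_function_pushforward__canonical__measure_function_Measure P mXc.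
apply: ereal_inf_lbound; exists pi.
  move=> A mA; split.
    rewrite rX// /pi /= /pushforward; congr (P _).
    by apply/seteqP; split => w //= [].
  rewrite /pi /= /pushforward diracE.
  case: (boolP (c \in A)) => cA.
    rewrite (_ : _ @^-1` _ = setT) ?probability_setT//.
    by apply/seteqP; split => w //= _; split=> //; exact: set_mem.
  rewrite (_ : _ @^-1` _ = set0) ?measure0//.
  by apply/seteqP; split => w //= [_ /mem_set]; rewrite (negbTE cA).
congr (_ `^ _)%E; rewrite [LHS]ge0_integral_pushforward//.
- apply/measurable_EFinP/measurable_funX/measurable_enorm_comp/measurable_rVB.
    exact: measurable_fst.
  exact: measurable_snd.
- by move=> z _; rewrite lee_fin sqr_ge0.
Qed.

End wasserstein.

(** * The momentum equation along characteristics *)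

Section material_derivative.
Context {R : realType} {n : nat}.
Notation V := 'rV[R]_n.

Lemma is_derive_chain (A B C : normedModType R) (F : B -> C) (g : A -> B) (a v : A)
    (dg : A -> B) :
  is_diff a g dg -> differentiable F (g a) ->
  is_derive a v (F \o g) ('d F (g a) (dg v)).
Proof.
move=> [gd gE] dF; have dFg := differentiable_comp gd dF.
apply: DeriveDef; first exact: diff_derivable.
by rewrite deriveE// diff_comp//= gE.
Qed.

Lemma is_diff_time (t : R) (y : V) :
  is_diff t (fun s : R => (s, y)) (fun h : R => (h, 0 : V)).
Proof. exact: (is_diff_pair (is_diff_id t) (is_diff_cst y t)). Qed.

Lemma is_diff_space (t : R) (y : V) :
  is_diff y (fun z : V => (t, z)) (fun h : V => (0 : R, h)).
Proof. exact: (is_diff_pair (is_diff_cst t y) (is_diff_id y)). Qed.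

Variables (rho : R -> V -> R) (u : R -> V -> V) (t : R) (y : V).
Hypothesis dr : differentiable (fun p : R * V => rho p.1 p.2) (t, y).
Hypothesis du : differentiable (fun p : R * V => u p.1 p.2) (t, y).

Let Dr (h : R * V) : R := 'd (fun p : R * V => rho p.1 p.2) (t, y) h.
Let Du (h : R * V) : V := 'd (fun p : R * V => u p.1 p.2) (t, y) h.

Let rho_t : is_derive t (1 : R) (fun s => rho s y) (Dr (1, 0)).
Proof. exact: (is_derive_chain (1 : R) (is_diff_time t y) dr). Qed.

Let rho_x h : is_derive y h (rho t) (Dr (0, h)).
Proof. exact: (is_derive_chain h (is_diff_space t y) dr). Qed.

Let duj j : differentiable (fun p : R * V => u p.1 p.2 0 j) (t, y).
Proof. exact: (differentiable_comp du (differentiable_coord (u t y) 0 j)). Qed.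

Let Duj j h : 'd (fun p : R * V => u p.1 p.2 0 j) (t, y) h = (Du h) 0 j.
Proof.
rewrite (_ : (fun p : R * V => u p.1 p.2 0 j) =
  (fun z : V => z 0 j) \o (fun p => u p.1 p.2)) // diff_comp//=; last first.
  exact: differentiable_coord.
have lin : linear (fun z : V => z 0 j : R^o) by move=> a b c; rewrite !mxE.
pose L := GRing.isLinear.Build _ _ _ _ _ lin.
pose f : {linear V -> R^o} := HB.pack (fun z : V => z 0 j : R^o) L.
have cf : continuous f by exact: coord_continuous.
have := diff_lin (u t y) cf; rewrite /= => H.
exact: (congr1 (fun g => g (Du h)) H).
Qed.

Let u_t j : is_derive t (1 : R) (fun s => u s y 0 j) ((Du (1, 0)) 0 j).
Proof. by rewrite -Duj; exact: (is_derive_chain (1 : R) (is_diff_time t y) (duj j)). Qed.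

Let u_x j h : is_derive y h (fun z => u t z 0 j) ((Du (0, h)) 0 j).
Proof. by rewrite -Duj; exact: (is_derive_chain h (is_diff_space t y) (duj j)). Qed.

Let direction : Du (1, u t y) = Du (1, 0) + \sum_(i < n) u t y 0 i *: Du (0, delta_mx 0 i).
Proof.
rewrite (_ : (1, u t y) = (1, 0 : V) + \sum_(i < n) u t y 0 i *: (0 : R, delta_mx 0 i : V)).
  rewrite /Du linearD linear_sum; congr (_ + _).
  by apply: eq_bigr => i _; rewrite linearZ.
apply/pair_equal_spec; split.
  rewrite /= (big_morph (fun p : R * V => p.1) (op1 := +%R) (id1 := 0))//.
  by rewrite big1 ?addr0// => i _ /=; rewrite scaler0.
rewrite /= (big_morph (fun p : R * V => p.2) (op1 := +%R) (id1 := 0))//= add0r.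
exact: row_sum_delta.
Qed.

(** The non-conservative form: subtracting the continuity equation from the
momentum equation leaves the density times the material derivative. *)
Lemma material_derivative j :
  'D_1 (fun s : R => rho s y) t
    + \sum_(i < n) 'D_(delta_mx 0 i) (fun z => rho t z * u t z 0 i) y = 0 ->
  'D_1 (fun s : R => rho s y * u s y 0 j) t
    + \sum_(i < n)
        'D_(delta_mx 0 i) (fun z => rho t z * u t z 0 i * u t z 0 j) y
  = rho t y * ('d (fun p : R * V => u p.1 p.2) (t, y) (1, u t y)) 0 j.
Proof.
have e1 : 'D_1 (fun s : R => rho s y * u s y 0 j) t =
    rho t y * (Du (1, 0)) 0 j + u t y 0 j * Dr (1, 0).
  by have [_ ->] := is_deriveM rho_t (u_t j).
have e2 i : 'D_(delta_mx 0 i) (fun z => rho t z * u t z 0 i) y =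
    rho t y * (Du (0, delta_mx 0 i)) 0 i + u t y 0 i * Dr (0, delta_mx 0 i).
  by have [_ ->] := is_deriveM (rho_x (delta_mx 0 i)) (u_x i (delta_mx 0 i)).
have e3 i : 'D_(delta_mx 0 i) (fun z => rho t z * u t z 0 i * u t z 0 j) y =
    rho t y * u t y 0 i * (Du (0, delta_mx 0 i)) 0 j +
    u t y 0 j * (rho t y * (Du (0, delta_mx 0 i)) 0 i + u t y 0 i * Dr (0, delta_mx 0 i)).
  by have [_ ->] := is_deriveM (is_deriveM (rho_x (delta_mx 0 i))
    (u_x i (delta_mx 0 i))) (u_x j (delta_mx 0 i)).
have e4 : 'D_1 (fun s : R => rho s y) t = Dr (1, 0) by have [_ ->] := rho_t.
rewrite e4; under eq_bigr do rewrite e2.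
move=> mass; rewrite e1; under [X in _ + X = _]eq_bigr do rewrite e3.
rewrite big_split/= -mulr_sumr.
rewrite -/(Du (1, u t y)) direction mxE summxE mulrDr [in RHS]mulr_sumr.
under [X in _ = _ + X]eq_bigr do rewrite mxE mulrA.
rewrite addrACA [u t y 0 j * _ + _](_ : _ = 0) ?addr0//.
by rewrite -mulrDr mass mulr0.
Qed.

End material_derivative.

Section trajectories.
Context {R : realType} {n : nat}.
Notation V := 'rV[R]_n.

Lemma continuous_within_comp (D B C : topologicalType) (A : set B) (F : B -> C) (h : D -> B) :
  {within A, continuous F} -> continuous h -> (forall t, A (h t)) ->
  continuous (fun t => F (h t)).
Proof.
move=> /subspace_continuousP cF ch hA t S /(cF _ (hA t)) nS.
have H : \forall s \near t, A (h s) -> S (F (h s)) by exact: (ch t _ nS).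
by apply: filterS H => s; apply; exact: hA.
Qed.

Lemma is_derive_trajectory (u : R -> V -> V) (X : R -> V) (t : R) (v : V) :
  is_derive t (1 : R) X v -> differentiable (fun p : R * V => u p.1 p.2) (t, X t) ->
  is_derive t (1 : R) (fun s => u s (X s))
    ('d (fun p : R * V => u p.1 p.2) (t, X t) (1, v)).
Proof.
move=> [dX vE] du.
have dXt : differentiable X t by exact/derivable1_diffP.
have dg : is_diff t (fun s : R => (s, X s)) (fun h : R => (h, 'd X t h)).
  have dX' : is_diff t X ('d X t) by exact: DiffDef.
  exact: (is_diff_pair (is_diff_id t) dX').
have := is_derive_chain (1 : R) dg du.
by rewrite -vE deriveE.
Qed.

Lemma diff_direction (F : R * V -> V) (p : R * V) (v : V) : differentiable F p ->
  'd F p (1, v) = 'D_(1, 0) F p + \sum_(i < n) v 0 i *: 'D_(0, delta_mx 0 i) F p.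
Proof.
move=> dF.
rewrite (_ : (1, v) = (1, 0 : V) + \sum_(i < n) v 0 i *: (0 : R, delta_mx 0 i : V)).
  rewrite linearD linear_sum deriveE//; congr (_ + _).
  by apply: eq_bigr => i _; rewrite linearZ deriveE.
apply/pair_equal_spec; split.
  rewrite /= (big_morph (fun p : R * V => p.1) (op1 := +%R) (id1 := 0))//.
  by rewrite big1 ?addr0// => i _ /=; rewrite scaler0.
rewrite /= (big_morph (fun p : R * V => p.2) (op1 := +%R) (id1 := 0))//= add0r.
exact: row_sum_delta.
Qed.

(** The hypothesis gives the continuity of directional derivatives in fixed
directions, so the moving direction (1, Y) is expanded in a fixed basis. *)
Lemma continuous_trajectory_derivative (u : R -> V -> V) (X Y : R -> V) (t : R) :
  0 < t -> C1_on [set p : R * V | 0 < p.1] (fun p => u p.1 p.2) ->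
  {for t, continuous X} -> {for t, continuous Y} ->
  {for t, continuous (fun s => 'd (fun p : R * V => u p.1 p.2) (s, X s) (1, Y s))}.
Proof.
move=> t0 u1 cX cY; set U := fun p : R * V => u p.1 p.2.
pose G s := 'D_(1, 0) U (s, X s) + \sum_(i < n) Y s 0 i *: 'D_(0, delta_mx 0 i) U (s, X s).
have GE s : 0 < s -> 'd U (s, X s) (1, Y s) = G s.
  by move=> s0; rewrite diff_direction//; have [] := u1 (s, X s) s0.
have cp : {for t, continuous (fun s => (s, X s))}.
  exact: (cvg_pair cvg_id cX).
have cD v : {for t, continuous (fun s => 'D_v U (s, X s))}.
  have [_ /(_ v) c] := u1 (t, X t) t0.
  exact: (cvg_comp _ _ cp c).
have cG : {for t, continuous G}.
  apply: cvgD; first exact: cD.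
  apply: (@cvg_big _ _ +%R) => // [|i _]; first exact: add_continuous.
  apply: cvgZ; last exact: cD.
  exact: (cvg_comp _ _ cY (@coord_continuous R 1 n 0 i (Y t))).
have cG' : G @ t --> 'd U (t, X t) (1, Y t) by rewrite GE.
apply: cvg_trans cG'; apply: near_eq_cvg.
near=> s; rewrite /= -GE//; near: s; exact: lt_nbhsr.
Unshelve. all: by end_near. Qed.

End trajectories.

(** * Measurability of a monotone radial weight *)

Section radial_weight.
Context {R : realType} {n : nat} (psi : 'rV[R]_n -> R) (phi : R -> R) (c : R).
Hypothesis psi_radial : forall z, psi z = phi (enorm z).
Hypothesis phi_noninc : forall r s, 0 < r -> r <= s -> phi s <= phi r.

(** At the origin the weight multiplies the relative velocity of particles at the
same position, which is zero; the value c put there makes the lower bound on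
the weight hold everywhere. *)
Definition regular_weight (z : 'rV[R]_n) : R := if z == 0 then c else psi z.

(** Monotone functions are measurable; the possible singularity at 0 is
approached through the half-lines [1/k, +oo[. *)
Lemma measurable_regular_weight : measurable_fun setT regular_weight.
Proof.
have mphi : measurable_fun (`]0, +oo[%classic : set R) phi.
  have -> : `]0, +oo[%classic = \bigcup_k `[k.+1%:R^-1, +oo[%classic :> set R.
    apply/seteqP; split=> [r /=|r [k _ /=]]; rewrite !in_itv/= !andbT; last first.
      exact: lt_le_trans.
    move=> r0; near \oo => k; exists k => //=; rewrite in_itv/= andbT ltW//.
    by near: k; exact: near_infty_natSinv_lt (PosNum r0).
  apply/measurable_fun_bigcup => // k.
  apply: (@eq_measurable_fun _ _ _ _ _ (fun r : R => phi (Num.max k.+1%:R^-1 r))).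
    move=> r /[!inE]/=; rewrite in_itv/= andbT => kr.
    by congr (phi _); apply/max_idPr.
  apply: nonincreasing_measurable => // r s rs; apply: phi_noninc.
    by rewrite lt_max invr_gt0 ltr0Sn.
  by rewrite ge_max le_max lexx/= le_max rs orbT.
have mpr := (measurable_restrictT phi (measurable_itv `]0, +oo[)).1 mphi.
rewrite (_ : regular_weight = fun z => if enorm z == 0 then c
    else (phi \_ `]0, +oo[) (enorm z)).
  apply: measurable_fun_ifT => //.
    by apply: measurable_fun_eqr => //; exact: measurable_enorm.
  by apply: (measurableT_comp mpr); exact: measurable_enorm.
apply/funext => z; rewrite /regular_weight enorm_eq0; case: eqP => // /eqP z0.
rewrite psi_radial patchE mem_set//= in_itv/= andbT.
by rewrite lt_neqAle enorm_ge0 andbT eq_sym enorm_eq0.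
Unshelve. all: by end_near. Qed.

End radial_weight.

(** * Classical solutions as particle flows *)

Section lagrangian.
Context {R : realType} {n : nat}.
Variables (W psi : 'rV[R]_n -> R) (phi : R -> R).
Variables (rho0 : 'rV[R]_n -> R) (u0 : 'rV[R]_n -> 'rV[R]_n).
Variables (rho : R -> 'rV[R]_n -> R) (u : R -> 'rV[R]_n -> 'rV[R]_n).
Variable psi_m : R.
Hypothesis psi_radial : forall x, psi x = phi (enorm x).
Hypothesis phi_noninc : forall r s, 0 < r -> r <= s -> phi s <= phi r.
Hypothesis W_C1 : C1_on setT W.
Hypothesis psi_m_gt0 : 0 < psi_m.
Hypothesis psi_lower : forall x, x != 0 -> psi_m <= psi x.
Hypothesis sol : classical_solution W psi rho0 u0 rho u.
Notation V := 'rV[R]_n.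
Notation mu := (@lebesgue_measure R).
Notation leb := (@lebesgue_rV R n).
Notation weight := (regular_weight psi psi_m).

Let rho00 : rho 0 = rho0. Proof. by apply/funext => y; exact: sol_rho_init sol y. Qed.
Let u00 : u 0 = u0. Proof. by apply/funext => y; exact: sol_u_init sol y. Qed.

Let crho (t : R) : 0 <= t -> continuous (rho t).
Proof.
move=> t0.
apply: (@continuous_within_comp _ _ _ [set p : R * V | 0 <= p.1]
  (fun p => rho p.1 p.2) (fun y => (t, y)) (sol_rho_cont sol)) => //.
by move=> y; apply: differentiable_continuous; have [] := is_diff_space t y.
Qed.

Let cu (t : R) : 0 <= t -> continuous (u t).
Proof.
move=> t0.
apply: (@continuous_within_comp _ _ _ [set p : R * V | 0 <= p.1]
  (fun p => u p.1 p.2) (fun y => (t, y)) (sol_u_cont sol)) => //.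
by move=> y; apply: differentiable_continuous; have [] := is_diff_space t y.
Qed.

Lemma measurable_density (t : R) : 0 <= t -> measurable_fun setT (rho t).
Proof. by move=> t0; apply: continuous_measurable_rV; exact: crho. Qed.

Lemma measurable_velocity (t : R) : 0 <= t -> measurable_fun setT (u t).
Proof.
move=> t0; apply/measurable_fun_rVP => i; apply: continuous_measurable_rV => y.
exact: (cvg_comp _ _ (@cu t t0 y) (@coord_continuous R 1 n 0 i (u t y))).
Qed.

Let mrho0 : measurable_fun setT rho0.
Proof. by rewrite -rho00; exact: measurable_density. Qed.

Let rho0_ge0 y : 0 <= rho0 y.
Proof. by rewrite -rho00; exact: (sol_rho_ge0 sol). Qed.

Let rho0_mass : (\int[leb]_y (rho0 y)%:E = 1)%E.
Proof. by rewrite -rho00; exact: (sol_mass sol (lexx 0)). Qed.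

Definition initial_law : probability V R := density_prob mrho0 rho0_ge0 rho0_mass.
Notation P := initial_law.
Notation S := (density_support rho0).

Let mS : measurable S.
Proof.
rewrite -[X in measurable X]setCK; apply: measurableC; apply: open_measurable_rV.
exact: (closed_openC (@closed_closure _ _)).
Qed.

Let PS : P (~` S) = 0%E.
Proof.
rewrite /initial_law /= /density_prob integral0_eq// => y /= Sy.
have [->//|r0] := eqVneq (rho0 y) 0.
by exfalso; apply: Sy; exact: subset_closure.
Qed.

Let in_S : {ae P, forall w, S w}.
Proof. by exists (~` S); split => //; exact: measurableC. Qed.

Variable eta : R -> V -> V.
Hypothesis ch : characteristics rho0 rho u eta.

(** Times are truncated at 0, and particles outside the support are put at the
origin, so that the flow is measurable and continuous everywhere. *)
Let clock (t : R) : R := Num.max t 0.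

Definition flow_position (t : R) (w : V) : V := if w \in S then eta (clock t) w else 0.
Definition flow_velocity (t : R) (w : V) : V := u (clock t) (flow_position t w).

Let clock_ge0 t : 0 <= clock t. Proof. by rewrite /clock le_max lexx orbT. Qed.
Let clock_id t : 0 <= t -> clock t = t. Proof. by move=> t0; apply/max_idPl. Qed.

Let clock_cont : continuous clock.
Proof.
move=> t; apply: continuous_max; [exact: cvg_id|exact: cvg_cst].
Qed.

Let measurable_position t : measurable_fun setT (flow_position t).
Proof.
apply/measurable_fun_rVP => i.
have m : measurable_fun S (fun w => eta (clock t) w 0 i).
  apply: (measurableT_comp (measurable_coor i)).
  exact: (char_measurable ch (clock_ge0 t)).
rewrite (_ : (fun w => _) = (fun w => eta (clock t) w 0 i) \_ S).
  exact: (measurable_restrictT _ mS).1.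
by apply/funext => w; rewrite patchE /flow_position; case: ifPn => // _; rewrite mxE.
Qed.

Let position_cont w : continuous (flow_position ^~ w).
Proof.
case: (boolP (w \in S)) => Sw; last first.
  rewrite (_ : _ ^~ _ = cst 0); first by move=> t; exact: cvg_cst.
  by apply/funext => t; rewrite /flow_position (negbTE Sw).
rewrite (_ : _ ^~ _ = fun t => eta (clock t) w); last first.
  by apply/funext => t; rewrite /flow_position Sw.
move/set_mem in Sw.
apply: (continuous_within_comp (char_cont ch Sw) clock_cont).
by move=> t; rewrite /= in_itv/= clock_ge0.
Qed.

Let velocity_cont w : continuous (flow_velocity ^~ w).
Proof.
apply: (@continuous_within_comp _ _ _ [set p : R * V | 0 <= p.1]
  (fun p => u p.1 p.2) (fun t => (clock t, flow_position t w)) (sol_u_cont sol)).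
- by move=> t; exact: (cvg_pair (@clock_cont t) (@position_cont w t)).
- by move=> t /=.
Qed.

Let density_cont w : continuous (fun t => rho (clock t) (flow_position t w)).
Proof.
apply: (@continuous_within_comp _ _ _ [set p : R * V | 0 <= p.1]
  (fun p => rho p.1 p.2) (fun t => (clock t, flow_position t w)) (sol_rho_cont sol)).
- by move=> t; exact: (cvg_pair (@clock_cont t) (@position_cont w t)).
- by move=> t /=.
Qed.

Let measurable_rV_joint (f : R -> V -> V) : (forall t, measurable_fun setT (f t)) ->
  (forall w, continuous (f ^~ w)) ->
  measurable_fun setT (fun p : measurableTypeR R * V => f p.1 p.2).
Proof.
move=> mf cf; apply/measurable_fun_rVP => i.
apply: (@measurable_caratheodory _ _ _ (fun t w => f t w 0 i)).
  by move=> t; exact: measurable_coor_comp.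
by move=> w t; exact: (cvg_comp _ _ (cf w t) (@coord_continuous R 1 n 0 i (f t w))).
Qed.

Let mX : measurable_fun setT (fun p : measurableTypeR R * V => flow_position p.1 p.2).
Proof. exact: measurable_rV_joint. Qed.

Let measurable_vel t : measurable_fun setT (flow_velocity t).
Proof. exact: (measurableT_comp (measurable_velocity (clock_ge0 t)) (measurable_position t)). Qed.

Let mV : measurable_fun setT (fun p : measurableTypeR R * V => flow_velocity p.1 p.2).
Proof. exact: measurable_rV_joint. Qed.

Lemma flow_transport (t : R) : 0 <= t -> forall A, measurable A ->
  density_measure (rho t) A = P (flow_position t @^-1` A).
Proof.
move=> t0 A mA; rewrite (char_pushforward ch t0 mA).
have mXA : measurable (flow_position t @^-1` A).
  by rewrite -[X in measurable X]setTI; exact: measurable_position.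
have mXAS := measurableI _ _ mXA mS.
have -> : P (flow_position t @^-1` A) = P (flow_position t @^-1` A `&` S).
  rewrite (measureDI P mXA mS) [X in (X + _)%E](_ : _ = 0%E) ?add0e//.
  apply: (subset_measure0 (measurableD mXA mS) (measurableC mS) _ PS).
  by move=> w [].
rewrite setIC; congr (P _).
have E w : S w -> flow_position t w = eta t w.
  by move=> Sw; rewrite /flow_position mem_set// clock_id.
by apply/seteqP; split=> w [Sw] /= H; split=> //; [rewrite /= E|rewrite /= -E].
Qed.

Let flow_integral (t : R) (f : V -> \bar R) : 0 <= t -> measurable_fun setT f ->
  (forall y, 0 <= f y)%E ->
  (\int[leb]_y (f y * (rho t y)%:E) = \int[P]_w f (flow_position t w))%E.
Proof.
move=> t0 mf f0; apply: ge0_integral_transport => //.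
- exact: measurable_density.
- by move=> y; exact: (sol_rho_ge0 sol).
- exact: (sol_mass sol).
- exact: flow_transport.
Qed.

Let flow_Rintegral (t : R) (g : V -> R) : 0 <= t -> measurable_fun setT g ->
  \int[leb]_y (g y * rho t y) = \int[P]_w g (flow_position t w).
Proof.
move=> t0 mg; apply: Rintegral_transport => //.
- exact: measurable_density.
- by move=> y; exact: (sol_rho_ge0 sol).
- exact: (sol_mass sol).
- exact: flow_transport.
Qed.

Let flow_velocityE (t : R) w : 0 <= t -> flow_velocity t w = u t (flow_position t w).
Proof. by move=> t0; rewrite /flow_velocity clock_id. Qed.

Lemma flow_moments (t : R) : 0 <= t -> moments (rho t) (u t) =
  (\int[P]_w (moment flow_position flow_velocity t w)%:E)%E.
Proof.
move=> t0; rewrite /moments.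
under eq_integral do rewrite EFinM.
rewrite (@flow_integral t (fun y => (enorm y ^+ 2 + enorm (u t y) ^+ 2)%:E))//.
- by apply: eq_integral => w _; rewrite /moment flow_velocityE.
- apply/measurable_EFinP/measurable_funD; apply: measurable_funX.
    exact: measurable_enorm.
  exact: (measurable_enorm_comp (measurable_velocity t0)).
- by move=> y; rewrite lee_fin addr_ge0 ?sqr_ge0.
Qed.

Let weight_meas : measurable_fun setT weight.
Proof. exact: measurable_regular_weight psi_radial phi_noninc. Qed.

Lemma weight_lower z : psi_m <= weight z.
Proof. by rewrite /regular_weight; case: eqP => // /eqP; exact: psi_lower. Qed.

Lemma weight_even z : weight (- z) = weight z.
Proof. by rewrite /regular_weight oppr_eq0 !psi_radial enormN. Qed.

Let weight_ge0 z : 0 <= weight z.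
Proof. by apply: le_trans (weight_lower z); exact: ltW. Qed.

Let weightM (y z : V) (c : R) : (y = z -> c = 0) -> psi (y - z) * c = weight (y - z) * c.
Proof.
move=> yz; rewrite /regular_weight; case: eqP => // /eqP; rewrite subr_eq0 => /eqP/yz ->.
by rewrite !mulr0.
Qed.

Let measurable_shift (y : V) : measurable_fun setT (fun z : V => y - z).
Proof. by apply: measurable_rVB; [exact: measurable_cst|exact: measurable_id]. Qed.

Lemma flow_exchange (t : R) : 0 <= t -> alignment_exchange psi (rho t) (u t) =
  (\int[P]_w \int[P]_w' (exchange weight flow_position flow_velocity t (w, w'))%:E)%E.
Proof.
move=> t0; rewrite /alignment_exchange.
pose F (y z : V) := weight (y - z) * enorm (u t y - u t z) * (1 + enorm y + enorm (u t y)).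
have F0 y z : 0 <= F y z by rewrite !mulr_ge0 ?addr_ge0 ?enorm_ge0.
have mF : measurable_fun setT (fun p : V * V => F p.1 p.2).
  have mu1 : measurable_fun setT (fun p : V * V => u t p.1).
    exact: (measurableT_comp (measurable_velocity t0) measurable_fst).
  have mu2 : measurable_fun setT (fun p : V * V => u t p.2).
    exact: (measurableT_comp (measurable_velocity t0) measurable_snd).
  apply: measurable_funM.
    apply: measurable_funM.
      apply: (measurableT_comp weight_meas).
      by apply: measurable_rVB; [exact: measurable_fst|exact: measurable_snd].
    exact: (measurable_enorm_comp (measurable_rVB mu1 mu2)).
  apply: measurable_funD; last exact: measurable_enorm_comp mu1.
  by apply: measurable_funD => //; apply: measurable_enorm_comp; exact: measurable_fst.
have mFy y : measurable_fun setT (fun z => (F y z)%:E).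
  by apply/measurable_EFinP; exact: (measurableT_comp mF (pair1_measurable y)).
have mG : measurable_fun setT (fun y => \int[P]_w' (F y (flow_position t w'))%:E)%E.
  apply: (@measurable_fun_fubini_tonelli_F _ _ _ _ _ P
     (fun p : V * V => (F p.1 (flow_position t p.2))%:E)) => [|p]; last by rewrite lee_fin.
  apply/measurable_EFinP.
  apply: (measurableT_comp mF (_ : measurable_fun setT (fun p : V * V => (p.1, flow_position t p.2)))).
  apply/measurable_fun_pairP; split; first exact: measurable_fst.
  exact: (measurableT_comp (measurable_position t) measurable_snd).
transitivity (\int[leb]_y ((\int[P]_w' (F y (flow_position t w'))%:E) * (rho t y)%:E))%E.
  apply: eq_integral => y _.
  rewrite -(@flow_integral t (fun z => (F y z)%:E))//; last by move=> z; rewrite lee_fin.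
  rewrite -ge0_integralZr//; last 3 first.
  - apply: emeasurable_funM => //; apply/measurable_EFinP; exact: measurable_density.
  - by move=> z _; rewrite mule_ge0// lee_fin// (sol_rho_ge0 sol).
  - by rewrite lee_fin (sol_rho_ge0 sol).
  apply: eq_integral => z _; rewrite -!EFinM; congr EFin.
  rewrite -!mulrA (@weightM y z).
    by rewrite /F; ring.
  by move=> ->; rewrite subrr enorm0 mul0r.
have G0 y : (0 <= \int[P]_w' (F y (flow_position t w'))%:E)%E.
  by apply: integral_ge0 => w' _; rewrite lee_fin.
apply: (eq_trans (flow_integral t0 mG G0)).
apply: eq_integral => w _; apply: eq_integral => w' _.
by rewrite /exchange /= !flow_velocityE.
Qed.

(** No particle sits where the density vanishes, up to a null set of particles
and times; this is where the momentum equation may be divided by the density. *)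
Lemma density_positive : {ae P, forall w,
  {ae mu, forall t : R, 0 < t -> rho t (flow_position t w) != 0}}.
Proof.
pose f (p : measurableTypeR R * V) : R :=
  if (0 < p.1) && (rho (clock p.1) (flow_position p.1 p.2) == 0) then 1 else 0.
have f0 p : 0 <= f p by rewrite /f; case: ifP.
have mr : measurable_fun setT
    (fun p : measurableTypeR R * V => rho (clock p.1) (flow_position p.1 p.2)).
  apply: (@measurable_caratheodory _ _ _ (fun t w => rho (clock t) (flow_position t w))).
    by move=> t; exact: (measurableT_comp (measurable_density (clock_ge0 t)) (measurable_position t)).
  exact: density_cont.
have mf : measurable_fun setT f.
  apply: measurable_fun_ifT => //.
  apply: measurable_and.
    by apply: measurable_fun_ltr => //; exact: measurable_fst.
  by apply: measurable_fun_eqr.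
have mfE : measurable_fun setT (fun p => (f p)%:E) by exact/measurable_EFinP.
have F0 t : (\int[P]_w (f (t, w))%:E = 0)%E.
  have [t0|t0] := ltP 0 t; last first.
    by apply: integral0_eq => w _; rewrite /f/= ltNge t0.
  pose g y : \bar R := if rho t y == 0 then 1%E else 0%E.
  have g0 y : (0 <= g y)%E by rewrite /g; case: ifP.
  have mg : measurable_fun setT g.
    apply: measurable_fun_ifT => //; apply: measurable_fun_eqr => //.
    exact: measurable_density (ltW t0).
  transitivity (\int[P]_w g (flow_position t w))%E.
    apply: eq_integral => w _; rewrite /f /g/= t0/= clock_id ?(ltW t0)//.
    by case: ifP.
  rewrite -(flow_integral (ltW t0) mg g0); apply: integral0_eq => y _.
  by rewrite /g; case: eqP => [->|_]; rewrite ?mule0 ?mul0e.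
have f0E p : (0 <= (f p)%:E)%E by rewrite lee_fin.
have := @fubini_tonelli _ _ _ _ _ mu P (fun p => (f p)%:E) mfE f0E.
rewrite integral0_eq => [/esym H|t _]; last exact: F0.
have mG : measurable_fun setT (fun w => \int[mu]_t (f (t, w))%:E)%E.
  exact: (@measurable_fun_fubini_tonelli_G _ _ _ _ _ mu (fun p => (f p)%:E)).
have G0 w : (0 <= \int[mu]_t (f (t, w))%:E)%E.
  by apply: integral_ge0 => t _; rewrite lee_fin.
have := (ae_eq_integral_abs P measurableT mG).1.
under eq_integral do rewrite gee0_abs//.
move=> /(_ H) aeG.
apply: (ae_imp aeG) => w /(_ I) /= Gw.
have mfw : measurable_fun setT (fun t : measurableTypeR R => (f (t, w))%:E).
  exact: (measurableT_comp mfE (pair2_measurable w)).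
have := (ae_eq_integral_abs mu measurableT mfw).1.
under eq_integral do rewrite gee0_abs ?lee_fin//.
move=> /(_ Gw) aef; apply: (ae_imp aef) => t /(_ I) /= ft t0.
apply/negP => rt0; move: ft; rewrite /f/= t0 clock_id ?(ltW t0)// rt0/=.
by case=> /eqP; rewrite oner_eq0.
Qed.

(** The material derivative form of the momentum equation, divided by the
density. *)
Lemma flow_acceleration (t : R) w j : 0 < t -> rho t (flow_position t w) != 0 ->
  ('d (fun p : R * V => u p.1 p.2) (t, flow_position t w)
     (1, u t (flow_position t w))) 0 j =
  acceleration P W weight flow_position flow_velocity j t w.
Proof.
move=> t0 r0; set y := flow_position t w in r0 *.
have [dr _] := sol_rho_C1 sol (t0 : [set p : R * V | 0 < p.1] (t, y)).
have [du _] := sol_u_C1 sol (t0 : [set p : R * V | 0 < p.1] (t, y)).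
have := material_derivative dr du j (sol_continuity sol y t0).
rewrite (sol_momentum sol)// => /esym E.
apply: (mulfI r0); rewrite E /acceleration [RHS]mulrN -opprD -mulrDr; congr (- (_ * _)).
have i1 := sol_potential_integrable sol y j t0.
have i2 := sol_alignment_integrable sol y j t0.
rewrite /potential_force /alignment_force -RintegralD//.
pose g z := grad W (y - z) 0 j + weight (y - z) * (u t y 0 j - u t z 0 j).
have mg : measurable_fun setT g.
  apply: measurable_funD.
    have m := continuous_measurable_rV (@grad_continuous _ _ _ W_C1 j).
    exact: (measurableT_comp m (measurable_shift y)).
  apply: measurable_funM; first exact: (measurableT_comp weight_meas (measurable_shift y)).
  by apply: measurable_funB => //; exact: measurable_coor_comp (measurable_velocity (ltW t0)).
transitivity (\int[leb]_z (g z * rho t z)).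
  apply: eq_Rintegral => z _; rewrite /g mulrDl; congr (_ + _); congr (_ * _).
  by apply: weightM => ->; rewrite subrr.
rewrite flow_Rintegral ?(ltW t0)//; apply: eq_Rintegral => w' _.
by rewrite /pair_force /g/= !flow_velocityE ?(ltW t0).
Qed.

Lemma flow_newton_path :
  {ae P, forall w, newton_path P W weight flow_position flow_velocity w}.
Proof.
apply: (ae_imp2 in_S density_positive) => w Sw rw.
have near_clock (t : R) : 0 < t -> \forall s \near t, clock s = s.
  by move=> t0; near=> s; apply: clock_id; apply/ltW; near: s; exact: lt_nbhsr.
have dX (t : R) : 0 < t -> is_derive t (1 : R) (flow_position ^~ w) (flow_velocity t w).
  move=> t0; rewrite flow_velocityE ?(ltW t0)//.
  have -> : flow_position t w = eta t w.
    by rewrite /flow_position mem_set// clock_id// ltW.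
  apply: near_eq_is_derive (char_ode ch Sw t0).
  apply: filterS (near_clock t t0) => s cs.
  by rewrite /flow_position mem_set// cs.
split.
- by apply: continuous_subspaceT; exact: position_cont.
- exact: dX.
- by apply: continuous_subspaceT; exact: velocity_cont.
pose Y t := u t (flow_position t w).
exists (fun t => 'd (fun p : R * V => u p.1 p.2) (t, flow_position t w) (1, Y t)); split.
- move=> t t0.
  have [du _] := sol_u_C1 sol (t0 : [set p : R * V | 0 < p.1] (t, flow_position t w)).
  have dXt := dX t t0; rewrite flow_velocityE ?(ltW t0)// in dXt.
  apply: near_eq_is_derive (is_derive_trajectory dXt du).
  by apply: filterS (near_clock t t0) => s cs; rewrite /flow_velocity cs.
- move=> t t0; apply: continuous_trajectory_derivative => //.
  + exact: sol_u_C1 sol.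
  + exact: position_cont.
  + have [du _] := sol_u_C1 sol (t0 : [set p : R * V | 0 < p.1] (t, flow_position t w)).
    have dXt := dX t t0; rewrite flow_velocityE ?(ltW t0)// in dXt.
    exact: (is_derive_continuous (is_derive_trajectory dXt du)).
- by apply: (ae_imp rw) => t rt t0 j; apply: flow_acceleration => //; exact: rt.
Unshelve. all: by end_near. Qed.

Lemma flow_of_solution : particle_flow P W weight flow_position flow_velocity.
Proof.
split.
- exact: mX.
- exact: mV.
- by move=> t t0; rewrite -flow_moments//; exact: (sol_moments sol).
- move=> t; apply: le_lt_trans (sol_moments_int sol t).
  rewrite le_eqVlt; apply/orP; left; apply/eqP; apply: eq_integral => r.
  by rewrite inE/= in_itv/= => /andP[r0 _]; rewrite flow_moments.
- move=> t; apply: le_lt_trans (sol_exchange_int sol t).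
  rewrite le_eqVlt; apply/orP; left; apply/eqP; apply: eq_integral => r.
  by rewrite inE/= in_itv/= => /andP[r0 _]; rewrite flow_exchange.
- exact: flow_newton_path.
Qed.

Lemma flow_momentum : \row_j momentum P flow_velocity j = mean_velocity rho0 u0.
Proof.
apply/rowP => j; rewrite !mxE /momentum -rho00 -u00.
have m := measurable_velocity (lexx 0).
under [RHS]eq_Rintegral do rewrite mulrC.
rewrite (flow_Rintegral (lexx 0) (measurable_coor_comp j m)).
by apply: eq_Rintegral => w _; rewrite flow_velocityE.
Qed.

Lemma flow_barycenter (t : R) : 0 <= t ->
  barycenter (rho t) = \row_j \int[P]_w (flow_position t w 0 j).
Proof.
move=> t0; apply/rowP => j; rewrite !mxE.
exact: (flow_Rintegral t0 (measurable_coor j)).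
Qed.

Lemma flow_weighted_L2norm (t : R) (c : V) : 0 <= t ->
  weighted_L2norm (rho t) (fun y => u t y - c) =
  ((\int[P]_w (enorm (flow_velocity t w - c) ^+ 2)%:E) `^ 2^-1)%E.
Proof.
move=> t0; rewrite /weighted_L2norm; congr (_ `^ _)%E.
under eq_integral do rewrite EFinM.
have m : measurable_fun setT (fun y => (enorm (u t y - c) ^+ 2)%:E).
  apply/measurable_EFinP/measurable_funX/measurable_enorm_comp/measurable_rVB.
    exact: measurable_velocity.
  exact: measurable_cst.
rewrite (flow_integral t0 m) => [|y]; last by rewrite lee_fin sqr_ge0.
by apply: eq_integral => w _; rewrite flow_velocityE.
Qed.

Lemma flow_wasserstein (t : R) (c : V) : 0 <= t ->
  (wasserstein2 (density_measure (rho t)) \d_c <=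
   (\int[P]_w (enorm (flow_position t w - c) ^+ 2)%:E) `^ 2^-1)%E.
Proof.
move=> t0; apply: wasserstein2_dirac_le; first exact: measurable_position.
exact: flow_transport.
Qed.

End lagrangian.

(** * Equilibration *)

Section lyapunov.
Context {R : realType} {n : nat} (W psi : 'rV[R]_n -> R) (phi : R -> R).
Hypothesis W_sym : forall x, W (- x) = W x.
Hypothesis psi_radial : forall x, psi x = phi (enorm x).
Hypothesis phi_noninc : forall r s, 0 < r -> r <= s -> phi s <= phi r.
Variables (rho0 : 'rV[R]_n -> R) (u0 : 'rV[R]_n -> 'rV[R]_n).
Variables (rho : R -> 'rV[R]_n -> R) (u : R -> 'rV[R]_n -> 'rV[R]_n).
Hypothesis sol : classical_solution W psi rho0 u0 rho u.
Hypothesis W_C1 : C1_on setT W.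
Variables lambda Lambda : R.
Hypothesis lambda_gt0 : 0 < lambda.
Hypothesis lambda_le : lambda <= Lambda.
Hypothesis W_convex : forall x y,
      lambda * enorm (x - y) ^+ 2 <= dotrV (grad W x - grad W y) (x - y) /\
      dotrV (grad W x - grad W y) (x - y) <= Lambda * enorm (x - y) ^+ 2.
Variable psi_m : R.
Hypothesis psi_m_gt0 : 0 < psi_m.
Hypothesis psi_lower : forall x, x != 0 -> psi_m <= psi x.

Lemma poweR_half_le (I : \bar R) (y : R) : (0 <= I)%E -> 0 <= y ->
  (I <= y%:E)%E -> (I `^ 2^-1 <= (Num.sqrt y)%:E)%E.
Proof.
move=> I0 y0 Iy; rewrite -powR12_sqrt// -poweR_EFin.
by apply: gt0_ler_poweR => //; rewrite ?in_itv /= ?andbT ?leey ?lee_fin ?invr_ge0 ?I0 ?y0.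
Qed.

(** What the decay of the solution needs to know of the energy; all the rest is
a matter of real functions. *)
Lemma lyapunov_functional : exists E : R -> R,
  [/\ forall t : R, 0 <= t -> 0 <= E t,
      forall s t : R, 0 <= s -> s <= t -> E t <= E s,
      forall a b s t : R, 0 < a -> 0 <= b ->
        (forall z, z != 0 -> psi z * enorm z ^+ 2 <= a * enorm z ^+ 2 + b) ->
        0 <= s -> s <= t ->
        (t - s) * (lambda / (2 * Lambda)) * E t <=
        (2 * (1 + 2 / lambda) + (a / (2 * lambda) + 2 / psi_m)) * E s
        + (t - s) * (lambda * b / (4 * a)) &
      forall t : R, 0 <= t -> (equilibration_error rho0 u0 rho u t <=
        ((Num.sqrt (4 / lambda) + Num.sqrt 2) * Num.sqrt (E t))%:E)%E].
Proof.
have [eta ch] := sol_characteristics sol.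
have flow := flow_of_solution psi_radial phi_noninc W_C1 psi_m_gt0 psi_lower sol ch.
have Lambda_ge0 : 0 <= Lambda by rewrite (le_trans (ltW lambda_gt0)).
have wmeas := measurable_regular_weight psi_m psi_radial phi_noninc.
have weven := weight_even psi_m psi_radial.
have wlow := weight_lower psi_lower.
pose E := energy (initial_law sol) W (flow_position rho0 eta) (flow_velocity rho0 u eta).
have E0 t : 0 <= t -> 0 <= E t.
  exact: (energy_ge0 flow W_C1 W_sym lambda_gt0 W_convex Lambda_ge0 wmeas weven psi_m_gt0 wlow).
exists E; split => //.
- exact: (energy_noninc flow W_C1 W_sym lambda_gt0 W_convex Lambda_ge0 wmeas weven psi_m_gt0 wlow).
- move=> a b s t a0 b0 hab.
  apply: (energy_estimate flow W_C1 W_sym lambda_gt0 W_convex Lambda_ge0 wmeas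
    weven psi_m_gt0 wlow lambda_le a0 b0).
  move=> z; rewrite /regular_weight; case: eqP => [->|/eqP]; last exact: hab.
  by rewrite enorm0 expr0n/= !mulr0 add0r.
move=> t t0; rewrite /equilibration_error mulrDl EFinD; apply: leeD.
  rewrite (flow_barycenter sol ch t0).
  apply: (le_trans (flow_wasserstein sol ch _ t0)).
  rewrite -sqrtrM; last by rewrite divr_ge0// ltW.
  apply: poweR_half_le.
  - by apply: integral_ge0 => w _; rewrite lee_fin sqr_ge0.
  - by rewrite mulr_ge0 ?E0// divr_ge0// ltW.
  - exact: (position_spread flow W_C1 W_sym lambda_gt0 W_convex Lambda_ge0 wmeas
      weven psi_m_gt0 wlow t0).
rewrite -(flow_momentum sol ch) (flow_weighted_L2norm sol ch _ t0) -sqrtrM//.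
apply: poweR_half_le.
- by apply: integral_ge0 => w _; rewrite lee_fin sqr_ge0.
- by rewrite mulr_ge0 ?E0.
- exact: (velocity_spread flow W_C1 W_sym lambda_gt0 W_convex t0).
Qed.

End lyapunov.

Theorem theorem1p3 (R : realType) (d : nat) (hd : (0 < d)%N)
    (W psi : 'rV[R]_d -> R) (phi : R -> R)
    (W_sym : forall x, W (- x) = W x)
    (psi_radial : forall x, psi x = phi (enorm x))
    (phi_ge0 : forall r, 0 < r -> 0 <= phi r)
    (phi_noninc : forall r s, 0 < r -> r <= s -> phi s <= phi r)
    (rho0 : 'rV[R]_d -> R) (u0 : 'rV[R]_d -> 'rV[R]_d)
    (rho : R -> 'rV[R]_d -> R) (u : R -> 'rV[R]_d -> 'rV[R]_d)
    (sol : classical_solution W psi rho0 u0 rho u)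
    (W_C1 : C1_on setT W)
    (lambda Lambda : R) (lambda_gt0 : 0 < lambda) (lambda_le : lambda <= Lambda)
    (W_convex : forall x y,
      lambda * enorm (x - y) ^+ 2 <= dotrV (grad W x - grad W y) (x - y) /\
      dotrV (grad W x - grad W y) (x - y) <= Lambda * enorm (x - y) ^+ 2)
    (psi_m : R) (psi_m_gt0 : 0 < psi_m)
    (psi_lower : forall x, x != 0 -> psi_m <= psi x) :
  ((exists M : R, forall x, psi x <= M) ->
   exists C c : R, [/\ 0 < C, 0 < c & forall t, 0 <= t ->
     (equilibration_error rho0 u0 rho u t <= (C * expR (- (c * t)))%:E)%E])
  /\
  (forall alpha r B : R, 0 < alpha -> alpha < 2 -> 0 < r -> 0 < B ->
   (forall x, x != 0 -> enorm x <= r -> psi x <= B / enorm x `^ alpha) ->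
   exists2 C : R, 0 < C & \forall t \near +oo,
     (equilibration_error rho0 u0 rho u t
      <= (C * t `^ (- (alpha^-1 - 2^-1)))%:E)%E).
Proof.
have [E [E0 Edec Eest Eerr]] := lyapunov_functional W_sym psi_radial phi_noninc sol
  W_C1 lambda_gt0 lambda_le W_convex psi_m_gt0 psi_lower.
have L0 : 0 < Lambda by exact: lt_le_trans lambda_le.
set c0 := lambda / (2 * Lambda) in Eest.
have c00 : 0 < c0 by rewrite divr_gt0// mulr_gt0.
set C0 := Num.sqrt (4 / lambda) + Num.sqrt 2 in Eerr.
have C00 : 0 < C0 by rewrite addr_gt0// sqrtr_gt0// divr_gt0.
pose K := 2 * (1 + 2 / lambda) + 2 / psi_m.
have K0 : 0 < K.
  by apply: addr_gt0; [apply: mulr_gt0 => //; apply: addr_gt0 => // | ]; exact: divr_gt0.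
split.
  (* a bounded weight: b = 0; the maximum with psi_m makes a positive *)
  move=> [M psiM]; pose a := Num.max M psi_m.
  have a0 : 0 < a by rewrite lt_max psi_m_gt0 orbT.
  have k0 : 0 < (K + a / (2 * lambda)) / c0.
    by rewrite divr_gt0// addr_gt0// divr_gt0// mulr_gt0.
  have est s t : 0 <= s -> s <= t -> (t - s) * E t <= (K + a / (2 * lambda)) / c0 * E s.
    move=> s0 st.
    have := Eest a 0 s t a0 (lexx 0) _ s0 st; rewrite mulr0 mul0r mulr0 addr0 => H.
    rewrite mulrAC ler_pdivlMr// mulrAC; apply: (le_trans (H _)).
      by move=> z _; rewrite addr0 ler_wpM2r ?sqr_ge0// le_max psiM.
    by rewrite le_eqVlt /K; apply/orP; left; apply/eqP; ring.
  have := exponential_decay k0 E0 Edec est.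
  set c := (expR 1 * _)^-1 => dec.
  have cp : 0 < c by rewrite invr_gt0 mulr_gt0 ?expR_gt0.
  have e0 : 0 <= expR 1 * E 0 by rewrite mulr_ge0 ?expR_ge0 ?E0.
  exists (C0 * Num.sqrt (expR 1 * E 0) + 1), (c / 2); split.
  - by rewrite ltr_wpDl// mulr_ge0 ?sqrtr_ge0// ltW.
  - by rewrite divr_gt0.
  move=> t t0; apply: (le_trans (Eerr t t0)); rewrite lee_fin.
  have es : expR (- (c * t)) = expR (- (c / 2 * t)) ^+ 2.
    by rewrite expr2 -expRD; congr expR; field.
  have sq : Num.sqrt (E t) <= Num.sqrt (expR 1 * E 0) * expR (- (c / 2 * t)).
    apply: (le_trans (ler_wsqrtr (dec t t0))).
    by rewrite es sqrtrM// sqrtr_sqr ger0_norm ?expR_ge0.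
  apply: (le_trans (ler_wpM2l (ltW C00) sq)).
  by rewrite (mulrDl (C0 * _)) mulrA lerDl mul1r expR_ge0.
move=> alpha r B al0 al2 r0 B0 psiB.
pose K1 := K / c0; pose K2 := B / (2 * lambda) / c0; pose K3 := lambda / 4 / c0.
have K10 : 0 < K1 by rewrite divr_gt0.
have K20 : 0 < K2 by rewrite divr_gt0// divr_gt0// mulr_gt0.
have K30 : 0 < K3 by rewrite divr_gt0// divr_gt0.
have est q s t : 0 < q -> q <= r -> 0 <= s -> s <= t ->
    (t - s) * E t <= (K1 + K2 * q `^ (- alpha)) * E s + (t - s) * (K3 * q ^+ 2).
  move=> q0 qr s0 st.
  have Q0 : 0 < q `^ (- alpha) by rewrite powR_gt0.
  pose a := B * q `^ (- alpha); have a0 : 0 < a by rewrite mulr_gt0.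
  have ab z : z != 0 -> psi z * enorm z ^+ 2 <= a * enorm z ^+ 2 + a * q ^+ 2.
    move=> z0.
    have n0 : 0 < enorm z by rewrite lt_neqAle enorm_ge0 eq_sym enorm_eq0 z0.
    (* beyond distance q, monotonicity bounds the weight by its value at
       distance q, reached at a rescaled z; below, alpha < 2 lets
       |z|^(2 - alpha) increase to q^(2 - alpha) *)
    have [qz|zq] := leP q (enorm z).
      apply: ler_wpDr; first by rewrite mulr_ge0 ?sqr_ge0 ?(ltW a0).
      rewrite ler_wpM2r ?sqr_ge0//.
      pose z' := (q / enorm z) *: z.
      have nz' : enorm z' = q.
        apply/eqP; rewrite -(@eqrXn2 _ 2) ?enorm_ge0 ?(ltW q0)//.
        by rewrite /z' enormZ exprMn exprVn mulfVK// expf_neq0// gt_eqF.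
      have z'0 : z' != 0 by rewrite -enorm_eq0 nz' gt_eqF.
      have := psiB z' z'0; rewrite nz' => /(_ qr); rewrite /a powRN.
      by apply: le_trans; rewrite !psi_radial nz'; exact: phi_noninc.
    apply: ler_wpDl; first by rewrite mulr_ge0 ?sqr_ge0 ?(ltW a0).
    have hz := psiB z z0 (ltW (lt_le_trans zq qr)).
    apply: (le_trans (ler_wpM2r (sqr_ge0 _) hz)).
    rewrite /a -!mulrA ler_pM2l// -powRN -!powR_mulrn ?enorm_ge0 ?(ltW q0)//.
    have nz : enorm z != 0 by rewrite gt_eqF.
    have qn0 : q != 0 by rewrite gt_eqF.
    rewrite -!powRD ?nz ?qn0 ?implybT//.
    by rewrite ge0_ler_powR ?nnegrE ?enorm_ge0 ?(ltW q0) ?(ltW zq)//; lra.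
  have b0 : 0 <= a * q ^+ 2 by rewrite mulr_ge0 ?sqr_ge0 ?(ltW a0).
  have H := Eest a (a * q ^+ 2) s t a0 b0 ab s0 st.
  rewrite -(ler_pM2r c00).
  rewrite (_ : _ * c0 = (t - s) * c0 * E t); last by ring.
  apply: (le_trans H); rewrite le_eqVlt; apply/orP; left; apply/eqP.
  rewrite /K1 /K2 /K3 /K /a; field.
  by rewrite !gt_eqF.
have [A [t0 [A0 t01 dec]]] := algebraic_decay al0 r0 K10 K20 K30 E0 Edec est.
exists (C0 * Num.sqrt A); first by rewrite mulr_gt0// sqrtr_gt0.
near=> t.
have tt0 : t0 <= t by near: t; apply: nbhs_pinfty_ge; exact: num_real.
have t1 : 1 <= t by exact: le_trans tt0.
have tp : 0 <= t by exact: le_trans t1.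
apply: (le_trans (Eerr t tp)); rewrite lee_fin -mulrA ler_pM2l//.
apply: (le_trans (ler_wsqrtr (dec t tt0))).
rewrite sqrtrM ?(ltW A0)// sqrtr_sqr ger0_norm ?powR_ge0// ler_wpM2l ?sqrtr_ge0//.
by apply: ler_powR => //; lra.
Unshelve. all: by end_near. Qed.
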